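(* Suppose $\Omega \subset \mathbb{P}(\mathbb{R}^d)$ is a properly convex domain, $\Gamma \leq \mathrm{Aut}(\Omega)$ is convex co-compact, $A \leq \Gamma$ is an infinite Abelian subgroup, and $Z_\Gamma(A)$ is the centralizer of $A$ in $\Gamma$. If $$V := \mathrm{Span}\left\{ x \in \overline{\mathcal{C}_\Omega(\Gamma)} : ax=x \text{ for all } a \in A\right\},$$ then (1) $\Omega \cap \mathbb{P}(V)$ is a non-empty $Z_\Gamma(A)$-invariant properly convex domain in $\mathbb{P}(V)$, (2) $\Omega\cap\mathbb{P}(V)\subset\mathcal{C}_\Omega(\Gamma)$, (3) the quotient $Z_\Gamma(A) \backslash (\Omega \cap \mathbb{P}(V))$ is compact, and (4) there exist a non-trivial $Z_\Gamma(A)$-invariant direct sum decomposition $V=\bigoplus_{j=1}^m V_j$ and properly convex domains $F_j\subset\mathbb{P}(V_j)$ such that $A$ acts by scaling on each $V_j$ and $$\Omega\cap\mathbb{P}(V)=\mathrm{relint}\left(\mathrm{ConvHull}_{\overline{\Omega}}\Big(\bigcup_{j=1}^m F_j\Big)\right).$$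
   Context: A properly convex domain is an open subset $\Omega \subset \mathbb{P}(\mathbb{R}^d)$ which is a bounded convex subset of some affine chart (similarly in $\mathbb{P}(V)$ for a linear subspace $V$; if $\dim V=1$ the point $\mathbb{P}(V)$ is a properly convex domain in $\mathbb{P}(V)$); $\mathrm{Aut}(\Omega) := \{ g \in \mathrm{PGL}_d(\mathbb{R}) : g\Omega = \Omega\}$. For a subgroup $\Gamma \leq \mathrm{Aut}(\Omega)$, $\mathcal{L}_\Omega(\Gamma)$ is the set of all $x \in \partial\Omega$ for which there exist $p \in \Omega$ and a sequence $(g_n)$ in $\Gamma$ with $g_n(p) \to x$; $\mathcal{C}_\Omega(\Gamma)$ is the convex hull of $\mathcal{L}_\Omega(\Gamma)$ in $\Omega$ (the convex hull in $\overline{\Omega}$, intersected with $\Omega$). An infinite discrete subgroup $\Gamma \leq \mathrm{Aut}(\Omega)$ is convex co-compact if $\mathcal{C}_\Omega(\Gamma)$ is non-empty and $\Gamma$ acts co-compactly on it. For $X\subset\mathbb{P}(\mathbb{R}^d)$ non-empty, $\mathrm{Span}\,X\subset\mathbb{R}^d$ is the smallest linear subspace whose projectivization contains $X$. For $X\subset\overline{\Omega}$, $\mathrm{ConvHull}_{\overline{\Omega}}(X)$ is the smallest convex subset of $\overline{\Omega}$ containing $X$ (so in (4) one has $F_j \subset \overline{\Omega}$). For a properly convex set $C$, $\mathrm{relint}(C)$ is its interior in $\mathbb{P}(\mathrm{Span}\,C)$. A decomposition is non-trivial if $m\geq 2$ and every $V_j\neq\{0\}$; it is $Z_\Gamma(A)$-invariant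 if each $V_j$ is invariant under (lifts of) elements of $Z_\Gamma(A)$. $A$ acts by scaling on $V_j$ if any lift to $\mathrm{GL}_d(\mathbb{R})$ of any element of $A$ acts on $V_j$ as a scalar multiple of the identity. *)

(* Defs.v *)
From HB Require Import structures.
From mathcomp Require Import all_boot all_order all_algebra generic_quotient.
From mathcomp Require Import all_classical all_reals all_analysis.

Set Implicit Arguments.
Unset Strict Implicit.
Unset Printing Implicit Defensive.

Import Order.TTheory GRing.Theory Num.Theory.
Import numFieldNormedType.Exports.

Local Open Scope classical_set_scope.
Local Open Scope ring_scope.
Local Open Scope quotient_scope.

Section ProjectiveSpace.
Context (R : realType) (d : nat).

Definition nonzero_vec := set_type [set v : 'cV[R]_d | v != 0].
HB.instance Definition _ := Choice.on nonzero_vec.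
HB.instance Definition _ := Topological.on nonzero_vec.

Definition collinear (u v : nonzero_vec) : bool :=
  `[< exists2 c : R, c != 0 & \val u = c *: \val v >].

Lemma collinear_refl : reflexive collinear.
Proof. by move=> u; apply/asboolP; exists 1; rewrite ?oner_eq0 ?scale1r. Qed.

Lemma collinear_sym : symmetric collinear.
Proof.
move=> u v; apply/asboolP/asboolP => -[c c0 e]; exists c^-1;
  by rewrite ?invr_eq0 // e scalerA mulVf ?scale1r.
Qed.

Lemma collinear_trans : transitive collinear.
Proof.
move=> v u w /asboolP[a a0 ea] /asboolP[b b0 eb]; apply/asboolP.
by exists (a * b); rewrite ?mulf_neq0 // ea eb scalerA.
Qed.

Canonical collinear_equiv :=
  EquivRel collinear collinear_refl collinear_sym collinear_trans.

Definition proj_space := quotient_topology {eq_quot collinear}.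
HB.instance Definition _ := Choice.on proj_space.
HB.instance Definition _ := Topological.on proj_space.
HB.instance Definition _ := Quotient.on proj_space.

Definition pt_vec (x : proj_space) : 'cV[R]_d := \val (repr x : nonzero_vec).

Lemma pt_vec_neq0 x : pt_vec x != 0.
Proof. exact: set_mem (valP (repr x : nonzero_vec)). Qed.

Definition pt_of (v : 'cV[R]_d) (v0 : v != 0) : proj_space :=
  \pi_proj_space (exist _ v (mem_set v0) : nonzero_vec).

Lemma eq_projP (u v : nonzero_vec) :
  \pi_proj_space u = \pi_proj_space v <->
  exists2 c : R, c != 0 & \val u = c *: \val v.
Proof. by split => [/eqmodP/asboolP//|e]; apply/eqmodP/asboolP. Qed.

Lemma pt_vec_pi (u : nonzero_vec) :
  exists2 c : R, c != 0 & pt_vec (\pi_proj_space u) = c *: \val u.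
Proof. by apply/eq_projP; rewrite reprK. Qed.

Definition proj_of (V : {vspace 'cV[R]_d}) : set proj_space :=
  [set x | pt_vec x \in V].

Definition is_span (X : set proj_space) (V : {vspace 'cV[R]_d}) : Prop :=
  X `<=` proj_of V /\
  forall W : {vspace 'cV[R]_d}, X `<=` proj_of W -> (V <= W)%VS.

Definition Span (X : set proj_space) : {vspace 'cV[R]_d} :=
  xget fullv [set V | is_span X V].

Lemma SpanP (X : set proj_space) : is_span X (Span X).
Proof.
rewrite /Span; case: xgetP => [V -> //|none]; exfalso.
pose P n := `[< exists2 V, X `<=` proj_of V & \dim V = n >].
have exP : exists n, P n.
  by exists (\dim {:'cV[R]_d}); apply/asboolP; exists fullv => // x _;
     rewrite /proj_of /= memvf.
case: (ex_minnP exP) => n /asboolP[V XV dimV] minn.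
apply: (none V); split => // W XW.
have /minn : P (\dim (V :&: W)).
  by apply/asboolP; exists (V :&: W)%VS => // x Xx;
     rewrite /proj_of /= memv_cap (XV x Xx) (XW x Xx).
rewrite -dimV => le_dim; apply/capv_idPl/eqP.
by rewrite eqEdim capvSl le_dim.
Qed.

End ProjectiveSpace.

Section ProjectiveLinearGroup.
Context (R : realType) (d : nat).

Definition GL := set_type [set g : 'M[R]_d | g \in unitmx].
HB.instance Definition _ := Choice.on GL.
HB.instance Definition _ := Topological.on GL.

Definition mkGL (g : 'M[R]_d) (gu : g \in unitmx) : GL :=
  exist _ g (mem_set (gu : [set g : 'M[R]_d | g \in unitmx] g)).

Lemma GL_unit (g : GL) : \val g \in unitmx.
Proof. exact: set_mem (valP g). Qed.

Lemma GL_mul_unit (g h : GL) : \val g *m \val h \in unitmx.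
Proof. by rewrite unitmx_mul !GL_unit. Qed.

Lemma GL_inv_unit (g : GL) : invmx (\val g) \in unitmx.
Proof. by rewrite unitmx_inv GL_unit. Qed.

Definition GL_one : GL := mkGL (unitmx1 R d).
Definition GL_mul (g h : GL) : GL := mkGL (GL_mul_unit g h).
Definition GL_inv (g : GL) : GL := mkGL (GL_inv_unit g).

Definition homothetic (g h : GL) : bool :=
  `[< exists2 c : R, c != 0 & \val g = c *: \val h >].

Lemma homothetic_refl : reflexive homothetic.
Proof. by move=> u; apply/asboolP; exists 1; rewrite ?oner_eq0 ?scale1r. Qed.

Lemma homothetic_sym : symmetric homothetic.
Proof.
move=> u v; apply/asboolP/asboolP => -[c c0 e]; exists c^-1;
  by rewrite ?invr_eq0 // e scalerA mulVf ?scale1r.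
Qed.

Lemma homothetic_trans : transitive homothetic.
Proof.
move=> v u w /asboolP[a a0 ea] /asboolP[b b0 eb]; apply/asboolP.
by exists (a * b); rewrite ?mulf_neq0 // ea eb scalerA.
Qed.

Canonical homothetic_equiv :=
  EquivRel homothetic homothetic_refl homothetic_sym homothetic_trans.

Definition PGL := quotient_topology {eq_quot homothetic}.
HB.instance Definition _ := Choice.on PGL.
HB.instance Definition _ := Topological.on PGL.
HB.instance Definition _ := Quotient.on PGL.

Lemma eq_PGLP (g h : GL) :
  \pi_PGL g = \pi_PGL h <-> exists2 c : R, c != 0 & \val g = c *: \val h.
Proof. by split => [/eqmodP/asboolP//|e]; apply/eqmodP/asboolP. Qed.

Lemma repr_piPGL (g : GL) :
  exists2 c : R, c != 0 & \val (repr (\pi_PGL g) : GL) = c *: \val g.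
Proof. by apply/eq_PGLP; rewrite reprK. Qed.

(* Operations on PGL and its action on points are computed on representatives;
   piPGL_mul, piPGL_inv and pactE show independence of this choice. *)
Definition PGL_one : PGL := \pi_PGL GL_one.
Definition PGL_mul (x y : PGL) : PGL := \pi_PGL (GL_mul (repr x) (repr y)).
Definition PGL_inv (x : PGL) : PGL := \pi_PGL (GL_inv (repr x)).

Lemma piPGL_mul (g h : GL) :
  PGL_mul (\pi_PGL g) (\pi_PGL h) = \pi_PGL (GL_mul g h).
Proof.
have [a a0 ea] := repr_piPGL g; have [b b0 eb] := repr_piPGL h.
apply/eq_PGLP; exists (a * b); rewrite ?mulf_neq0 //=.
by rewrite ea eb -scalemxAl -scalemxAr scalerA.
Qed.

Lemma piPGL_inv (g : GL) : PGL_inv (\pi_PGL g) = \pi_PGL (GL_inv g).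
Proof.
have [a a0 ea] := repr_piPGL g.
apply/eq_PGLP; exists a^-1; rewrite ?invr_eq0 //= ea.
by rewrite invmxZ // unitmxZ ?unitfE // GL_unit.
Qed.

Lemma PGL_ind (P : PGL -> Prop) : (forall g, P (\pi_PGL g)) -> forall x, P x.
Proof. by move=> H x; rewrite -[x]reprK. Qed.

Lemma PGL_mulA : associative PGL_mul.
Proof.
elim/PGL_ind=> x; elim/PGL_ind=> y; elim/PGL_ind=> z; rewrite !piPGL_mul.
by congr (\pi_PGL _); apply: val_inj; rewrite /= mulmxA.
Qed.

Lemma PGL_mul1 : left_id PGL_one PGL_mul.
Proof.
elim/PGL_ind=> x; rewrite piPGL_mul.
by congr (\pi_PGL _); apply: val_inj; rewrite /= mul1mx.
Qed.

Lemma PGL_mulr1 : right_id PGL_one PGL_mul.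
Proof.
elim/PGL_ind=> x; rewrite piPGL_mul.
by congr (\pi_PGL _); apply: val_inj; rewrite /= mulmx1.
Qed.

Lemma PGL_mulV : left_inverse PGL_one PGL_inv PGL_mul.
Proof.
elim/PGL_ind=> x; rewrite piPGL_inv piPGL_mul.
by congr (\pi_PGL _); apply: val_inj; rewrite /= mulVmx ?GL_unit.
Qed.

Lemma PGL_mulrV : right_inverse PGL_one PGL_inv PGL_mul.
Proof.
elim/PGL_ind=> x; rewrite piPGL_inv piPGL_mul.
by congr (\pi_PGL _); apply: val_inj; rewrite /= mulmxV ?GL_unit.
Qed.

HB.instance Definition _ :=
  isGroup.Build PGL PGL_mulA PGL_mul1 PGL_mulr1 PGL_mulV PGL_mulrV.

Lemma GL_act_neq0 (g : GL) (v : 'cV[R]_d) : v != 0 -> \val g *m v != 0.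
Proof.
apply: contraNneq => gv0.
by rewrite -[v](mulKmx (GL_unit g)) gv0 mulmx0.
Qed.

Definition pact (g : PGL) (x : proj_space R d) : proj_space R d :=
  pt_of (GL_act_neq0 (repr g) (pt_vec_neq0 x)).

Lemma pactE (g : GL) (v : 'cV[R]_d) (v0 : v != 0) :
  pact (\pi_PGL g) (pt_of v0) = pt_of (GL_act_neq0 g v0).
Proof.
have [a a0 ea] := repr_piPGL g.
have [b b0 eb] := pt_vec_pi (exist _ v (mem_set v0) : nonzero_vec R d).
apply/eq_projP; exists (a * b); rewrite ?mulf_neq0 //=.
by rewrite ea eb -scalemxAl -scalemxAr scalerA.
Qed.

End ProjectiveLinearGroup.

Section Actions.
Context (R : realType) (d : nat).
Implicit Types (G H : set (PGL R d)) (X : set (proj_space R d)).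

Definition is_subgroup G : Prop := group_closed (mem G).

Definition discrete_set G : Prop := G `<=` isolated G.

Definition centralizer G H : set (PGL R d) :=
  [set g | G g /\ forall h, H h -> commute g h].

Definition abelian_set G : Prop := forall g h, G g -> G h -> commute g h.

Definition orbit G (x : proj_space R d) : set (proj_space R d) :=
  [set pact g x | g in G].

Definition invariant_under G X : Prop :=
  forall g, G g -> pact g @` X = X.

(* Points of X are compared through their whole orbits, so that this is an
   equivalence relation for an arbitrary set G; for a subgroup G it says that
   some g in G maps x to y. *)
Definition same_orbit G X (x y : X) : bool :=
  `[< orbit G (\val x) = orbit G (\val y) >].

Lemma same_orbit_refl G X : reflexive (@same_orbit G X).
Proof. by move=> x; apply/asboolP. Qed.

Lemma same_orbit_sym G X : symmetric (@same_orbit G X).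
Proof. by move=> x y; apply/asboolP/asboolP. Qed.

Lemma same_orbit_trans G X : transitive (@same_orbit G X).
Proof. by move=> y x z /asboolP e /asboolP f; apply/asboolP; rewrite e. Qed.

Canonical same_orbit_equiv G X := EquivRel (@same_orbit G X)
  (@same_orbit_refl G X) (@same_orbit_sym G X) (@same_orbit_trans G X).

(* G \ X: the quotient of the subspace topology on X. *)
Definition orbit_space G X :=
  quotient_topology {eq_quot (@same_orbit G X)}.
HB.instance Definition _ G X := Topological.on (orbit_space G X).

Definition compact_quotient G X : Prop := compact [set: orbit_space G X].

End Actions.

Section Convexity.
Context (R : realType) (d : nat).
Implicit Types (X C Omega : set (proj_space R d)) (f : 'rV[R]_d).

(* The affine chart of a nonzero functional f is the complement of the
   hyperplane P(ker f), identified with {v | f v = 1} by affine_coord f. *)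
Definition affine_chart f : set (proj_space R d) :=
  [set x | (f *m pt_vec x) ord0 ord0 != 0].

Definition affine_coord f (x : proj_space R d) : 'cV[R]_d :=
  ((f *m pt_vec x) ord0 ord0)^-1 *: pt_vec x.

Definition proj_convex C : Prop :=
  exists2 f, f != 0 &
    C `<=` affine_chart f /\ convex_set (affine_coord f @` C).

Definition properly_convex C : Prop :=
  exists2 f, f != 0 &
    [/\ C `<=` affine_chart f, convex_set (affine_coord f @` C)
      & bounded_set (affine_coord f @` C)].

Definition properly_convex_domain_in (V : {vspace 'cV[R]_d}) X : Prop :=
  [/\ X `<=` proj_of V, open (X : set (subspace (proj_of V)))
    & properly_convex X].

Definition properly_convex_domain Omega : Prop :=
  open Omega /\ properly_convex Omega.

Definition conv_hull Omega X : set (proj_space R d) :=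
  smallest [set C | proj_convex C /\ C `<=` closure Omega] X.

Definition relint C : set (proj_space R d) :=
  (C : set (subspace (proj_of (Span C))))°.

Definition Aut Omega : set (PGL R d) := [set g | pact g @` Omega = Omega].

Definition limit_set Omega (G : set (PGL R d)) : set (proj_space R d) :=
  [set x | (closure Omega `\` Omega°) x /\
    exists p (g : nat -> PGL R d),
      [/\ Omega p, forall n, G (g n) & pact (g n) p @[n --> \oo] --> x]].

Definition limit_core Omega (G : set (PGL R d)) : set (proj_space R d) :=
  conv_hull Omega (limit_set Omega G) `&` Omega.

Definition convex_cocompact Omega (G : set (PGL R d)) : Prop :=
  [/\ is_subgroup G, G `<=` Aut Omega, infinite_set G & discrete_set G] /\
  (limit_core Omega G !=set0 /\ compact_quotient G (limit_core Omega G)).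

Definition fixed_points (G : set (PGL R d)) X : set (proj_space R d) :=
  [set x | X x /\ forall g, G g -> pact g x = x].

Definition lift_invariant (G : set (PGL R d)) (V : {vspace 'cV[R]_d}) : Prop :=
  forall h : GL R d, G (\pi_(PGL R d) h) ->
    forall v, v \in V -> \val h *m v \in V.

Definition acts_by_scaling (G : set (PGL R d)) (V : {vspace 'cV[R]_d}) : Prop :=
  forall h : GL R d, G (\pi_(PGL R d) h) ->
    exists c : R, forall v, v \in V -> \val h *m v = c *: v.

End Convexity.

(* Main.v *)
From mathcomp Require Import all_boot all_order all_algebra.
From mathcomp Require Import all_classical all_reals all_analysis.
From mathcomp Require Import unstable lra ring.
Require Import Defs.

(** Everything is read on the convex cone [O] over the domain in a bounded affine
chart: elements of the automorphism group lift to matrices preserving [O],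
unique up to positive scalars, the group [G] of lifts of Gamma acts properly on
[O] modulo scalars, and it acts cocompactly on the cone [C] over the convex core
of the limit set.  The fixed points of [A] in the closed core are the rays of
simultaneous eigenvectors of [A], called eigenrays, and [V] is their span.

The engine is a recurrence property of the centralizer [Z] of [A]
([centralizer_recurrence]).  Given points of the core which finitely many
elements spanning [A] displace by a bounded amount, bring them back to a compact
set by elements [g k] of [G]; the conjugates of these elements of [A] by [g k]
stay bounded, hence take finitely many values by discreteness, and quotients of
the [g k] with the same values lie in [Z].  So [Z] is cocompact on the points
of bounded displacement.

These points form a closed convex cone, invariant under [Z].  By Zorn's lemma it
contains a minimal invariant closed convex cone reaching the interior of [O].
A farthest point of a slice of this minimal cone from any given centre is
extreme, and it is a limit of the orbit of an interior point under maps
commuting with [A], which forces it to be an eigenray ([extremal_eigenray]).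
Moving the centre to infinity and separating convex sets, one finds that a sum
of eigenrays lies in [O] ([interior_eigensum]): the domain meets [V].

The space [V] splits into simultaneous eigenspaces [W j] on which [A] acts by
pairwise distinct positive characters, with projections commuting with [Z]
([joint_eigenspaces_exist]).  The face of [O] generated by a ray of [W j] lies in
[W j] as far as [V] is concerned ([face_in_eigenspace]).  Approaching a
relatively interior ray of the core in [W j] from the inside of [O], the inverse
recurrence maps degenerate to an endomorphism sending the points of [O] in [V]
into the face of this ray; as the images are limit points of the group, they
belong to the closed core.  Hence
all components of all points of [O] in [V] belong to the closed core
([interior_components]).  This single fact gives the rest: such points are sums
of their components, so they lie in the core; they have bounded displacement, so
[Z] acts cocompactly on them; and the components sweep out the factors [F j], of
which the domain in [V] is the relative interior of the convex hull
([domain_subspace_join]).  There are at least two factors because an infinite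
discrete group fixes no point of the domain ([no_fixed_point]). *)

Set Implicit Arguments.
Unset Strict Implicit.
Unset Printing Implicit Defensive.

Import Order.TTheory GRing.Theory Num.Theory.
Import numFieldNormedType.Exports.

Local Open Scope classical_set_scope.
Local Open Scope ring_scope.

(** * Limits of matrices along ultrafilters *)

Section MatrixLimits.
Context (R : realType) (T : Type) (F : set_system T) {FF : Filter F}.

Lemma mx_entry_le m n (A : 'M[R]_(m, n)) i j : `|A i j| <= `|A|.
Proof.
rewrite [leRHS]/Num.norm /= mx_normrE; apply/bigmax_geP; right => /=.
by exists (i, j).
Qed.

Lemma mx_norm_le m n (A : 'M[R]_(m, n)) (b : R) :
  0 <= b -> (forall i j, `|A i j| <= b) -> `|A| <= b.
Proof.
move=> b0 Ab; rewrite [leLHS]/Num.norm /= mx_normrE; apply/bigmax_leP; split => // -[i j].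
Qed.

Lemma cvg_mxP m n (x : T -> 'M[R]_(m, n)) (l : 'M[R]_(m, n)) :
  x t @[t --> F] --> l <-> forall i j, x t i j @[t --> F] --> l i j.
Proof.
split=> [xl i j|xl].
  by apply: (cvg_comp _ _ xl (@coord_continuous R m n i j l)).
apply/cvgrPdist_le => e e0.
have H : \forall t \near F, forall i, forall j, `|l i j - x t i j| <= e.
  apply: filter_forall => i; apply: filter_forall => j.
  by move/cvgrPdist_le : (xl i j); exact.
apply: filterS H => t H; apply: mx_norm_le; first exact: ltW.
by move=> i j; rewrite !mxE.
Qed.

Lemma cvg_mulmx m n p (A : T -> 'M[R]_(m, n)) (B : T -> 'M[R]_(n, p))
    (a : 'M[R]_(m, n)) (b : 'M[R]_(n, p)) :
  A t @[t --> F] --> a -> B t @[t --> F] --> b ->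
  A t *m B t @[t --> F] --> a *m b.
Proof.
move=> /cvg_mxP Aa /cvg_mxP Bb; apply/cvg_mxP => i j.
under eq_cvg do rewrite mxE.
rewrite mxE; apply: cvg_big => [|k _]; first exact: add_continuous.
apply: cvgM; [exact: Aa|exact: Bb].
Qed.

Lemma cvg_mulmxr m n p (A : 'M[R]_(m, n)) (B : T -> 'M[R]_(n, p)) (b : 'M[R]_(n, p)) :
  B t @[t --> F] --> b -> A *m B t @[t --> F] --> A *m b.
Proof. by move=> Bb; apply: cvg_mulmx Bb; exact: cvg_cst. Qed.

End MatrixLimits.

Lemma cvg_ler (R : realType) (T : Type) (F : set_system T) {FF : ProperFilter F}
    (x y : T -> R) (a c : R) :
  x t @[t --> F] --> a -> y t @[t --> F] --> c ->
  (\forall t \near F, x t <= y t) -> a <= c.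
Proof.
move=> xa yc xy; rewrite -subr_ge0; apply: (cvgr_to_ge (cvgB yc xa)).
by apply: filterS xy => t; rewrite /= subr_ge0.
Qed.

(** Limits are taken along a fixed free ultrafilter: every bounded sequence of
matrices converges along it, so the recurrence arguments below never have to
pass to nested subsequences. *)
Section UltraLimits.
Context (R : realType).

Lemma free_ultrafilter :
  exists F : set_system nat, UltraFilter F /\ eventually `<=` F.
Proof. exact: ultraFilterLemma. Qed.

Context (T : Type) (F : set_system T) {FU : UltraFilter F}.

Lemma ultra_bounded_real (x : T -> R) (b : R) :
  (\forall k \near F, `|x k| <= b) -> exists l : R, x k @[k --> F] --> l.
Proof.
move=> xb.
have cI : compact `[(- b), b]%classic by exact: segment_compact.
have Fx : fmap x F `[(- b), b]%classic.
  by apply: filterS xb => k; rewrite /= in_itv /= ler_norml.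
have [l [_ cl]] := cI (fmap x F) _ Fx.
exists l => U nU /=.
have [//|FnU] := in_ultra_setVsetC (x @^-1` U) FU.
have [y [/= nUy Uy]] := cl (~` U) U FnU nU.
by [].
Qed.

Lemma ultra_bounded_cvg m n (x : T -> 'M[R]_(m, n)) (b : R) :
  (\forall k \near F, `|x k| <= b) -> exists l : 'M[R]_(m, n), x k @[k --> F] --> l.
Proof.
move=> xb.
have H i j : exists l : R, x k i j @[k --> F] --> l.
  apply: (@ultra_bounded_real _ b).
  by apply: filterS xb => k; apply: le_trans; exact: mx_entry_le.
pose l := \matrix_(i, j) xget (0 : R) [set r : R | x k i j @[k --> F] --> r].
exists l; apply/cvg_mxP => i j; rewrite mxE.
by have := xgetPex (0 : R) (H i j).
Qed.

End UltraLimits.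

Lemma bounded_closed_compact_mx (R : realType) m n (A : set 'M[R]_(m, n)) (b : R) :
  (forall v, A v -> `|v| <= b) -> closed A -> compact A.
Proof.
move=> Ab cA; rewrite compact_ultra => F FU FA.
have [|l Fl] := @ultra_bounded_cvg R _ F FU m n id b; first exact: filterS FA.
by exists l; split => //; exact: (closed_cvg _ cA) Fl.
Qed.

Section Sequences.
Context (R : realType) (m n : nat).

Lemma closure_seq (A : set 'M[R]_(m, n)) v : closure A v ->
  exists u : nat -> 'M[R]_(m, n),
    (forall k, A (u k)) /\ u k @[k --> \oo] --> v.
Proof.
move=> clA.
have H k : exists w, A w /\ `|v - w| < k.+1%:R^-1.
  have [w []] := clA _ (nbhsx_ballx v k.+1%:R^-1 ltac:(by rewrite invr_gt0 ltr0Sn)).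
  by rewrite -ball_normE /= => Aw vw; exists w.
exists (fun k => xget 0 [set w | A w /\ `|v - w| < k.+1%:R^-1]).
have G k := xgetPex 0 (H k); split => [k|]; first by case: (G k).
apply/cvgrPdist_lt => e e0.
near=> k; apply: lt_trans (proj2 (G k)) _.
rewrite invf_plt ?posrE//.
apply: lt_le_trans (_ : k%:R <= _); last by rewrite ler_nat.
near: k; exact: nbhs_infty_gtr.
Unshelve. all: by end_near. Qed.

Lemma closed_lim (T : Type) (F : set_system T) {FF : ProperFilter F}
    (A : set 'M[R]_(m, n)) (u : T -> 'M[R]_(m, n)) v :
  closed A -> (\forall k \near F, A (u k)) -> u k @[k --> F] --> v -> A v.
Proof. by move=> cA Au uv; apply: (closed_cvg _ cA) uv. Qed.

Lemma closure_lim (T : Type) (F : set_system T) {FF : ProperFilter F}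
    (A : set 'M[R]_(m, n)) (u : T -> 'M[R]_(m, n)) v :
  (\forall k \near F, closure A (u k)) -> u k @[k --> F] --> v -> closure A v.
Proof. by move=> Au uv; apply: (closed_cvg _ (@closed_closure _ A)) uv. Qed.

Lemma cvg_closure (T : Type) (F : set_system T) {FF : ProperFilter F}
    (A : set 'M[R]_(m, n)) (u : T -> 'M[R]_(m, n)) v :
  (\forall k \near F, A (u k)) -> u k @[k --> F] --> v -> closure A v.
Proof.
move=> Au uv; apply: (closure_lim (u := u)) uv.
by apply: filterS Au => k; exact: subset_closure.
Qed.

End Sequences.

(** * Sharp cones *)

Section Functional.
Context (R : realType) (d : nat) (f : 'rV[R]_d).
Definition ev (v : 'cV[R]_d) : R := (f *m v) ord0 ord0.

Lemma evD u v : ev (u + v) = ev u + ev v.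
Proof. by rewrite /ev mulmxDr mxE. Qed.

Lemma evZ c v : ev (c *: v) = c * ev v.
Proof. by rewrite /ev -scalemxAr mxE. Qed.

Lemma evN v : ev (- v) = - ev v.
Proof. by rewrite /ev mulmxN mxE. Qed.

Lemma evB u v : ev (u - v) = ev u - ev v.
Proof. by rewrite evD evN. Qed.

Lemma ev0 : ev 0 = 0.
Proof. by rewrite /ev mulmx0 mxE. Qed.

Lemma cvg_ev (T : Type) (F : set_system T) {FF : Filter F}
    (x : T -> 'cV[R]_d) (l : 'cV[R]_d) :
  x t @[t --> F] --> l -> ev (x t) @[t --> F] --> ev l.
Proof.
move=> xl; have H : f *m x t @[t --> F] --> f *m l by exact: cvg_mulmxr.
exact: (proj1 (cvg_mxP _ _) H).
Qed.

End Functional.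
Arguments cvg_ev {R d} f {T F FF x l}.

(** The cone over a properly convex domain.  The last field says that the slice
[ev f = 1] is bounded, which is what makes the cone contain no line. *)
Record sharp_cone (R : realType) (d : nat) (f : 'rV[R]_d) (b : R)
    (O : set 'cV[R]_d) : Prop := SharpCone {
  cone_nonempty : O !=set0;
  cone_open : open O;
  coneD : forall u v, O u -> O v -> O (u + v);
  coneZ : forall c v, 0 < c -> O v -> O (c *: v);
  cone_gt0 : forall v, O v -> 0 < ev f v;
  cone_bound0 : 0 <= b;
  cone_bound : forall v, O v -> `|v| <= b * ev f v }.

Section SharpCone.
Context (R : realType) (d : nat) (f : 'rV[R]_d) (b : R) (O : set 'cV[R]_d).
Context (hO : sharp_cone f b O).
Local Notation K := (closure O).

Lemma cone_ball w : O w ->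
  exists2 e, 0 < e & forall u, `|u| <= e -> O (w + u).
Proof.
move=> Ow; have /nbhs_ballP[e /= e0 eO] := open_nbhs_nbhs (conj (cone_open hO) Ow).
exists (e / 2); first by rewrite divr_gt0.
move=> u ue; apply: eO; rewrite -ball_normE /= opprD addrA subrr add0r normrN.
by rewrite (le_lt_trans ue)// ltr_pdivrMr// ltr_pMr// ltr1n.
Qed.

Lemma cone_absorb w u : O w -> exists2 e, 0 < e & O (w + e *: u).
Proof.
move=> /cone_ball[e e0 eO]; exists (e / (`|u| + 1)).
  by rewrite divr_gt0// ltr_wpDl.
apply: eO; rewrite normrZ gtr0_norm ?divr_gt0 ?ltr_wpDl//.
by rewrite -mulrA ler_piMr// ?(ltW e0)// ler_pdivrMl ?ltr_wpDl// mulr1 lerDl.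
Qed.

Lemma cone_closureP v : K v <-> exists u : nat -> 'cV[R]_d,
  (forall k, O (u k)) /\ u k @[k --> \oo] --> v.
Proof.
split=> [/closure_seq//|[u [Ou uv]]].
by apply: cvg_closure uv; exact: nearW.
Qed.

Lemma clconeD u v : K u -> K v -> K (u + v).
Proof.
move=> /cone_closureP[x [Ox xu]] /cone_closureP[y [Oy yv]]; apply/cone_closureP.
by exists (fun k => x k + y k); split; [move=> k; exact: coneD hO _ _ _ _|exact: cvgD].
Qed.

Lemma clcone0 : K 0.
Proof.
have [v Ov] := cone_nonempty hO; apply/cone_closureP.
exists (fun k => harmonic k *: v); split.
  by move=> k; apply: (coneZ hO) => //; rewrite invr_gt0.
by rewrite -(scale0r v); apply: cvgZr_tmp; exact: cvg_harmonic.
Qed.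

Lemma clconeZ c v : 0 <= c -> K v -> K (c *: v).
Proof.
rewrite le_eqVlt => /orP[/eqP <- _|c0]; first by rewrite scale0r; exact: clcone0.
move=> /cone_closureP[x [Ox xu]]; apply/cone_closureP.
exists (fun k => c *: x k); split; first by move=> k; exact: (coneZ hO).
exact: cvgZl_tmp.
Qed.

Lemma clcone_ge0 v : K v -> 0 <= ev f v.
Proof.
move=> /cone_closureP[x [Ox xu]].
apply: (cvgr_to_ge (cvg_ev f xu)).
by apply: nearW => k; apply/ltW/(cone_gt0 hO)/Ox.
Qed.

Lemma clcone_bound v : K v -> `|v| <= b * ev f v.
Proof.
move=> /cone_closureP[x [Ox xu]].
apply: (cvg_ler (cvg_norm xu) (cvgMl_tmp (cvg_ev f xu))).
by apply: nearW => k; apply/(cone_bound hO)/Ox.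
Qed.

Lemma cone_clcone v : O v -> K v.
Proof. exact: subset_closure. Qed.

Lemma coneDcl u v : K u -> O v -> O (u + v).
Proof.
move=> /cone_closureP[x [Ox xu]] /cone_ball[e e0 eO].
have /cvgrPdist_le/(_ e e0) := xu; case => N _ /(_ N (leqnn N)) /= uxN.
rewrite -(subrK (x N) u) -addrA addrC -addrA; apply: coneD hO _ _ (Ox N) _.
exact: eO.
Qed.

Lemma clcone_antisym v : K v -> K (- v) -> v = 0.
Proof.
move=> Kv KNv; apply/eqP; rewrite -normr_le0.
apply: le_trans (clcone_bound Kv) _; rewrite mulr_ge0_le0 ?(cone_bound0 hO)//.
by move/clcone_ge0: KNv; rewrite evN oppr_ge0.
Qed.

Lemma cone_neq0 v : O v -> v != 0.
Proof.
by move=> Ov; apply/eqP => v0; have := cone_gt0 hO Ov; rewrite v0 ev0 ltxx.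
Qed.

Lemma clcone_gt0 v : K v -> v != 0 -> 0 < ev f v.
Proof.
move=> Kv v0; rewrite lt_neqAle clcone_ge0// andbT eq_sym.
apply: contra_neq v0 => /= v0; apply/eqP; rewrite -normr_le0.
by rewrite (le_trans (clcone_bound Kv))// v0 mulr0.
Qed.

(** In the order defined by the cone, [0 <= u <= w] gives [ev f u <= ev f w], and
[ev f] controls the norm. *)
Lemma interval_bound u w : K u -> K (w - u) -> `|u| <= b * ev f w.
Proof.
move=> Ku Kwu; apply: le_trans (clcone_bound Ku) _.
rewrite ler_wpM2l ?(cone_bound0 hO)//.
by rewrite -subr_ge0 -evB; exact: clcone_ge0.
Qed.

Lemma symmetric_interval_bound u w : K (w + u) -> K (w - u) ->
  `|u| <= 3 * b * ev f w.
Proof.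
move=> Kp Km.
have wE : w = 2^-1 *: ((w + u) + (w - u)).
  by rewrite addrACA subrr addr0 -[w in w + _]scale1r -[w in _ + w]scale1r -scalerDl
       scalerA mulVf ?scale1r// -mulr2n pnatr_eq0.
have Kw : K w.
  by rewrite wE; apply: clconeZ; [rewrite invr_ge0|exact: clconeD].
have -> : u = (w + u) - w by rewrite addrAC subrr add0r.
apply: le_trans (ler_normB _ _) _.
have -> : 3 * b * ev f w = b * ev f (w + w) + b * ev f w.
  by rewrite evD; ring.
have Kwu : K (w + w - (w + u)) by rewrite opprD addrACA subrr add0r.
by apply: lerD; [exact: (interval_bound Kp Kwu)|exact: clcone_bound Kw].
Qed.

(** Endomorphisms of the cone are bounded as soon as they are bounded at one
interior point [w], because a vector of norm [e] lies in the order interval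
between [-w] and [w].  The test points [v k] may themselves vary, as long as
they tend to [w]. *)
Lemma cone_maps_cvg (F : set_system nat) {FU : UltraFilter F}
    (g : nat -> 'M[R]_d) (v : nat -> 'cV[R]_d) w (c : R) :
  (\forall k \near F, forall u, K u -> K (g k *m u)) ->
  v k @[k --> F] --> w -> O w ->
  (\forall k \near F, ev f (g k *m v k) <= c) ->
  exists h : 'M[R]_d, g k @[k --> F] --> h.
Proof.
move=> gK vw Ow gvc; have [e e0 eO] := cone_ball Ow.
have e20 : 0 < e / 2 by rewrite divr_gt0.
apply: (ultra_bounded_cvg (b := (e / 2)^-1 * (3 * b * c))).
have /cvgrPdist_le/(_ _ e20) vwe := vw.
near=> k.
have vO u : `|u| <= e / 2 -> O (v k + u).
  move=> ue; have -> : v k + u = w + ((v k - w) + u) by rewrite addrA addrCA subrr addr0.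
  apply: eO; rewrite (le_trans (ler_normD _ _))// [leRHS](splitr e) lerD//.
  by rewrite distrC; near: k.
have c0 : 0 <= c.
  have gvk : ev f (g k *m v k) <= c by near: k.
  apply: le_trans gvk; apply: clcone_ge0.
  have gKk : forall u, K u -> K (g k *m u) by near: k.
  by apply/gKk/cone_clcone; rewrite -[v k]addr0; apply: vO; rewrite normr0 ltW.
apply: mx_norm_le => [|i j].
  by rewrite mulr_ge0 ?invr_ge0 ?(ltW e20)// !mulr_ge0// (cone_bound0 hO).
rewrite ler_pdivlMl//; pose u := (e / 2) *: delta_mx j (0 : 'I_1) : 'cV[R]_d.
have ue : `|u| <= e / 2.
  apply: mx_norm_le => [|i' j']; first exact: ltW.
  rewrite !mxE; case: (_ && _); rewrite /= ?mulr1 ?mulr0 ?normr0 ?(ltW e20)//.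
  by rewrite gtr0_norm.
have -> : e / 2 * `|g k i j| = `|(g k *m u) i 0|.
  by rewrite /u -scalemxAr -colE !mxE normrM gtr0_norm.
apply: le_trans (mx_entry_le _ _ _) _.
have gKk : forall u, K u -> K (g k *m u) by near: k.
apply: le_trans (_ : 3 * b * ev f (g k *m v k) <= _).
  apply: symmetric_interval_bound; rewrite -?mulmxDr -?mulmxBr.
    exact/gKk/cone_clcone/vO.
  by apply/gKk/cone_clcone/vO; rewrite normrN.
rewrite ler_wpM2l ?mulr_ge0 ?(cone_bound0 hO)//.
by near: k.
Unshelve. all: by end_near. Qed.

End SharpCone.

(** * Discrete groups of cone automorphisms *)

Lemma mx_cvg_unique (R : realType) m n (T : Type) (F : set_system T)
    {FF : ProperFilter F} (x : T -> 'M[R]_(m, n)) (a c : 'M[R]_(m, n)) :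
  x t @[t --> F] --> a -> x t @[t --> F] --> c -> a = c.
Proof. by apply: cvg_unique; exact: norm_hausdorff. Qed.

Lemma cvg_le_near (R : realType) (T : Type) (F : set_system T) {FF : Filter F}
    (x : T -> R) (l : R) :
  x t @[t --> F] --> l -> \forall t \near F, x t <= l + 1.
Proof. by move=> xl; apply: (cvgr_le l xl); rewrite ltrDl. Qed.

(** Closing the group under positive scalars lets each projective automorphism be
represented by its lifts without choosing a normalization. *)
Record cone_group (R : realType) (d : nat) (O : set 'cV[R]_d)
    (G : set 'M[R]_d) : Prop := ConeGroup {
  cg1 : G 1%:M;
  cgM : forall g h, G g -> G h -> G (g *m h);
  cgV : forall g, G g -> G (invmx g);
  cgZ : forall c g, 0 < c -> G g -> G (c *: g);
  cg_unit : forall g, G g -> g \in unitmx;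
  cg_cone : forall g v, G g -> O v -> O (g *m v) }.

(** Discreteness in the projective group, read on matrices: near the identity
there are only homotheties. *)
Definition proj_discrete (R : realType) (d : nat) (G : set 'M[R]_d) : Prop :=
  exists2 e, 0 < e & forall h, G h -> `|h - 1%:M| < e -> exists c, h = c%:M.

Section ConeGroup.
Context (R : realType) (d : nat) (f : 'rV[R]_d) (b : R) (O : set 'cV[R]_d).
Context (hO : sharp_cone f b O).
Local Notation K := (closure O).
Context (G : set 'M[R]_d) (hG : cone_group O G).

Lemma cg_clcone g v : G g -> K v -> K (g *m v).
Proof.
move=> Gg /cone_closureP[u [Ou uv]]; apply/cone_closureP.
exists (fun k => g *m u k); split; first by move=> k; exact: (cg_cone hG).
exact: cvg_mulmxr.
Qed.

Lemma cg_mulKmx g (v : 'cV[R]_d) : G g -> invmx g *m (g *m v) = v.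
Proof. by move=> Gg; rewrite mulKmx// (cg_unit hG). Qed.

Lemma cone_dim_gt0 : (0 < d)%N.
Proof.
have [v Ov] := cone_nonempty hO; rewrite lt0n; apply/eqP => d0.
have /eqP := cone_neq0 hO Ov; apply; apply/matrixP => i j.
by have := ltn_ord i; rewrite [X in (_ < X)%N]d0.
Qed.

(** Projective discreteness makes a convergent sequence of cone automorphisms
eventually constant up to positive scalars: the quotients of its late terms
approach the identity, hence are scalar. *)
Lemma cone_group_lim (F : set_system nat) {FF : ProperFilter F}
    (g : nat -> 'M[R]_d) (h h' : 'M[R]_d) :
  proj_discrete G -> (\forall k \near F, G (g k)) ->
  g k @[k --> F] --> h -> invmx (g k) @[k --> F] --> h' ->
  G h /\ \forall k \near F, exists2 c, 0 < c & g k = c *: h.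
Proof.
move=> [e e0 disc] Gg gh gh'.
have hh' : h *m h' = 1%:M.
  apply: (@mx_cvg_unique _ _ _ _ F _ (fun k => g k *m invmx (g k))).
    exact: cvg_mulmx.
  apply: cvg_near_cst; apply: filterS Gg => k Gk.
  by rewrite mulmxV// (cg_unit hG).
have gmh' : g k *m h' @[k --> F] --> (1%:M : 'M[R]_d).
  by rewrite -hh'; apply: cvg_mulmx => //; exact: cvg_cst.
have [m [Gm gm1]] : exists m, G (g m) /\ `|1%:M - g m *m h'| < e.
  have /cvgrPdist_lt/(_ e e0) gm1 := gmh'.
  exact: (filter_ex (filterI Gg gm1)).
have [w Ow] := cone_nonempty hO.
have gmw : 0 < ev f (g m *m w) by apply/(cone_gt0 hO)/(cg_cone hG).
pose c k := ev f (g k *m w) / ev f (g m *m w).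
have gc : \forall k \near F, 0 < c k /\ g k = c k *: g m.
  have cvk : `|1%:M - g m *m invmx (g k)| @[k --> F] --> `|1%:M - g m *m h'|.
    by apply: cvg_norm; apply: cvgB; [exact: cvg_cst|exact: cvg_mulmxr].
  have lt1 : \forall k \near F, `|1%:M - g m *m invmx (g k)| < e.
    exact: (cvgr_lt _ cvk).
  near=> k.
  have Gk : G (g k) by near: k.
  have gkw : 0 < ev f (g k *m w) by apply/(cone_gt0 hO)/(cg_cone hG).
  have c0 : 0 < c k by rewrite divr_gt0.
  split => //.
  have [|a aE] := disc (g m *m invmx (g k)) (cgM hG Gm (cgV hG Gk)).
    by rewrite distrC; near: k.
  have gma : g m = a *: g k.
    by rewrite -mul_scalar_mx -aE -mulmxA mulVmx ?mulmx1// (cg_unit hG).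
  have a0 : a != 0.
    by apply: contraTneq gmw => a0; rewrite gma a0 scale0r mul0mx ev0 ltxx.
  rewrite /c gma -scalemxAl evZ invfM mulrCA divff ?gt_eqF// mulr1 scalerA.
  by rewrite mulVf// scale1r.
pose c0 := ev f (h *m w) / ev f (g m *m w).
have cc0 : c k @[k --> F] --> c0.
  apply: cvgMr_tmp; apply: cvg_ev; apply: cvg_mulmx => //; exact: cvg_cst.
have hE : h = c0 *: g m.
  apply: (@mx_cvg_unique _ _ _ _ F _ g); first exact: gh.
  have : c k *: g m @[k --> F] --> c0 *: g m by exact: cvgZr_tmp.
  apply: cvg_trans; apply: near_eq_cvg.
  by apply: filterS gc => k [].
have c00 : 0 < c0.
  rewrite lt_neqAle; apply/andP; split.
    rewrite eq_sym; apply/eqP => c00.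
    move: hh'; rewrite hE c00 scale0r mul0mx => /(congr1 (mulmx^~ w)).
    rewrite mul0mx mul1mx => /esym w0; move: (cone_neq0 hO Ow).
    by rewrite w0 eqxx.
  by apply: (cvgr_to_ge cc0); apply: filterS gc => k [/ltW].
split; first by rewrite hE; exact: (cgZ hG).
apply: filterS gc => k [ck gk]; exists (c k / c0); first by rewrite divr_gt0.
by rewrite gk hE scalerA divfK// gt_eqF.
Unshelve. all: by end_near. Qed.

(** Proper discontinuity on the cone: maps moving a convergent sequence of points
to a convergent sequence, with both limits interior, are bounded together with
their inverses, hence converge, hence are eventually constant up to scalars. *)
Lemma cone_group_proper (F : set_system nat) {FU : UltraFilter F}
    (g : nat -> 'M[R]_d) (v : nat -> 'cV[R]_d) v0 w :
  proj_discrete G -> (\forall k \near F, G (g k)) ->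
  v k @[k --> F] --> v0 -> O v0 -> g k *m v k @[k --> F] --> w -> O w ->
  exists h, [/\ G h, g k @[k --> F] --> h, h *m v0 = w &
    \forall k \near F, exists2 c, 0 < c & g k = c *: h].
Proof.
move=> disc Gg vv0 Ov0 gvw Ow.
have [h gh] : exists h : 'M[R]_d, g k @[k --> F] --> h.
  apply: (cone_maps_cvg hO _ vv0 Ov0 (c := ev f w + 1)).
    by apply: filterS Gg => k Gk u; exact: cg_clcone.
  exact: (cvg_le_near (cvg_ev f gvw)).
have gvv0 : invmx (g k) *m (g k *m v k) @[k --> F] --> v0.
  apply: cvg_trans vv0; apply: near_eq_cvg; apply: filterS Gg => k Gk.
  by rewrite cg_mulKmx.
have [h' gh'] : exists h : 'M[R]_d, invmx (g k) @[k --> F] --> h.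
  apply: (cone_maps_cvg hO _ gvw Ow (c := ev f v0 + 1)).
    by apply: filterS Gg => k Gk u; apply: cg_clcone; exact: (cgV hG).
  exact: (cvg_le_near (cvg_ev f gvv0)).
have [Gh gk] := cone_group_lim disc Gg gh gh'.
exists h; split => //; apply: (@mx_cvg_unique _ _ _ _ F _ (fun k => g k *m v k)) => //.
exact: cvg_mulmx.
Qed.

End ConeGroup.

(** A convex cone in [O] on which [G] acts cocompactly.  The last field is
sequential cocompactness modulo positive scalars, as [G] contains these; the
ultrafilter [F] replaces the extraction of a convergent subsequence. *)
Record cocompact_core (R : realType) (d : nat) (O : set 'cV[R]_d)
    (G : set 'M[R]_d) (F : set_system nat) (C : set 'cV[R]_d) : Prop :=
  CocompactCore {
  core_sub : C `<=` O;
  core_nonempty : C !=set0;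
  coreD : forall u v, C u -> C v -> C (u + v);
  coreZ : forall c v, 0 < c -> C v -> C (c *: v);
  core_inv : forall g v, G g -> C v -> C (g *m v);
  core_cocompact : forall v : nat -> 'cV[R]_d, (forall k, C (v k)) ->
    exists g w, [/\ forall k, G (g k), C w & g k *m v k @[k --> F] --> w] }.

Definition centralizing (R : realType) (d : nat) (G A : set 'M[R]_d) :=
  [set z | G z /\ forall a, A a -> z *m a = a *m z].

Section Core.
Context (R : realType) (d : nat) (f : 'rV[R]_d) (b : R) (O : set 'cV[R]_d).
Context (hO : sharp_cone f b O).
Local Notation K := (closure O).
Context (G : set 'M[R]_d) (hG : cone_group O G) (disc : proj_discrete G).
Context (F : set_system nat) {FU : UltraFilter F} (freeF : eventually `<=` F).
Context (C : set 'cV[R]_d) (hC : cocompact_core O G F C).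

(** A sequence of the core tending to an interior point is moved to a limit in the
core by maps which, by proper discontinuity, are essentially constant; apply
the inverse of that constant. *)
Lemma core_closed v : closure C v -> O v -> C v.
Proof.
move=> /closure_seq[u [Cu uv]] Ov.
have uvF : u k @[k --> F] --> v by move=> U /uv; exact: freeF.
have [g [w [Gg Cw gw]]] := core_cocompact hC Cu.
have GgF : \forall k \near F, G (g k) by exact: nearW.
have [h [Gh _ hv _]] := cone_group_proper hO hG disc GgF uvF Ov gw
  (core_sub hC Cw).
rewrite -(cg_mulKmx hG v Gh) hv; apply: (core_inv hC) => //; exact: (cgV hG).
Qed.

Context (A : set 'M[R]_d) (AG : A `<=` G).
Local Notation Z := (centralizing G A).

Lemma centralizing_group : cone_group O Z.
Proof.
split.
- by split; [exact: (cg1 hG)|move=> a _; rewrite mul1mx mulmx1].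
- move=> g h [Gg gA] [Gh hA]; split; first exact: (cgM hG).
  by move=> a Aa; rewrite -mulmxA hA// !mulmxA gA.
- move=> g [Gg gA]; split; first exact: (cgV hG).
  move=> a Aa; have gu := cg_unit hG Gg.
  by rewrite -[LHS](mulmxK gu) -[X in X *m invmx g]mulmxA -gA// mulmxA mulVmx// mul1mx.
- move=> c g c0 [Gg gA]; split; first exact: (cgZ hG).
  by move=> a Aa; rewrite -scalemxAl -scalemxAr gA.
- by move=> g [/(cg_unit hG)].
- by move=> g v [Gg _]; exact: (cg_cone hG).
Qed.

Lemma commutes_span (S : seq 'M[R]_d) (z a : 'M[R]_d) :
  (forall s, s \in S -> z *m s = s *m z) -> a \in <<S>>%VS ->
  z *m a = a *m z.
Proof.
move=> zS aS; rewrite (coord_span (X := in_tuple S) aS) mulmx_sumr mulmx_suml.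
apply: eq_bigr => i _; rewrite -scalemxAl -scalemxAr zS//.
exact: (mem_nth 0 (ltn_ord i)).
Qed.

(** If finitely many elements spanning [A] displace the points of a sequence of
the core by a bounded amount, then their conjugates by the recurrence maps
[g k] displace points near [w] by a bounded amount, so by proper discontinuity
they take a single value along the ultrafilter.  Quotients of two recurrence
maps therefore centralize [A]. *)
Lemma centralizer_recurrence (S : seq 'M[R]_d) (al be : 'M[R]_d -> R)
    (v : nat -> 'cV[R]_d) :
  {in S, forall s, A s} -> (forall a, A a -> a \in <<S>>%VS) ->
  {in S, forall s, 0 < be s} -> (forall k, C (v k)) ->
  (forall k, {in S, forall s, K (al s *: v k - s *m v k) /\
                              K (s *m v k - be s *: v k)}) ->
  exists z w, [/\ forall k, Z (z k), O w & z k *m v k @[k --> F] --> w].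
Proof.
move=> SA AS be0 Cv vS.
have [g [w [Gg Cw gw]]] := core_cocompact hC Cv.
have Ow := core_sub hC Cw.
pose t s k := g k *m s *m invmx (g k).
have tE s k u : t s k *m (g k *m u) = g k *m (s *m u).
  by rewrite /t -!mulmxA mulKmx// (cg_unit hG).
have Gt s k : s \in S -> G (t s k).
  move=> sS; apply: (cgM hG); last exact: (cgV hG).
  by apply: (cgM hG) => //; exact/AG/SA.
have tcst s : s \in S -> exists x, \forall k \near F, t s k = x.
  move=> sS.
  have [h th] : exists h : 'M[R]_d, t s k @[k --> F] --> h.
    apply: (cone_maps_cvg hO _ gw Ow (c := al s * ev f w + 1)).
      by apply: nearW => k u; exact/(cg_clcone hG)/Gt.
    near=> k; apply: le_trans (_ : al s * ev f (g k *m v k) <= _).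
      rewrite -evZ -subr_ge0 -evB tE scalemxAr -mulmxBr.
      have [Ks _] := vS k s sS.
      exact: (clcone_ge0 hO (cg_clcone hG (Gg k) Ks)).
    near: k; apply: cvg_le_near; apply: cvgMl_tmp; exact: cvg_ev gw.
  have tw : t s k *m (g k *m v k) @[k --> F] --> h *m w by exact: cvg_mulmx.
  have Ohw : O (h *m w).
    rewrite -(subrK (be s *: w) (h *m w)); apply: (coneDcl hO).
      have H : t s k *m (g k *m v k) - be s *: (g k *m v k) @[k --> F] -->
          h *m w - be s *: w by apply: cvgB tw _; exact: cvgZl_tmp.
      apply: closure_lim H.
      apply: nearW => k /=; rewrite tE scalemxAr -mulmxBr.
      have [_ Ks] := vS k s sS; exact: (cg_clcone hG (Gg k) Ks).
    by apply: (coneZ hO) => //; exact: be0.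
  have GtF : \forall k \near F, G (t s k) by apply: nearW => k; exact: Gt.
  have [x [Gx _ _ tx]] := cone_group_proper hO hG disc GtF gw Ow tw Ohw.
  have [k0 [c0 c00 k0E]] := filter_ex tx.
  exists (t s k0); apply: filterS tx => k [c cgt0 kE].
  (* the conjugates agree up to a positive scalar, and have the same determinant *)
  have dett k' : \det (t s k') = \det s.
    rewrite /t !det_mulmx mulrAC -det_mulmx mulmxV ?det1 ?mul1r//.
    exact: (cg_unit hG).
  have : \det (t s k) = \det (t s k0) by rewrite !dett.
  rewrite kE k0E !detZ => /mulIf; rewrite -unitfE -/(x \in unitmx).
  move=> /(_ (cg_unit hG Gx)) /eqP.
  by rewrite eqrXn2 ?ltW ?(cone_dim_gt0 hO)// => /eqP ->.
have tall : exists x : 'M[R]_d -> 'M[R]_d,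
    \forall k \near F, forall i : 'I_(size S), t S`_i k = x S`_i.
  exists (fun s => xget 0 [set x | \forall k \near F, t s k = x]).
  apply: filter_forall => i.
  by have := xgetPex 0 (tcst _ (mem_nth 0 (ltn_ord i))).
have {tall} [x Fx] := tall.
have [m mE] := filter_ex Fx.
pose z k := if `[< forall i : 'I_(size S), t S`_i k = x S`_i >]
  then invmx (g m) *m g k else 1%:M.
(* [z k] is a quotient of recurrence maps as soon as the conjugates have
   stabilized at both [m] and [k] *)
exists z, (invmx (g m) *m w); split.
- move=> k; rewrite /z; case: asboolP => [kE|_]; last first.
    exact: (cg1 centralizing_group).
  split; first by apply: (cgM hG) => //; exact: (cgV hG).
  move=> a /AS; apply: commutes_span => s sS.
  have sE : S`_(index s S) = s by rewrite nth_index.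
  have iS : (index s S < size S)%N by rewrite index_mem.
  have := kE (Ordinal iS); rewrite -(mE (Ordinal iS)) /= sE /t => te.
  have gku := cg_unit hG (Gg k); have gmu := cg_unit hG (Gg m).
  have /(congr1 (fun y => invmx (g m) *m y *m g k)) := te.
  by rewrite -mulmxA (mulmxKV gku) !mulmxA mulVmx// mul1mx.
- by apply: (cg_cone hG) => //; exact: (cgV hG).
- have : invmx (g m) *m (g k *m v k) @[k --> F] --> invmx (g m) *m w.
    exact: cvg_mulmxr.
  apply: cvg_trans; apply: near_eq_cvg; apply: filterS Fx => k kE.
  by rewrite /z asboolT// mulmxA.
Unshelve. all: by end_near. Qed.

End Core.

(** * Convex cones, finite spans and separation *)

Section Dot.
Context (R : realType) (d : nat).
Implicit Types u v w : 'cV[R]_d.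

Definition dot u v : R := \sum_i u i 0 * v i 0.

Lemma dotC u v : dot u v = dot v u.
Proof. by apply: eq_bigr => i _; rewrite mulrC. Qed.

Lemma dotDl u v w : dot (u + v) w = dot u w + dot v w.
Proof. by rewrite -big_split; apply: eq_bigr => i _; rewrite mxE mulrDl. Qed.

Lemma dotZl c u v : dot (c *: u) v = c * dot u v.
Proof. by rewrite /dot mulr_sumr; apply: eq_bigr => i _; rewrite mxE mulrA. Qed.

Lemma dotDr u v w : dot u (v + w) = dot u v + dot u w.
Proof. by rewrite dotC dotDl !(dotC _ u). Qed.

Lemma dotZr c u v : dot u (c *: v) = c * dot u v.
Proof. by rewrite dotC dotZl dotC. Qed.

Lemma dotNl u v : dot (- u) v = - dot u v.
Proof. by rewrite -scaleN1r dotZl mulN1r. Qed.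

Lemma dotNr u v : dot u (- v) = - dot u v.
Proof. by rewrite dotC dotNl dotC. Qed.

Lemma dot_ge0 v : 0 <= dot v v.
Proof. by apply: sumr_ge0 => i _; rewrite -expr2 sqr_ge0. Qed.

Lemma norm_le_dot v : `|v| ^+ 2 <= dot v v.
Proof.
have [/eqP v0|v0] := boolP (`|v| == 0); first by rewrite v0 expr0n dot_ge0.
rewrite [X in X ^+ 2]/Num.norm /=; have [[i j] ->] := mx_norm_neq0 v0.
rewrite /= (ord1 j) /dot (bigD1 i)//= real_normK ?num_real// expr2 lerDl.
by apply: sumr_ge0 => k _; rewrite -expr2 sqr_ge0.
Qed.

Lemma dot_le_norm v : dot v v <= d%:R * `|v| ^+ 2.
Proof.
rewrite -[d in d%:R]card_ord -sumr_const mulr_suml; apply: ler_sum => i _.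
rewrite mul1r -expr2 -real_normK ?num_real// lerXn2r ?nnegrE//.
exact: mx_entry_le.
Qed.

Lemma dot_eq0 v : dot v v <= 0 -> v = 0.
Proof.
move=> v0; apply/eqP; rewrite -normr_eq0 -sqrf_eq0.
by rewrite eq_le sqr_ge0 andbT (le_trans (norm_le_dot v)).
Qed.

Lemma cvg_dot (T : Type) (F : set_system T) {FF : Filter F}
    (x y : T -> 'cV[R]_d) u v :
  x t @[t --> F] --> u -> y t @[t --> F] --> v ->
  dot (x t) (y t) @[t --> F] --> dot u v.
Proof.
move=> /cvg_mxP xu /cvg_mxP yv; apply: cvg_big => [|i _].
  exact: add_continuous.
by apply: cvgM; [exact: xu|exact: yv].
Qed.

End Dot.

Section FiniteSpan.
Context (R : realType) (vT : vectType R).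

(** Take a finite family in [P] whose span has maximal dimension. *)
Lemma finite_span (P : set vT) : exists xs : seq vT,
  {in xs, forall x, P x} /\ forall x, P x -> x \in <<xs>>%VS.
Proof.
pose D n := `[< exists xs : seq vT, {in xs, forall x, P x} /\ \dim <<xs>> = n >].
have exD : exists n, D n.
  by exists 0%N; apply/asboolP; exists [::]; split => //; rewrite span_nil dimv0.
have Dle n : D n -> (n <= \dim {:vT})%N.
  by move=> /asboolP[xs [_ <-]]; apply/dimvS/subvf.
case: (ex_maxnP exD Dle) => n /asboolP[xs [sP sn]] nmax.
exists xs; split => // x Px; apply: contrapT => /negP xNs.
have : D (\dim <<x :: xs>>).
  apply/asboolP; exists (x :: xs); split => // y; rewrite inE => /orP[/eqP->//|].
  exact: sP.
move=> /nmax; rewrite -sn => le_dim.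
have /eqP E : (<<xs>> == <<x :: xs>>)%VS.
  by rewrite eqEdim le_dim andbT span_cons addvSr.
by move: xNs; rewrite E memv_span// mem_head.
Qed.

End FiniteSpan.

Definition convex_cone (R : realType) (d : nat) (M : set 'cV[R]_d) : Prop :=
  [/\ M 0, forall u v, M u -> M v -> M (u + v)
    & forall c v, 0 <= c -> M v -> M (c *: v)].

Lemma convex_cone_sum (R : realType) (d : nat) (M : set 'cV[R]_d) (I : Type)
    (r : seq I) (P : pred I) (x : I -> 'cV[R]_d) :
  convex_cone M -> (forall i, P i -> M (x i)) -> M (\sum_(i <- r | P i) x i).
Proof. by move=> [M0 MD _] Mx; elim/big_ind : _. Qed.

(** An order unit: the coordinates of [u] on a spanning family of elements of [M]
bound how much of [u] may be subtracted from the sum of that family. *)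
Lemma cone_order_unit (R : realType) (d : nat) (M : set 'cV[R]_d) p :
  convex_cone M -> M p -> exists w, [/\ M w, M (w - p) &
    forall u, M u -> exists2 e, 0 < e & M (w - e *: u)].
Proof.
move=> cM Mp; have [M0 MD MZ] := cM.
have [s [sM Ms]] := finite_span M.
have Mi (i : 'I_(size s)) : M s`_i by apply/sM/mem_nth.
exists (p + \sum_(i < size s) s`_i); split.
- by apply: MD => //; apply: convex_cone_sum.
- by rewrite addrAC subrr add0r; exact: convex_cone_sum.
move=> u /Ms us; pose c i := coord (in_tuple s) i u.
have uE : u = \sum_i c i *: s`_i by rewrite {1}(coord_span (X := in_tuple s) us).
pose t := 1 + \sum_i `|c i|.
have t0 : 0 < t by rewrite ltr_wpDr// sumr_ge0.
exists t^-1; first by rewrite invr_gt0.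
rewrite uE scaler_sumr -addrA -sumrB; apply: MD => //.
apply: convex_cone_sum => // i _.
rewrite scalerA -[X in X - _]scale1r -scalerBl; apply: MZ => //.
rewrite subr_ge0 mulrC ler_pdivrMr// mul1r /t (bigD1 i)//=.
rewrite (le_trans (ler_norm _))// addrCA lerDl addr_ge0//.
by rewrite sumr_ge0.
Qed.

Lemma real_sup_seq (R : realType) (T : Type) (P : set T) (phi : T -> R) (B : R) :
  P !=set0 -> (forall x, P x -> phi x <= B) ->
  exists s (u : nat -> T), [/\ forall x, P x -> phi x <= s,
    forall k, P (u k) & phi (u k) @[k --> \oo] --> s].
Proof.
move=> [x0 Px0] PB; pose S := [set phi x | x in P].
have hS : has_sup S.
  split; first by exists (phi x0), x0.
  by exists B => _ [x Px <-]; exact: PB.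
have H k : exists x, P x /\ sup S - k.+1%:R^-1 < phi x.
  have [|_ [x Px <-] lt] := sup_adherent (_ : 0 < k.+1%:R^-1 :> R) hS.
    by rewrite invr_gt0.
  by exists x.
have [u uP] := choice H.
have le_sup x : P x -> phi x <= sup S.
  by move=> Px; apply: sup_upper_bound => //; exists x.
exists (sup S), u; split => // [k|]; first by case: (uP k).
apply: (@squeeze_cvgr _ _ _ _ (fun k => sup S - harmonic k) (fun=> sup S)).
- near=> k; have [Pu /ltW ->] := uP k.
  by rewrite /= le_sup.
- by rewrite -[X in _ --> X]subr0; apply: cvgB; [exact: cvg_cst|exact: cvg_harmonic].
- exact: cvg_cst.
Unshelve. all: by end_near. Qed.

(** The vector from the nearest point of the cone to the outside point [m] is
separating. *)
Lemma cone_separation (R : realType) (d : nat) (D : set 'cV[R]_d) m :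
  closed D -> convex_cone D -> ~ D m ->
  exists xi, 0 < dot xi m /\ forall v, D v -> dot xi v <= 0.
Proof.
move=> clD [D0 DD DZ] nDm.
have [F [FU freeF]] := free_ultrafilter.
have [|v _|s [u [us Du us']]] := @real_sup_seq R _ D (fun v => - dot (m - v) (m - v)) 0.
- by exists 0.
- by rewrite oppr_le0 dot_ge0.
have usF : - dot (m - u k) (m - u k) @[k --> F] --> s by move=> U /us'; exact: freeF.
have [n un] : exists n : 'cV[R]_d, u k @[k --> F] --> n.
  apply: (ultra_bounded_cvg (b := 1 + (1 - s) + `|m|)).
  near=> k.
  have : - (s - 1) >= dot (m - u k) (m - u k).
    rewrite lerNr ltW//; near: k; apply: (cvgr_gt s usF).
    by rewrite ltrBlDr ltrDl.
  rewrite opprB => /(le_trans (norm_le_dot _)) le1.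
  have le2 : `|m - u k| <= 1 + (1 - s).
    have [h|h] := leP `|m - u k| 1.
      by rewrite (le_trans h)// lerDl (le_trans _ le1)// sqr_ge0.
    rewrite (le_trans (_ : _ <= `|m - u k| ^+ 2))//.
      by rewrite expr2 ler_peMl// ltW.
    by rewrite (le_trans le1)// lerDr.
  rewrite -(opprK (u k)) normrN -(addrK m (- u k)) (addrC (- u k)).
  by rewrite (le_trans (ler_normB _ _))// lerD2r.
have Dn : D n.
  by apply: (closed_cvg _ clD) un; exact: nearW.
have sE : s = - dot (m - n) (m - n).
  apply: (cvg_unique (@norm_hausdorff _ _)) usF _.
  by apply: cvgN; apply: cvg_dot; apply: cvgB => //; exact: cvg_cst.
have [xi xiE] : exists xi, xi = m - n by exists (m - n).
have xi0 : 0 < dot xi xi.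
  rewrite lt_neqAle dot_ge0 andbT eq_sym; apply/eqP => xi0.
  have /dot_eq0 : dot xi xi <= 0 by rewrite xi0.
  by rewrite xiE => /subr0_eq mn; apply: nDm; rewrite mn.
have min v : D v -> dot xi xi <= dot (m - v) (m - v).
  by move=> /us; rewrite sE lerN2 xiE.
(* first order variation at the minimum *)
have small (a q : R) : (forall e, 0 < e -> e <= 1 -> a <= e * q) -> 0 <= q -> a <= 0.
  move=> H q0; rewrite leNgt; apply/negP => a0.
  pose e := Num.min 1 (a / (2 * (q + 1))).
  have q1 : 0 < 2 * (q + 1) by rewrite mulr_gt0// ltr_wpDl.
  have e0 : 0 < e by rewrite lt_min ltr01 divr_gt0.
  have := H e e0; rewrite ge_min lexx => /(_ isT); apply/negP; rewrite -ltNge.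
  have : e * (2 * (q + 1)) <= a by rewrite -ler_pdivlMr// ge_min lexx orbT.
  have : 0 <= e * q by rewrite mulr_ge0// ltW.
  nra.
have neg v : D v -> dot xi v <= 0.
  move=> Dv; apply: (@small _ (dot v v)); last exact: dot_ge0.
  move=> e e0 _.
  have := min _ (DD _ _ Dn (DZ _ _ (ltW e0) Dv)).
  rewrite opprD addrA -xiE !(dotDl, dotDr, dotNl, dotNr, dotZl, dotZr).
  rewrite (dotC v xi) => h.
  have h2 : 0 <= e * (e * dot v v - 2 * dot xi v) by lra.
  have : 0 <= e * dot v v - 2 * dot xi v by rewrite -(pmulr_rge0 _ e0).
  have : 0 <= dot v v by exact: dot_ge0.
  nra.
exists xi; split => //.
have -> : m = xi + n by rewrite xiE subrK.
rewrite dotDr ltr_wpDr// -oppr_le0; apply: (@small _ (dot n n)); last exact: dot_ge0.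
move=> e e0 e1.
have := min ((1 - e) *: n) (DZ _ _ _ Dn); rewrite subr_ge0 => /(_ e1).
have -> : m - (1 - e) *: n = xi + e *: n.
  by rewrite xiE scalerBl scale1r opprB addrCA addrC.
rewrite !(dotDl, dotDr, dotNl, dotNr, dotZl, dotZr) (dotC n xi) => h.
have h2 : 0 <= e * (e * dot n n + 2 * dot xi n) by lra.
have : 0 <= e * dot n n + 2 * dot xi n by rewrite -(pmulr_rge0 _ e0).
have : 0 <= dot n n by exact: dot_ge0.
nra.
Unshelve. all: by end_near. Qed.

(** * Minimal invariant cones and eigenrays *)

Definition eigenray (R : realType) (d : nat) (A : set 'M[R]_d) (v : 'cV[R]_d) :=
  v != 0 /\ forall a, A a -> exists c, a *m v = c *: v.

(** The cones among which a minimal one is sought.  Requiring an interior point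
excludes the degenerate minimal cones in the boundary. *)
Definition full_invariant_cone (R : realType) (d : nat) (O : set 'cV[R]_d)
    (Z : set 'M[R]_d) (M : set 'cV[R]_d) : Prop :=
  [/\ closed M, convex_cone M, forall z v, Z z -> M v -> M (z *m v)
    & exists2 p, M p & O p].

(** Exhaust the interior by the compact sets [N k] of points which are not too
large and not too close to the boundary.  If none of them met all the orbits,
points whose orbits avoid [N k] would form a sequence violating recurrence. *)
Lemma recurrence_compact (R : realType) (d : nat) (f : 'rV[R]_d) (b : R)
    (O : set 'cV[R]_d) (Z : set 'M[R]_d) (Q : set 'cV[R]_d)
    (F : set_system nat) {FF : ProperFilter F} :
  sharp_cone f b O -> eventually `<=` F ->
  (forall v : nat -> 'cV[R]_d, (forall k, Q (v k)) ->
    exists z w, [/\ forall k, Z (z k), O w & z k *m v k @[k --> F] --> w]) ->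
  exists N, [/\ compact N, N `<=` O &
    forall v, Q v -> exists2 z, Z z & N (z *m v)].
Proof.
move=> hO freeF rec.
pose N (k : nat) := [set v : 'cV[R]_d | `|v| <= k%:R /\
  forall u, `|u| <= k.+1%:R^-1 -> closure O (v + u)].
have cN k : compact (N k).
  apply: (@bounded_closed_compact_mx _ _ _ _ k%:R) => [v []//|].
  move=> v /closure_seq[x [Nx xv]]; split.
    by apply: (cvgr_to_le (cvg_norm xv)); apply: nearW => j; case: (Nx j).
  move=> u uk; have xuv : x j + u @[j --> \oo] --> v + u.
    by apply: cvgD => //; exact: cvg_cst.
  by apply: closure_lim xuv; apply: nearW => j; case: (Nx j) => _; exact.
have NO k : N k `<=` O.
  move=> v [_ vk]; have [w Ow] := cone_nonempty hO.
  have nw : 0 < `|w| by rewrite normr_gt0 (cone_neq0 hO).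
  pose e := k.+1%:R^-1 / `|w|.
  have e0 : 0 < e by rewrite divr_gt0 ?invr_gt0.
  rewrite -(subrK (e *: w) v); apply: (coneDcl hO); last exact: (coneZ hO).
  apply: vk; rewrite normrN normrZ gtr0_norm// divfK//.
  by rewrite gt_eqF.
apply: contrapT => noN.
have H k : exists v, Q v /\ forall z, Z z -> ~ N k (z *m v).
  apply: contrapT => nov; apply: noN; exists (N k); split => // v Qv.
  apply: contrapT => noz; apply: nov; exists v; split => // z Zz Nz.
  by apply: noz; exists z.
have [v vP] := choice H.
have [|z [w [Zz Ow zw]]] := rec v; first by move=> k; case: (vP k).
have [e e0 eO] := cone_ball hO Ow.
have [j jP] : exists j : nat, `|w| + 1 <= j%:R /\ j.+1%:R^-1 <= e / 2.
  have [j1 h1] : exists j : nat, `|w| + 1 <= j%:R.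
    by exists (Num.bound (`|w| + 1)); rewrite ltW// archi_boundP// addr_ge0.
  have [j2 h2] : exists j : nat, (e / 2)^-1 <= j%:R.
    exists (Num.bound (e / 2)^-1); rewrite ltW// archi_boundP// invr_ge0.
    by rewrite divr_ge0// ltW.
  exists (maxn j1 j2); split.
    by rewrite (le_trans h1)// ler_nat leq_maxl.
  rewrite invf_ple ?posrE ?divr_gt0//.
  by rewrite (le_trans h2)// ler_nat (leq_trans (leq_maxr j1 j2)).
have near1 : \forall k \near F, `|w - z k *m v k| <= Num.min 1 (e / 2).
  move/cvgrPdist_le : zw; apply.
  by rewrite lt_min ltr01 divr_gt0.
have nearj : \forall k \near F, (j <= k)%N.
  by apply: freeF; exact: nbhs_infty_ge.
have [k [k1 jk]] := filter_ex (filterI near1 nearj).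
have [_ /(_ (z k) (Zz k))] := vP k; apply.
move: k1; rewrite le_min => /andP[k1 k2]; split.
  rewrite -(subKr w (z k *m v k)) (le_trans (ler_normB _ _))//.
  by rewrite (le_trans (lerD (lexx _) k1))// (le_trans (proj1 jP))// ler_nat.
move=> u uk; apply/subset_closure.
have -> : z k *m v k + u = w + (u - (w - z k *m v k)).
  by rewrite opprB addrCA (addrC w) subrK addrC.
apply: eO; rewrite (le_trans (ler_normB _ _))// [leRHS](splitr e) lerD//.
rewrite (le_trans uk)// (le_trans _ (proj2 jP))// lef_pV2 ?posrE//.
by rewrite ler_nat.
Qed.

Section MinimalCone.
Context (R : realType) (d : nat) (f : 'rV[R]_d) (b : R) (O : set 'cV[R]_d).
Context (hO : sharp_cone f b O) (Z : set 'M[R]_d).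
Context (F : set_system nat) {FF : ProperFilter F} (freeF : eventually `<=` F).
Context (M0 : set 'cV[R]_d) (hM0 : full_invariant_cone O Z M0).
Context (recM0 : forall v : nat -> 'cV[R]_d, (forall k, M0 (v k) /\ O (v k)) ->
  exists z w, [/\ forall k, Z (z k), O w & z k *m v k @[k --> F] --> w]).

(** Zorn's lemma applies because recurrence provides a compact set of interior
points which meets every competing cone: the intersection of a chain of such
cones still meets it, and so still reaches the interior. *)
Lemma minimal_invariant_cone : exists M, [/\ full_invariant_cone O Z M,
  M `<=` M0 &
  forall M', full_invariant_cone O Z M' -> M' `<=` M -> M `<=` M'].
Proof.
have [N [cN NO NZ]] := recurrence_compact (Q := [set v | M0 v /\ O v]) hO freeF recM0.
have NM M : full_invariant_cone O Z M -> M `<=` M0 -> exists2 v, M v & N v.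
  move=> [_ _ inv [p Mp Op]] MM0.
  by have [z Zz Nz] := NZ p (conj (MM0 _ Mp) Op); exists (z *m p) => //; exact: inv.
pose P M := full_invariant_cone O Z M /\ M `<=` M0.
pose T := {M | P M}.
pose r (s t : T) := `[< sval t `<=` sval s >].
have [||chain totc|] := @ZL_preorder T (exist P M0 (conj hM0 (@subset_refl _ M0))) r.
- by move=> t; apply/asboolP.
- move=> s t u /asboolP st /asboolP tu; apply/asboolP.
  exact: subset_trans tu st.
- have [[t0 ct0]|none] := pselect (chain !=set0); last first.
    exists (exist P M0 (conj hM0 (@subset_refl _ M0))) => s cs.
    by exfalso; apply: none; exists s.
  pose I := [set v | forall t, chain t -> sval t v].
  have IP : P I.
    split; last by move=> v Iv; case: (svalP t0) => _; apply; exact: Iv.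
    split.
    - move=> v clv t ct; case: (svalP t) => -[+ _ _ _] _; apply.
      by move=> B /clv[y [Iy By]]; exists y; split => //; exact: Iy.
    - split => [t ct|u v Iu Iv t ct|c v c0 Iv t ct];
        case: (svalP t) => -[_ [z0 zD zZ] _ _] _ //.
      + by apply: zD; [exact: Iu|exact: Iv].
      + by apply: zZ => //; exact: Iv.
    - move=> z v Zz Iv t ct; case: (svalP t) => -[_ _ inv _] _.
      by apply: inv => //; exact: Iv.
    pose FI := filter_from chain (fun t : T => sval t `&` N).
    have FFI : ProperFilter FI.
      apply: filter_from_proper.
        apply: filter_from_filter; first by exists t0.
        move=> s t cs ct; have [/asboolP ts|/asboolP st] := totc _ _ cs ct.
          by exists t => // v [tv Nv]; do 2!split => //; exact: ts.
        by exists s => // v [sv Nv]; do 2!split => //; exact: st.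
      move=> t ct; case: (svalP t) => gt tM0.
      by have [v tv Nv] := NM _ gt tM0; exists v.
    have [|p [Np clp]] := cN FI _.
      by exists t0 => // v [].
    exists p; last exact: NO.
    move=> t ct; case: (svalP t) => -[+ _ _ _] _; apply => B nB.
    have [|y [[ty _] By]] := clp (sval t `&` N) B _ nB; first by exists t.
    by exists y.
  exists (exist P I IP) => s cs; apply/asboolP => v /=; exact.
- move=> t max; have [gM MM0] := svalP t; exists (sval t); split => // M' gM' M'M.
  have PM' : P M' by split => //; exact: subset_trans M'M MM0.
  by apply/asboolP/(max (exist P M' PM'))/asboolP.
Qed.

End MinimalCone.

Section ExtremalEigenrays.
Context (R : realType) (d : nat) (f : 'rV[R]_d) (b : R) (O : set 'cV[R]_d).
Context (hO : sharp_cone f b O).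
Local Notation K := (closure O).
Context (Z : set 'M[R]_d) (hZ : cone_group O Z).
Context (A : set 'M[R]_d) (AZ : A `<=` Z).
Context (ZA : forall z a, Z z -> A a -> z *m a = a *m z).
Context (M : set 'cV[R]_d) (gM : full_invariant_cone O Z M) (MK : M `<=` K).
Context (minM : forall M', full_invariant_cone O Z M' -> M' `<=` M -> M `<=` M').

(** The points of [M] whose whole orbit lies in [D] form a competing cone. *)
Lemma minimal_cone_generated w (D : set 'cV[R]_d) : M w -> O w ->
  closed D -> convex_cone D -> (forall z, Z z -> D (z *m w)) -> M `<=` D.
Proof.
move=> Mw Ow clD [D0 DD DZ] Dw; have [clM [M0 MD MZ] invM _] := gM.
pose M' := [set v | M v /\ forall z, Z z -> D (z *m v)].
have : M `<=` M'.
  apply: minM; last by move=> v [].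
  split.
  - move=> v /closure_seq[u [Mu uv]]; split.
      by apply: (closed_cvg _ clM) uv; apply: nearW => k; case: (Mu k).
    move=> z Zz; have zuv : z *m u k @[k --> \oo] --> z *m v by exact: cvg_mulmxr.
    by apply: (closed_cvg _ clD) zuv; apply: nearW => k; case: (Mu k) => _; exact.
  - split.
    + by split => // z _; rewrite mulmx0.
    + move=> u v [Mu uD] [Mv vD]; split; first exact: MD.
      by move=> z Zz; rewrite mulmxDr; apply: DD; [exact: uD|exact: vD].
    + move=> c v c0 [Mv vD]; split; first exact: MZ.
      by move=> z Zz; rewrite -scalemxAr; apply: DZ => //; exact: vD.
  - move=> z v Zz [Mv vD]; split; first exact: invM.
    by move=> y Zy; rewrite mulmxA; apply: vD; exact: (cgM hZ).
  - by exists w.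
move=> MM' v /MM'[_ /(_ 1%:M)]; rewrite mul1mx; apply; exact: (cg1 hZ).
Qed.

Local Notation q v := (dot v v).

(** The cone over the ball with centre [c] and squared radius [s] in the slice
[ev f = 1]. *)
Lemma ball_cone_convex (c : 'cV[R]_d) (s : R) :
  convex_cone [set v | 0 <= ev f v /\ q (v - ev f v *: c) <= s * ev f v ^+ 2].
Proof.
split.
- by rewrite /= ev0 scale0r subr0 lexx expr0n mulr0 /dot big1// => i _; rewrite mxE mul0r.
- move=> x y /= [fx qx] [fy qy]; rewrite evD; split; first exact: addr_ge0.
  rewrite scalerDl opprD addrACA.
  set X := x - _ in qx *; set Y := y - _ in qy *; clearbody X Y.
  have qX : 0 <= q X := dot_ge0 X.
  have qY : 0 <= q Y := dot_ge0 Y.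
  move: fx; rewrite le_eqVlt => /orP[/eqP fx|fx].
    have X0 : X = 0 by apply: dot_eq0; rewrite (le_trans qx)// -fx expr0n mulr0.
    by rewrite X0 !add0r -fx add0r.
  move: fy; rewrite le_eqVlt => /orP[/eqP fy|fy].
    have Y0 : Y = 0 by apply: dot_eq0; rewrite (le_trans qy)// -fy expr0n mulr0.
    by rewrite Y0 !addr0 -fy addr0.
  have := dot_ge0 (ev f y *: X - ev f x *: Y).
  rewrite !(dotDl, dotDr, dotNl, dotNr, dotZl, dotZr) (dotC Y X) => h.
  have h1 : 2 * (ev f x * ev f y) * dot X Y <=
      ev f y ^+ 2 * q X + ev f x ^+ 2 * q Y by lra.
  have h2 : ev f y ^+ 2 * q X <= ev f y ^+ 2 * (s * ev f x ^+ 2).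
    by rewrite ler_wpM2l// sqr_ge0.
  have h3 : ev f x ^+ 2 * q Y <= ev f x ^+ 2 * (s * ev f y ^+ 2).
    by rewrite ler_wpM2l// sqr_ge0.
  have fxy : 0 < ev f x * ev f y by rewrite mulr_gt0.
  have : (ev f x * ev f y) * dot X Y <= (ev f x * ev f y) * (s * (ev f x * ev f y)).
    by lra.
  rewrite ler_pM2l// => h4; lra.
- move=> t v t0 /= [fv qv]; rewrite evZ; split; first exact: mulr_ge0.
  rewrite -scalerA -scalerBr dotZl dotZr exprMn.
  rewrite mulrA -expr2 mulrCA ler_wpM2l// sqr_ge0//.
Qed.

Lemma ball_cone_closed (c : 'cV[R]_d) (s : R) :
  closed [set v | 0 <= ev f v /\ q (v - ev f v *: c) <= s * ev f v ^+ 2].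
Proof.
move=> v /closure_seq[u [Du uv]].
have fuv : ev f (u k) @[k --> \oo] --> ev f v by exact: (cvg_ev f uv).
have uc : u k - ev f (u k) *: c @[k --> \oo] --> v - ev f v *: c.
  by apply: cvgB => //; exact: cvgZr_tmp.
have quc : q (u k - ev f (u k) *: c) @[k --> \oo] --> q (v - ev f v *: c).
  exact: cvg_dot.
have sf : s * ev f (u k) ^+ 2 @[k --> \oo] --> s * ev f v ^+ 2.
  by apply: cvgMl_tmp; rewrite expr2; under eq_cvg do rewrite expr2; exact: cvgM.
split.
- by apply: (cvgr_to_ge fuv); apply: nearW => k; case: (Du k).
- by apply: (cvg_ler quc sf); apply: nearW => k; case: (Du k).
Qed.

(** By minimality [M] lies in the cone over any ball which contains the orbit of
one interior point.  Applied to the smallest such ball with centre [c] and an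
order unit [w], this shows that a limit [e] of the normalized orbit of [w] is a
farthest point of the slice of [M], and then extreme in [M] because balls are
strictly convex.  The limit [B] of the maps used commutes with [A]; since
[w - t *: (a *m w)] is in [M] for a small [t], applying [B] splits the extreme
point [e] with [t *: (a *m e)] as one summand, so that [e] is an eigenray. *)
Lemma extremal_eigenray (c : 'cV[R]_d) : exists e,
  [/\ M e, ev f e = 1, eigenray A e &
    forall v, M v -> ev f v = 1 -> q (v - c) <= q (e - c)].
Proof.
have [clM cM invM [p Mp Op]] := gM; have [M0 MD MZ] := cM.
have [F [FU freeF]] := free_ultrafilter.
have [w [Mw Mwp unit_w]] := cone_order_unit cM Mp.
have Ow : O w by rewrite -(subrK p w); apply: (coneDcl hO) => //; exact: MK.
pose P z := Z z /\ ev f (z *m w) = 1.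
have normalize z : Z z -> P ((ev f (z *m w))^-1 *: z).
  move=> Zz; have fz : 0 < ev f (z *m w) by apply/(cone_gt0 hO)/(cg_cone hZ).
  split; first by apply: (cgZ hZ) => //; rewrite invr_gt0.
  by rewrite -scalemxAl evZ mulVf// gt_eqF.
have PK z : P z -> `|z *m w| <= b.
  move=> [Zz zw]; rewrite -[leRHS]mulr1 -zw; apply: (cone_bound hO).
  exact: (cg_cone hZ).
have [||s [z [sP Pz zs]]] := @real_sup_seq R _ P (fun z => q (z *m w - c))
    (d%:R * (b + `|c|) ^+ 2).
- by exists ((ev f (1%:M *m w))^-1 *: 1%:M); apply: normalize; exact: (cg1 hZ).
- move=> z Pz; rewrite (le_trans (dot_le_norm _))// ler_wpM2l//.
  rewrite lerXn2r ?nnegrE ?addr_ge0 ?(cone_bound0 hO)//.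
  by rewrite (le_trans (ler_normB _ _))// lerD2r PK.
have wF : (fun _ : nat => w) k @[k --> F] --> w by exact: cvg_cst.
have [B zB] : exists B : 'M[R]_d, z k @[k --> F] --> B.
  apply: (cone_maps_cvg hO _ wF Ow (c := 1)).
    by apply: nearW => k u; apply/(cg_clcone hZ); case: (Pz k).
  by apply: nearW => k; case: (Pz k) => _ ->.
have zuB (u : 'cV[R]_d) : z k *m u @[k --> F] --> B *m u.
  by apply: cvg_mulmx => //; exact: cvg_cst.
have BM u : M u -> M (B *m u).
  move=> Mu; apply: (closed_lim clM _ (zuB u)); apply: nearW => k.
  by apply: invM => //; case: (Pz k).
have BA a : A a -> B *m a = a *m B.
  move=> Aa; apply: (@mx_cvg_unique _ _ _ _ F _ (fun k => z k *m a)).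
    by apply: cvg_mulmx => //; exact: cvg_cst.
  have : a *m z k @[k --> F] --> a *m B by exact: cvg_mulmxr.
  apply: cvg_trans; apply: near_eq_cvg; apply: nearW => k.
  by have [Zzk _] := Pz k; rewrite (ZA Zzk Aa).
pose e := B *m w.
have fe : ev f e = 1.
  apply: (cvg_unique (@norm_hausdorff _ _)) (cvg_ev f (zuB w)) _.
  by apply: cvg_near_cst; apply: nearW => k; case: (Pz k).
have qe : q (e - c) = s.
  have zsF : q (z k *m w - c) @[k --> F] --> s by move=> U /zs; exact: freeF.
  apply: (cvg_unique (@norm_hausdorff _ _)) zsF.
  by apply: cvg_dot; apply: cvgB; rewrite /e //; exact: cvg_cst.
have Mball v : M v -> 0 <= ev f v /\ q (v - ev f v *: c) <= s * ev f v ^+ 2.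
  move=> Mv.
  have := minimal_cone_generated Mw Ow (@ball_cone_closed c s) (@ball_cone_convex c s).
  apply => // y Zy /=.
  have fy : 0 < ev f (y *m w) by apply/(cone_gt0 hO)/(cg_cone hZ).
  split; first exact: ltW.
  have := sP _ (normalize y Zy); rewrite -scalemxAl => qy.
  have -> : y *m w - ev f (y *m w) *: c =
      ev f (y *m w) *: ((ev f (y *m w))^-1 *: (y *m w) - c).
    by rewrite scalerBr scalerA mulfV ?gt_eqF// scale1r.
  by rewrite dotZl dotZr mulrA -expr2 mulrC ler_wpM2r// sqr_ge0.
have Me : M e by exact: BM.
exists e; split => //.
- split.
    by apply: contra_eq_neq fe => ->; rewrite ev0 eq_sym oner_eq0.
  move=> a Aa; have Maw : M (a *m w) by apply: invM => //; exact: AZ.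
  have [t t0 Mt] := unit_w _ Maw.
  have Ba : B *m (a *m w) = a *m e by rewrite mulmxA BA// -mulmxA.
  have [x xE] : exists x, x = t *: (a *m e) by exists (t *: (a *m e)).
  have [y yE] : exists y, y = e - x by exists (e - x).
  have Mx : M x by rewrite xE -Ba; apply: MZ (ltW t0) _; exact: BM.
  have My : M y.
    by rewrite yE xE -Ba scalemxAr -mulmxBr; exact: BM.
  have xy : x + y = e by rewrite yE addrCA subrr addr0.
  have fxy : ev f x + ev f y = 1 by rewrite -evD xy.
  have [X XE] : exists X, X = x - ev f x *: c by exists (x - ev f x *: c).
  have [Y YE] : exists Y, Y = y - ev f y *: c by exists (y - ev f y *: c).
  have [fx qx] := Mball x Mx; have [fy qy] := Mball y My.
  rewrite -XE in qx; rewrite -YE in qy.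
  have XY : q (X + Y) = s.
    by rewrite XE YE addrACA -opprD -scalerDl xy fxy scale1r.
  (* equality in the convexity of the ball forces [x] and [y] to be parallel *)
  have := dot_eq0 (v := ev f y *: X - ev f x *: Y).
  rewrite !(dotDl, dotDr, dotNl, dotNr, dotZl, dotZr) (dotC Y X).
  move: XY; rewrite !(dotDl, dotDr) (dotC Y X) => XY.
  have h1 : ev f y * q X <= ev f y * (s * ev f x ^+ 2) by rewrite ler_wpM2l.
  have h2 : ev f x * q Y <= ev f x * (s * ev f y ^+ 2) by rewrite ler_wpM2l.
  have fyE : ev f y = 1 - ev f x by rewrite -fxy addrAC subrr add0r.
  have key : ev f y * (ev f y * q X) - ev f x * (ev f y * dot X Y) -
    (ev f y * (ev f x * dot X Y) - ev f x * (ev f x * q Y)) <= 0.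
    have -> : dot X Y = (s - q X - q Y) / 2 by rewrite -XY; field.
    move: h1 h2; rewrite fyE => h1 h2; lra.
  move=> /(_ ltac:(lra))/subr0_eq eXY.
  have : ev f y *: x = ev f x *: y.
    rewrite XE YE !scalerBr !scalerA (mulrC (ev f y) (ev f x)) in eXY.
    exact: addIr eXY.
  rewrite {2}yE scalerBr => /eqP; rewrite eq_sym subr_eq -scalerDl.
  rewrite addrC in fxy; rewrite fxy scale1r => /eqP ex.
  exists (t^-1 * ev f x); rewrite -scalerA ex xE scalerA mulVf ?scale1r//.
  by rewrite gt_eqF.
- by move=> v Mv fv; have [_] := Mball v Mv; rewrite fv scale1r expr1n mulr1 qe.
Qed.

(** The eigenrays of a minimal cone generate a cone reaching the interior: if a
functional separated an interior point from them, a point of the slice farthest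
from a centre far away on the negative side of that functional would be an
eigenray on the positive side. *)
Lemma eigenray_sum_interior : exists s : seq 'cV[R]_d,
  {in s, forall x, M x /\ eigenray A x} /\ O (\sum_(x <- s) x).
Proof.
have [clM cM invM [p Mp Op]] := gM; have [M0 MD MZ] := cM.
pose E := [set v | exists s : seq 'cV[R]_d,
  {in s, forall x, M x /\ eigenray A x} /\ v = \sum_(x <- s) x].
suff [v [[s [sE ->]] Os]] : exists v, E v /\ O v by exists s.
have cE : convex_cone E.
  split.
  - by exists [::]; rewrite big_nil.
  - move=> _ _ [s [sE ->]] [t [tE ->]]; exists (s ++ t); rewrite big_cat.
    by split => // x; rewrite mem_cat => /orP[/sE|/tE].
  - move=> c _ c0 [s [sE ->]]; move: c0; rewrite le_eqVlt => /orP[/eqP <-|c0].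
      by exists [::]; rewrite big_nil scale0r.
    exists [seq c *: x | x <- s]; split.
      move=> _ /mapP[x /sE[Mx [x0 xA]] ->]; split; first by apply: MZ => //; exact: ltW.
      split; first by rewrite scaler_eq0 negb_or gt_eqF.
      move=> a /xA[t at_]; exists t.
      by rewrite -scalemxAr at_ !scalerA mulrC.
    by rewrite big_map scaler_sumr.
pose D := closure E.
have cD : convex_cone D.
  have [E0 ED EZ] := cE; split.
  - exact: subset_closure.
  - move=> u v /closure_seq[x [Ex xu]] /closure_seq[y [Ey yv]].
    have xyuv : x k + y k @[k --> \oo] --> u + v by exact: cvgD.
    by apply: cvg_closure xyuv; apply: nearW => k; exact: ED.
  - move=> c v c0 /closure_seq[x [Ex xv]].
    have cxv : c *: x k @[k --> \oo] --> c *: v by exact: cvgZl_tmp.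
    by apply: cvg_closure cxv; apply: nearW => k; exact: EZ.
have [Dp|nDp] := pselect (D p).
  by have [v [Ev Ov]] := Dp O (open_nbhs_nbhs (conj (cone_open hO) Op)); exists v.
have [xi [xip xiD]] := cone_separation (@closed_closure _ E) cD nDp.
have fp : 0 < ev f p by exact: (cone_gt0 hO).
have [m [Mm fm xim]] : exists m, [/\ M m, ev f m = 1 & 0 < dot xi m].
  exists ((ev f p)^-1 *: p); split.
  - by apply: MZ => //; rewrite invr_ge0 ltW.
  - by rewrite evZ mulVf// gt_eqF.
  - by rewrite dotZr mulr_gt0// invr_gt0.
(* [d%:R * b ^+ 2] bounds [dot v v] on the slice, so points of the slice on the
   negative side are closer to the centre [- (t *: xi)] than [m] is *)
pose t := (d%:R * b ^+ 2 + 1) / dot xi m.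
have t0 : 0 < t by rewrite divr_gt0// ltr_wpDl// mulr_ge0// sqr_ge0.
have [e [Me fe eA emax]] := extremal_eigenray (- (t *: xi)).
have := emax m Mm fm; rewrite !opprK !(dotDl, dotDr, dotZl, dotZr) (dotC m xi) (dotC e xi).
have xie : dot xi e <= 0.
  apply/xiD/subset_closure; exists [:: e]; rewrite big_seq1; split => // x.
  by rewrite inE => /eqP ->.
have qe : q e <= d%:R * b ^+ 2.
  rewrite (le_trans (dot_le_norm _))// ler_wpM2l// lerXn2r ?nnegrE ?(cone_bound0 hO)//.
  by rewrite -[leRHS]mulr1 -fe; apply/(clcone_bound hO)/MK.
have qm : 0 <= q m := dot_ge0 m.
have tm : t * dot xi m = d%:R * b ^+ 2 + 1 by rewrite /t divfK// gt_eqF.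
have te : t * dot xi e <= 0 by rewrite mulr_ge0_le0// ltW.
have B0 : 0 <= d%:R * b ^+ 2 by rewrite mulr_ge0// sqr_ge0.
move: qe tm B0; move: (d%:R * b ^+ 2) => B qe tm B0.
clearbody t => h; exfalso; lra.
Qed.

End ExtremalEigenrays.

(** * Eigenrays of the core with interior sum *)

Section InteriorEigensum.
Context (R : realType) (d : nat) (f : 'rV[R]_d) (b : R) (O : set 'cV[R]_d).
Context (hO : sharp_cone f b O).
Local Notation K := (closure O).
Context (G : set 'M[R]_d) (hG : cone_group O G) (disc : proj_discrete G).
Context (F : set_system nat) {FU : UltraFilter F} (freeF : eventually `<=` F).
Context (C : set 'cV[R]_d) (hC : cocompact_core O G F C).
Context (A : set 'M[R]_d) (AG : A `<=` G).
Context (AA : forall a a', A a -> A a' -> a *m a' = a' *m a).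
Local Notation Z := (centralizing G A).
Local Notation KC := (closure C).

Lemma core_clcone v : KC v -> K v.
Proof. exact: (closure_subset (core_sub hC)). Qed.

Lemma clcore_cone : convex_cone KC.
Proof.
split.
- have [v Cv] := core_nonempty hC.
  have hv : harmonic k *: v @[k --> \oo] --> (0 : 'cV[R]_d).
    by rewrite -(scale0r v); apply: cvgZr_tmp; exact: cvg_harmonic.
  apply: cvg_closure hv; apply: nearW => k; apply: (coreZ hC) => //.
  by rewrite invr_gt0.
- move=> u v /closure_seq[x [Cx xu]] /closure_seq[y [Cy yv]].
  have xyuv : x k + y k @[k --> \oo] --> u + v by exact: cvgD.
  by apply: cvg_closure xyuv; apply: nearW => k; exact: (coreD hC).
- move=> c v; rewrite le_eqVlt => /orP[/eqP <-|c0] /closure_seq[x [Cx xv]].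
    have hv : harmonic k *: x 0%N @[k --> \oo] --> 0 *: v.
      rewrite scale0r -(scale0r (x 0%N)).
      by apply: cvgZr_tmp; exact: cvg_harmonic.
    apply: cvg_closure hv; apply: nearW => k; apply: (coreZ hC) => //.
    by rewrite invr_gt0.
  have cxv : c *: x k @[k --> \oo] --> c *: v by exact: cvgZl_tmp.
  by apply: cvg_closure cxv; apply: nearW => k; exact: (coreZ hC).
Qed.

Lemma clcore_sum (I : Type) (r : seq I) (P : pred I) (x : I -> 'cV[R]_d) :
  (forall i, P i -> KC (x i)) -> KC (\sum_(i <- r | P i) x i).
Proof. by have [KC0 KCD _] := clcore_cone => Mx; elim/big_ind : _. Qed.

Lemma clcore_inv g v : G g -> KC v -> KC (g *m v).
Proof.
move=> Gg /closure_seq[x [Cx xv]].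
have gxv : g *m x k @[k --> \oo] --> g *m v by exact: cvg_mulmxr.
by apply: cvg_closure gxv; apply: nearW => k; exact: (core_inv hC).
Qed.

Lemma centralizing_abelian : A `<=` Z.
Proof. by move=> a Aa; split; [exact: AG|move=> a' Aa'; exact: AA]. Qed.

(** Finitely many elements span [A], and they displace some point of the core by a
bounded amount.  The points of the closed core displaced by at most this amount
form a cone [M0] invariant under the centralizer, on the interior of which the
centralizer is recurrent; a minimal invariant subcone of [M0] then has enough
eigenrays. *)
Lemma interior_eigensum : exists s : seq 'cV[R]_d,
  {in s, forall x, KC x /\ eigenray A x} /\ O (\sum_(x <- s) x).
Proof.
have [S [SA AS]] := finite_span A.
have [p Cp] := core_nonempty hC; have Op := core_sub hC Cp.
have H s : exists ab : R * R, s \in S ->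
    [/\ 0 < ab.2, K (ab.1 *: p - s *m p) & K (s *m p - ab.2 *: p)].
  have [sS|nS] := boolP (s \in S); last by exists (0, 0).
  have Osp : O (s *m p) by apply: (cg_cone hG) => //; exact/AG/SA.
  have [e e0 Oe] := cone_absorb hO (- (s *m p)) Op.
  have [e' e'0 Oe'] := cone_absorb hO (- p) Osp.
  exists (e^-1, e') => _; split => //=.
  - have -> : e^-1 *: p - s *m p = e^-1 *: (p + e *: (- (s *m p))).
      by rewrite scalerDr scalerA mulVf ?gt_eqF// scale1r.
    by apply/subset_closure/(coneZ hO) => //; rewrite invr_gt0.
  - by rewrite -scalerN; exact: subset_closure.
have [ab abP] := choice H.
pose al s := (ab s).1; pose be s := (ab s).2.
pose M0 := [set v | KC v /\ {in S, forall s, K (al s *: v - s *m v) /\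
                                             K (s *m v - be s *: v)}].
have [kc0 kcD kcZ] := clcore_cone.
have hZ := centralizing_group hG A.
have gM0 : full_invariant_cone O Z M0.
  split.
  - move=> v /closure_seq[x [Mx xv]]; split.
      by apply: closure_lim xv; apply: nearW => k; case: (Mx k).
    move=> s sS; split.
      have h : al s *: x k - s *m x k @[k --> \oo] --> al s *: v - s *m v.
        by apply: cvgB; [exact: cvgZl_tmp|exact: cvg_mulmxr].
      by apply: closure_lim h; apply: nearW => k; have [_ /(_ s sS)[]] := Mx k.
    have h : s *m x k - be s *: x k @[k --> \oo] --> s *m v - be s *: v.
      by apply: cvgB; [exact: cvg_mulmxr|exact: cvgZl_tmp].
    by apply: closure_lim h; apply: nearW => k; have [_ /(_ s sS)[]] := Mx k.
  - split.
    + split; first exact: kc0.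
      move=> s sS; rewrite !scaler0 mulmx0 subr0.
      by have K0 := clcone0 hO; split; exact: K0.
    + move=> u v [Cu uS] [Cv vS]; split; first exact: (kcD _ _ Cu Cv).
      move=> s sS; have [u1 u2] := uS s sS; have [v1 v2] := vS s sS.
      rewrite !scalerDr !mulmxDr !opprD !(addrACA _ _ (- _)).
      exact: (conj (clconeD hO u1 v1) (clconeD hO u2 v2)).
    + move=> c v c0 [Cv vS]; split; first exact: (kcZ _ _ c0 Cv).
      move=> s sS; have [v1 v2] := vS s sS.
      rewrite -scalemxAr !scalerA !(mulrC _ c) -!scalerA -!scalerBr.
      exact: (conj (clconeZ hO c0 v1) (clconeZ hO c0 v2)).
  - move=> z v [Gz zA] [Cv vS]; split; first exact: clcore_inv.
    move=> s sS; have [v1 v2] := vS s sS.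
    rewrite mulmxA -(zA s (SA s sS)) -mulmxA !scalemxAr -!mulmxBr.
    exact: (conj (cg_clcone hG Gz v1) (cg_clcone hG Gz v2)).
  - exists p; last exact: Op.
    split; first exact: (subset_closure Cp).
    by move=> s sS; have [_ Ks1 Ks2] := abP s sS; exact: (conj Ks1 Ks2).
have rec v : (forall k, M0 (v k) /\ O (v k)) ->
    exists z w, [/\ forall k : nat, Z (z k), O w & z k *m v k @[k --> F] --> w].
  move=> Mv; apply: (centralizer_recurrence hO hG disc hC AG SA AS (al := al) (be := be)).
  - by move=> s /abP[].
  - move=> k; have [[Cv _] Ov] := Mv k.
    exact: (core_closed hO hG disc freeF hC).
  - by move=> k s sS; have [[_ vS] _] := Mv k; exact: vS.
have [M [gM MM0 minM]] := minimal_invariant_cone hO freeF gM0 rec.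
have MK : M `<=` K by move=> v /MM0[/core_clcone].
have ZA z a : Z z -> A a -> z *m a = a *m z by move=> [_]; exact.
have [s [sP Os]] := eigenray_sum_interior hO hZ centralizing_abelian ZA gM MK minM.
exists s; split => // x /sP[Mx xA]; split => //.
by have [] := MM0 x Mx.
Qed.

End InteriorEigensum.

(** Induction on the forms: to a vector which is good for all forms but [phi i],
add a multiple of a vector which is good for [phi i], with a factor larger than
the finitely many ratios at which a form could vanish. *)
Lemma common_nonvanishing (R : realType) (E : lmodType R) (P : set E)
    (I : eqType) (r : seq I) (phi : I -> E -> R) :
  (forall u v c, P u -> P v -> P (u + c *: v)) -> P 0 ->
  (forall i u v c, phi i (u + c *: v) = phi i u + c * phi i v) ->
  {in r, forall i, exists2 u, P u & phi i u != 0} ->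
  exists2 u, P u & {in r, forall i, phi i u != 0}.
Proof.
move=> PD P0 lin; elim: r => [_|i r IH rP]; first by exists 0.
have [|u Pu ur] := IH; first by move=> j jr; apply: rP; rewrite inE jr orbT.
have [v Pv vi] := rP i (mem_head _ _).
pose c := 1 + \sum_(j <- i :: r) `|phi j u / phi j v|.
exists (u + c *: v); first exact: PD.
move=> j jr; rewrite lin; have [v0|v0] := eqVneq (phi j v) 0.
  rewrite v0 mulr0 addr0; move: jr; rewrite inE => /orP[/eqP ji|]; last exact: ur.
  by rewrite -ji v0 eqxx in vi.
apply/eqP => /(canRL (addrK _)); rewrite sub0r => uE.
have : `|phi j u / phi j v| < c.
  by rewrite /c (big_rem j)//= addrCA ltrDl ltr_wpDr// sumr_ge0.
rewrite uE mulNr mulfK// normrN => /(le_lt_trans (ler_norm c)).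
by rewrite ltxx.
Qed.

(** * Simultaneous eigenspaces *)

(** Simultaneous eigenspaces [W j] of the group [A] inside [V], spanned by
eigenrays of the convex cone [D]; [P j] restricts on [V] to the projection onto
[W j] and [chi j] is the character by which [A] acts on [W j]. *)
Record joint_eigenspaces (R : realType) (d : nat) (A Z : set 'M[R]_d)
    (D : set 'cV[R]_d) (V : {vspace 'cV[R]_d}) (m : nat)
    (W : 'I_m -> {vspace 'cV[R]_d}) (P : 'I_m -> 'M[R]_d)
    (chi : 'I_m -> 'M[R]_d -> R) : Prop := JointEigenspaces {
  je_sum : forall v, v \in V -> \sum_j P j *m v = v;
  je_proj : forall j v, v \in V -> P j *m v \in W j;
  je_sub : forall j, (W j <= V)%VS;
  je_id : forall i j v, v \in W j -> P i *m v = if i == j then v else 0;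
  je_comm : forall j z, Z z -> z *m P j = P j *m z;
  je_scal : forall j a v, A a -> v \in W j -> a *m v = chi j a *: v;
  je_gt0 : forall j a, A a -> 0 < chi j a;
  je_sep : forall i j, i != j -> exists2 a, A a & chi i a < chi j a;
  je_gen : forall j, exists xs, [/\ xs != [::],
    {in xs, forall x, D x /\ eigenray A x} & W j = <<xs>>%VS];
  je_eig : forall x, D x -> eigenray A x -> exists j, x \in W j }.

Section JointEigenspaces.
Context (R : realType) (d : nat) (f : 'rV[R]_d) (b : R) (O : set 'cV[R]_d).
Context (hO : sharp_cone f b O).
Local Notation K := (closure O).
Context (A : set 'M[R]_d) (hA : cone_group O A).
Context (Z : set 'M[R]_d) (ZA : forall z a, Z z -> A a -> z *m a = a *m z).
Context (D : set 'cV[R]_d) (DK : D `<=` K).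
Context (V : {vspace 'cV[R]_d}).
Context (DV : forall x, D x -> eigenray A x -> x \in V).
Context (Vmin : forall W : {vspace 'cV[R]_d},
  (forall x, D x -> eigenray A x -> x \in W) -> (V <= W)%VS).

Local Notation X := [set x | D x /\ eigenray A x].

Definition eigval (x : 'cV[R]_d) (a : 'M[R]_d) : R := ev f (a *m x) / ev f x.

Lemma eigvalD x a c a' : eigval x (a + c *: a') = eigval x a + c * eigval x a'.
Proof.
by rewrite /eigval mulmxDl -scalemxAl evD evZ mulrDl mulrA.
Qed.

Lemma eigenray_f0 x : X x -> ev f x != 0.
Proof. by move=> [/DK Kx [x0 _]]; rewrite gt_eqF// (clcone_gt0 hO). Qed.

Lemma eigvalE x a c : X x -> a *m x = c *: x -> eigval x a = c.
Proof. by move=> Xx ax; rewrite /eigval ax evZ mulfK// eigenray_f0. Qed.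

Lemma eigval_scal x a : X x -> A a -> a *m x = eigval x a *: x.
Proof.
by move=> Xx Aa; have [_ [_ /(_ a Aa)[c ax]]] := Xx; rewrite (eigvalE Xx ax).
Qed.

Lemma eigval_gt0 x a : X x -> A a -> 0 < eigval x a.
Proof.
move=> Xx Aa; have [/DK Kx [x0 _]] := Xx.
rewrite divr_gt0// (clcone_gt0 hO)//; first exact: (cg_clcone hA).
by apply: contra_neq x0 => ax; rewrite -(cg_mulKmx hA x Aa) ax mulmx0.
Qed.

Lemma eigval_inv x a : X x -> A a -> eigval x (invmx a) = (eigval x a)^-1.
Proof.
move=> Xx Aa; apply: (eigvalE Xx).
rewrite -{1}(scale1r x) -(mulVf (lt0r_neq0 (eigval_gt0 Xx Aa))) -scalerA.
by rewrite -eigval_scal// -scalemxAr (cg_mulKmx hA).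
Qed.

Lemma eigval_span (S : seq 'M[R]_d) x a : X x -> {in S, forall s, A s} ->
  a \in <<S>>%VS ->
  a *m x = eigval x a *: x /\
  eigval x a = \sum_(i < size S) coord (in_tuple S) i a * eigval x S`_i.
Proof.
move=> Xx SA aS; set c := \sum_(i < _) _.
have ax : a *m x = c *: x.
  rewrite {1}(coord_span (X := in_tuple S) aS) mulmx_suml scaler_suml.
  apply: eq_bigr => i _; rewrite -scalemxAl eigval_scal ?scalerA//.
  exact/SA/mem_nth.
by rewrite (eigvalE Xx ax).
Qed.

(** Lagrange interpolation: the polynomial in [T] which is [1] at [t] and
vanishes at the members of [r]. *)
Definition lagrange (T : 'M[R]_d) (t : R) (r : seq R) : 'M[R]_d :=
  foldr (fun u M => (t - u)^-1 *: ((T - u%:M) *m M)) 1%:M r.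

Lemma lagrange_comm T t r z : z *m T = T *m z ->
  z *m lagrange T t r = lagrange T t r *m z.
Proof.
move=> zT; elim: r => [|u r IH] /=; first by rewrite mulmx1 mul1mx.
rewrite -scalemxAr -scalemxAl mulmxA mulmxBr zT scalar_mxC -mulmxBl.
by rewrite -!mulmxA IH.
Qed.

Lemma lagrange_eig T t r (x : 'cV[R]_d) l : T *m x = l *: x ->
  lagrange T t r *m x = (\prod_(u <- r) ((l - u) / (t - u))) *: x.
Proof.
move=> Tx; elim: r => [|u r IH] /=; first by rewrite big_nil mul1mx scale1r.
rewrite big_cons -scalemxAl -mulmxA IH -scalemxAr mulmxBl Tx mul_scalar_mx.
by rewrite -scalerBl !scalerA; congr (_ *: _); ring.
Qed.

(** Choose [T] in the span of [A] at which different characters take different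
values.  The eigenspaces of this single operator are the joint eigenspaces, and
the projections are polynomials in [T], so they commute with whatever commutes
with [A].  Two different characters differ in both directions, at some [a] and
at its inverse. *)
Lemma joint_eigenspaces_exist : exists m W P chi,
  @joint_eigenspaces R d A Z D V m W P chi.
Proof.
have [S [SA AS]] := finite_span A.
have [xs [xsX Xxs]] := finite_span X.
have xsXv x : x \in xs -> X x by move=> /xsX.
have Vxs : V = <<xs>>%VS.
  apply/eqP; rewrite eqEsubv; apply/andP; split.
    by apply: Vmin => x Dx xA; exact: Xxs.
  by apply/span_subvP => x /xsX[Dx xA]; exact: DV.
pose r : seq ('cV[R]_d * 'cV[R]_d) := [seq p <- [seq (x, y) | x <- xs, y <- xs] |
  `[< exists2 a, A a & eigval p.1 a != eigval p.2 a >]].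
have [||||T TS Tr] := @common_nonvanishing R _ [set a | a \in <<S>>%VS] _ r
    (fun p a => eigval p.1 a - eigval p.2 a).
- by move=> u v c /= uS vS; rewrite memvD// memvZ.
- exact: mem0v.
- by move=> p u v c; rewrite !eigvalD; ring.
- move=> p; rewrite mem_filter => /andP[/asboolP[a Aa pa] _].
  by exists a; [exact: AS|rewrite subr_eq0].
have Tsep x y : x \in xs -> y \in xs -> eigval x T = eigval y T ->
    forall a, A a -> eigval x a = eigval y a.
  move=> xs_x xs_y exy a Aa; apply/eqP; apply: contraT => ne.
  have /Tr : (x, y) \in r.
    rewrite mem_filter; apply/andP; split; first by apply/asboolP; exists a.
    by apply/allpairsP; exists (x, y).
  by rewrite /= exy subrr eqxx.
pose ts := undup [seq eigval x T | x <- xs].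
pose cls t := [seq x <- xs | eigval x T == t].
pose W (j : 'I_(size ts)) := <<cls ts`_j>>%VS.
pose P (j : 'I_(size ts)) := lagrange T ts`_j (rem ts`_j ts).
have tsj (j : 'I_(size ts)) : ts`_j \in ts by exact: mem_nth.
have uts : uniq ts by exact: undup_uniq.
have repP (j : 'I_(size ts)) : exists x, x \in cls ts`_j.
  have := tsj j; rewrite mem_undup => /mapP[x xxs tx]; exists x.
  by rewrite mem_filter xxs tx eqxx.
have [rep repE] := choice repP.
pose chi j a := eigval (rep j) a.
have PT (j : 'I_(size ts)) (x : 'cV[R]_d) : T *m x = ts`_j *: x -> P j *m x = x.
  move=> Tx; rewrite (lagrange_eig _ _ Tx) big_seq big1 ?scale1r// => u.
  rewrite mem_rem_uniq// inE => /andP[ut _].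
  by rewrite divff// subr_eq0 eq_sym.
have PN (j : 'I_(size ts)) (x : 'cV[R]_d) l : T *m x = l *: x -> l \in ts -> l != ts`_j -> P j *m x = 0.
  move=> Tx lts lj; rewrite (lagrange_eig _ _ Tx) (big_rem l)/=.
    by rewrite subrr !mul0r scale0r.
  by rewrite mem_rem_uniq// inE lj.
have span_ind (L : 'M[R]_d) (ys : seq 'cV[R]_d) v (M : 'M[R]_d) :
    {in ys, forall y, L *m y = M *m y} -> v \in <<ys>>%VS -> L *m v = M *m v.
  move=> LM vys; rewrite (coord_span (X := in_tuple ys) vys) !mulmx_sumr.
  apply: eq_bigr => i _; rewrite -!scalemxAr LM//.
  exact: mem_nth.
have Tcls (j : 'I_(size ts)) x : x \in cls ts`_j -> T *m x = ts`_j *: x.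
  rewrite mem_filter => /andP[/eqP <- xxs].
  by have [] := eigval_span (xsXv _ xxs) SA TS.
have Pid i j v : v \in W j -> P i *m v = if i == j then v else 0.
  move=> vW; have [->|ij] := eqVneq i j.
    rewrite -[RHS]mul1mx; apply: span_ind vW => x /Tcls Tx.
    by rewrite PT// mul1mx.
  rewrite -[RHS](mul0mx _ v); apply: span_ind vW => x /Tcls Tx.
  rewrite (PN _ _ _ Tx)// ?mul0mx//.
  by rewrite nth_uniq// eq_sym.
have clsxs (j : 'I_(size ts)) x : x \in cls ts`_j -> x \in xs by rewrite mem_filter => /andP[].
have xcls x : x \in xs -> exists j : 'I_(size ts), x \in cls ts`_j.
  move=> xxs; have xts : eigval x T \in ts by rewrite mem_undup; apply/mapP; exists x.
  have jlt : (index (eigval x T) ts < size ts)%N by rewrite index_mem.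
  by exists (Ordinal jlt); rewrite mem_filter xxs /= nth_index// eqxx.
have WV j : (W j <= V)%VS.
  by apply/span_subvP => x /clsxs xxs; rewrite Vxs memv_span.
have sumP v : v \in V -> \sum_j P j *m v = v.
  rewrite Vxs => vxs; rewrite -mulmx_suml -[RHS]mul1mx.
  apply: span_ind vxs => x /xcls[j xj]; rewrite mul1mx mulmx_suml.
  rewrite (bigD1 j)//= (Pid _ j) ?memv_span// eqxx big1 ?addr0// => i ij.
  by rewrite (Pid _ j) ?memv_span// (negbTE ij).
have projP j v : v \in V -> P j *m v \in W j.
  rewrite Vxs => vxs; rewrite (coord_span (X := in_tuple xs) vxs) mulmx_sumr.
  apply: memv_suml => i _; rewrite -scalemxAr memvZ//.
  have [k xk] : exists k : 'I_(size ts), xs`_i \in cls ts`_k.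
    by apply: xcls; exact: mem_nth.
  rewrite /= (Pid _ k _ (memv_span xk)); case: eqP => [->|_]; last exact: mem0v.
  by rewrite memv_span.
have scal j a v : A a -> v \in W j -> a *m v = chi j a *: v.
  move=> Aa vW; rewrite -mul_scalar_mx; apply: span_ind vW => x xj.
  rewrite mul_scalar_mx /chi (eigval_scal (xsXv _ (clsxs _ _ xj)) Aa).
  congr (_ *: _); apply: Tsep => //; [exact: clsxs xj|exact: clsxs (repE j)|].
  move: xj (repE j); rewrite !mem_filter => /andP[/eqP -> _] /andP[/eqP -> _].
  by [].
have Xrep j : X (rep j) by exact/xsXv/clsxs/repE.
exists (size ts), W, P, chi; split => //.
- move=> j z Zz; apply: lagrange_comm.
  by apply: commutes_span TS => s /SA As; exact: ZA.
- by move=> j a Aa; exact: eigval_gt0.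
- move=> i j ij.
  have [a Aa ne] : exists2 a, A a & chi i a != chi j a.
    apply: contrapT => no; move/eqP: ij; apply.
    have eq_ij a : A a -> chi i a = chi j a.
      by move=> Aa; apply/eqP; apply: contraT => ne; exfalso; apply: no; exists a.
    have eT : eigval (rep i) T = eigval (rep j) T.
      have [_ ->] := eigval_span (Xrep i) SA TS.
      have [_ ->] := eigval_span (Xrep j) SA TS.
      apply: eq_bigr => k _; congr (_ * _); apply: eq_ij.
      exact/SA/mem_nth.
    have rE k : eigval (rep k) T = ts`_k.
      by have := repE k; rewrite mem_filter => /andP[/eqP].
    apply/val_inj/eqP; rewrite /= -(nth_uniq 0 (ltn_ord i) (ltn_ord j) uts) -!rE.
    exact/eqP.
  have [lt|gt|eq] := ltgtP (chi i a) (chi j a); first by exists a.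
  - exists (invmx a); first exact: (cgV hA).
    by rewrite /chi !eigval_inv// ltf_pV2// posrE; exact: eigval_gt0.
  - by rewrite eq eqxx in ne.
- move=> j; exists (cls ts`_j); split => //.
    by apply/eqP => c0; have := repE j; rewrite c0.
  by move=> x /clsxs/xsXv.
- move=> x Dx xA; have xV := DV Dx xA.
  have Xx : X x by [].
  have [Tx _] := eigval_span Xx SA TS.
  have [j Pjx] : exists j, P j *m x != 0.
    apply: contrapT => no; have [x0 _] := xA; move/eqP: x0; apply.
    rewrite -(sumP x xV) big1// => j _; apply/eqP; apply: contraT => ne.
    by exfalso; apply: no; exists j.
  exists j; have TPx : T *m (P j *m x) = ts`_j *: (P j *m x).
    rewrite -[RHS]mul_scalar_mx; apply: span_ind (projP j x xV) => y /Tcls.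
    by rewrite mul_scalar_mx.
  have : ts`_j = eigval x T.
    have : T *m (P j *m x) = eigval x T *: (P j *m x).
      by rewrite mulmxA /P (@lagrange_comm T _ _ T)// -mulmxA Tx -scalemxAr.
    rewrite TPx => /eqP; rewrite -subr_eq0 -scalerBl scaler_eq0 (negbTE Pjx) orbF.
    by rewrite subr_eq0 => /eqP.
  by move=> tE; rewrite -(PT j x) ?projP// tE.
Qed.

End JointEigenspaces.

(** * The fixed subspace is a join inside the core *)

Section LinearMaps.
Context (R : realType) (d : nat).

Lemma mulmx_norm (g : 'M[R]_d) (v : 'cV[R]_d) : `|g *m v| <= d%:R * `|g| * `|v|.
Proof.
apply: mx_norm_le => [|i j]; first by rewrite !mulr_ge0.
rewrite mxE (le_trans (ler_norm_sum _ _ _))//.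
rewrite -mulrA -[d in d%:R]card_ord -sumr_const mulr_suml; apply: ler_sum => k _.
by rewrite mul1r normrM ler_pM// mx_entry_le.
Qed.

Lemma linear_form_bounded (phi : {scalar 'cV[R]_d}) :
  exists2 c, 0 <= c & forall u, `|phi u| <= c * `|u|.
Proof.
exists (\sum_k `|phi (delta_mx k 0)|); first by rewrite sumr_ge0.
move=> u; have uE : u = \sum_k u k 0 *: delta_mx k 0.
  by rewrite {1}(matrix_sum_delta u); apply: eq_bigr => k _; rewrite big_ord1.
rewrite {1}uE linear_sum (le_trans (ler_norm_sum _ _ _))// mulr_suml.
apply: ler_sum => k _; rewrite linearZ normrM mulrC ler_wpM2l//.
exact: mx_entry_le.
Qed.

Lemma closed_vspace (V : {vspace 'cV[R]_d}) (T : Type) (F : set_system T)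
    {FF : ProperFilter F} (u : T -> 'cV[R]_d) (v : 'cV[R]_d) :
  (forall t, u t \in V) -> u t @[t --> F] --> v -> v \in V.
Proof.
move=> uV uv; pose p w := projv V w.
have pE w : p w = \sum_k w k 0 *: p (delta_mx k 0).
  rewrite {1}(matrix_sum_delta w) /p linear_sum; apply: eq_bigr => k _.
  by rewrite big_ord1 linearZ.
have pu : p (u t) @[t --> F] --> p v.
  under eq_cvg do rewrite pE; rewrite pE.
  apply: cvg_big => [|k _]; first exact: add_continuous.
  by apply: cvgZr_tmp; have /cvg_mxP := uv; exact.
have -> : v = p v.
  apply: (@mx_cvg_unique _ _ _ _ F _ u) => //.
  by under eq_cvg do rewrite -[u _](projv_id (uV _)).
exact: memv_proj.
Qed.

End LinearMaps.

Section FixedSubspace.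
Context (R : realType) (d : nat) (f : 'rV[R]_d) (b : R) (O : set 'cV[R]_d).
Context (hO : sharp_cone f b O).
Local Notation K := (closure O).
Context (G : set 'M[R]_d) (hG : cone_group O G) (disc : proj_discrete G).
Context (F : set_system nat) {FU : UltraFilter F} (freeF : eventually `<=` F).
Context (C : set 'cV[R]_d) (hC : cocompact_core O G F C).
Local Notation KC := (closure C).
Context (A : set 'M[R]_d) (hA : cone_group O A) (AG : A `<=` G).
Context (AA : forall a a', A a -> A a' -> a *m a' = a' *m a).
Local Notation Z := (centralizing G A).
Context (noFix : forall v, O v -> ~ eigenray A v).
Context (limC : forall p y, O p -> closure [set g *m p | g in G] y ->
  y != 0 -> ~ O y -> KC y).
Context (V : {vspace 'cV[R]_d}) (m : nat) (W : 'I_m -> {vspace 'cV[R]_d}).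
Context (P : 'I_m -> 'M[R]_d) (chi : 'I_m -> 'M[R]_d -> R).
Context (hV : joint_eigenspaces A Z KC V W P chi).

Let AZ : A `<=` Z := centralizing_abelian AG AA.
Let hZ : cone_group O Z := centralizing_group hG A.

Lemma je_mem i v : v \in W i -> v \in V.
Proof. exact/subvP/(je_sub hV). Qed.

Lemma je_W i v : v \in V -> (forall j, j != i -> P j *m v = 0) -> v \in W i.
Proof.
move=> vV vj; rewrite -(je_sum hV vV) (bigD1 i)//= big1 ?addr0//.
exact: (je_proj hV).
Qed.

(** Centralizing maps permute the eigenrays of the closed core, which span [V]. *)
Lemma centralizer_stable z v : Z z -> v \in V -> z *m v \in V.
Proof.
move=> Zz vV; have [Gz zA] := Zz; rewrite -(je_sum hV vV) mulmx_sumr.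
apply: memv_suml => j _; have := je_proj hV j vV.
have [xs [_ xsX ->]] := je_gen hV j => vxs.
rewrite (coord_span (X := in_tuple xs) vxs) mulmx_sumr.
apply: memv_suml => i _; rewrite -scalemxAr memvZ//.
have xi : xs`_i \in xs by exact: mem_nth.
have [Cx [x0 xA]] := xsX _ xi.
have Cz : KC (z *m xs`_i) by exact: (clcore_inv hC).
have Az : eigenray A (z *m xs`_i).
  split.
    by apply: contra_neq x0 => zx; rewrite -(cg_mulKmx hG xs`_i Gz) zx mulmx0.
  move=> a Aa; have [c ax] := xA a Aa; exists c.
  by rewrite mulmxA -zA// -mulmxA ax -scalemxAr.
by have [k zx] := je_eig hV Cz Az; exact: je_mem zx.
Qed.

Lemma centralizer_stable_eigenspace z i v : Z z -> v \in W i -> z *m v \in W i.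
Proof.
move=> Zz vW; have vV := je_mem vW.
apply: je_W; first exact: centralizer_stable.
move=> j ji; rewrite mulmxA -(je_comm hV j Zz) -mulmxA (je_id hV j vW).
by rewrite (negbTE ji) mulmx0.
Qed.

(** For [j != i] some element of [A], normalized to fix [x], expands the [j]-th
component by a factor [rho > 1] while keeping [v] in the bounded order interval
between [0] and [x]; so this component of [v] vanishes. *)
Lemma face_in_eigenspace i x v : x \in W i -> v \in V -> K v -> K (x - v) ->
  v \in W i.
Proof.
move=> xW vV Kv Kxv; apply: je_W => // j ji; apply/eqP; apply: contraT => Pv.
have ij : i != j by rewrite eq_sym.
have [a0 Aa0 sep] := je_sep hV ij.
have ci := je_gt0 hV i Aa0.
pose a := (chi i a0)^-1 *: a0; pose rho := chi j a0 / chi i a0.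
have Aa : A a by apply: (cgZ hA) => //; rewrite invr_gt0.
have rho1 : 1 < rho by rewrite ltr_pdivlMr// mul1r.
have rho0 : 0 < rho by exact: lt_trans rho1.
have ax : a *m x = x.
  by rewrite /a -scalemxAl (je_scal hV Aa0 xW) scalerA mulVf ?scale1r// gt_eqF.
pose vn n := iter n (mulmx a) v.
have vnP n : [/\ K (vn n), K (x - vn n) & P j *m vn n = rho ^+ n *: (P j *m v)].
  elim: n => [|n [IH1 IH2 IH3]]; first by rewrite expr0 scale1r.
  split.
  - exact: (cg_clcone hA).
  - by rewrite -{1}ax /vn iterS -mulmxBr; exact: (cg_clcone hA).
  - rewrite /vn iterS mulmxA -(je_comm hV j (AZ Aa)) -mulmxA IH3 -scalemxAr.
    rewrite /a -scalemxAl (je_scal hV Aa0 (je_proj hV j vV)) !scalerA exprSr /rho.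
    by congr (_ *: _); ring.
pose B := d%:R * `|P j| * (b * ev f x).
have bnd n : rho ^+ n * `|P j *m v| <= B.
  have [K1 K2 Pn] := vnP n.
  have -> : rho ^+ n * `|P j *m v| = `|P j *m vn n|.
    by rewrite Pn normrZ gtr0_norm// exprn_gt0.
  rewrite (le_trans (mulmx_norm _ _))// ler_wpM2l ?mulr_ge0//.
  exact: (interval_bound hO).
have : `|P j *m v| <= 0.
  have h : B * (rho^-1) ^+ n @[n --> \oo] --> B * 0.
    apply: cvgMl_tmp; apply: cvg_expr.
    by rewrite gtr0_norm ?invr_gt0// invf_lt1.
  rewrite mulr0 in h; apply: (cvgr_to_ge h); apply: nearW => n.
  rewrite exprVn ler_pdivlMr ?exprn_gt0// mulrC; exact: bnd.
by rewrite normr_le0 (negbTE Pv).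
Qed.

(** The eigenspace is spanned by elements of the closed core, and their sum may be
perturbed in every direction of that span without leaving the core. *)
Lemma eigenspace_interior i : exists x, [/\ x \in W i, KC x, 0 < ev f x &
  exists2 e, 0 < e & forall u, u \in W i -> `|u| <= e -> KC (x + u)].
Proof.
have [xs [xs0 xsX WE]] := je_gen hV i.
have cKC := clcore_cone hC; have [KC0 KCD KCZ] := cKC.
have Xk (k : 'I_(size xs)) : KC xs`_k /\ 0 < ev f xs`_k.
  have [Cx [x0 _]] := xsX _ (mem_nth 0 (ltn_ord k)); split => //.
  by apply: (clcone_gt0 hO) => //; exact: core_clcone hC _ _.
pose x := \sum_(k < size xs) xs`_k.
have KCx : KC x by rewrite /x; apply: (clcore_sum hC) => k _; case: (Xk k).
exists x; split => //.
- by rewrite WE; apply: memv_suml => k _; apply/memv_span/mem_nth.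
- have sz : (0 < size xs)%N by rewrite lt0n size_eq0.
  rewrite /x (bigD1 (Ordinal sz))//= evD ltr_wpDr//; last by case: (Xk (Ordinal sz)).
  apply: (clcone_ge0 hO); apply: (core_clcone hC).
  by apply: (clcore_sum hC) => k _; case: (Xk k).
have H k : exists c, 0 <= c /\ forall u, `|coord (in_tuple xs) k u| <= c * `|u|.
  by have [c c0 cP] := linear_form_bounded (coord (in_tuple xs) k); exists c.
have [c cP] := choice H.
pose t := 1 + \sum_k c k.
have t0 : 0 < t by rewrite ltr_wpDr// sumr_ge0// => k _; case: (cP k).
exists t^-1; first by rewrite invr_gt0.
move=> u uW ut; rewrite WE in uW.
rewrite /x (coord_span (X := in_tuple xs) uW) -big_split /=.
apply: (clcore_sum hC) => k _; rewrite -[X in X + _]scale1r -scalerDl.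
apply: KCZ; last by case: (Xk k).
have [ck0 /(_ u) ck] := cP k.
have : `|coord (in_tuple xs) k u| <= 1.
  rewrite (le_trans ck)//; apply: le_trans (_ : t * t^-1 <= _).
    apply: ler_pM => //; rewrite /t (bigD1 k)//= addrCA lerDl addr_ge0//.
    by rewrite sumr_ge0// => k' _; case: (cP k').
  by rewrite mulfV// gt_eqF.
by rewrite ler_norml => /andP[]; lra.
Qed.

(** On a vector whose components all lie in the core, an element of [A] acts by
rescaling the components, so it displaces the vector by an amount depending
only on its characters. *)
Lemma split_recurrence (v : nat -> 'cV[R]_d) :
  (forall k, v k \in V) -> (forall k j, KC (P j *m v k)) -> (forall k, O (v k)) ->
  exists z w, [/\ forall k, Z (z k), O w & z k *m v k @[k --> F] --> w].
Proof.
move=> vV vKC vO; have [S [SA AS]] := finite_span A.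
have cKC := clcore_cone hC; have [KC0 KCD KCZ] := cKC.
pose al s := \sum_j chi j s; pose be s := (1 + \sum_j (chi j s)^-1)^-1.
have sumV s : s \in S -> 0 < 1 + \sum_j (chi j s)^-1.
  move=> sS; rewrite ltr_wpDr// sumr_ge0// => j _.
  by rewrite invr_ge0 ltW// (je_gt0 hV)//; exact: SA.
have KCK := core_clcone hC.
apply: (centralizer_recurrence hO hG disc hC AG SA AS (al := al) (be := be)).
- by move=> s sS; rewrite invr_gt0; exact: sumV.
- move=> k; apply: (core_closed hO hG disc freeF hC) => //.
  rewrite -(je_sum hV (vV k)); apply: (clcore_sum hC) => j _; exact: vKC.
- move=> k s sS; have As := SA _ sS.
  rewrite -[v k](je_sum hV (vV k)) !scaler_sumr mulmx_sumr -!sumrB.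
  have sP j : s *m (P j *m v k) = chi j s *: (P j *m v k).
    exact: (je_scal hV As (je_proj hV j (vV k))).
  split; apply/KCK; apply: (clcore_sum hC) => j _;
    rewrite sP -scalerBl; (apply: KCZ; last exact: vKC); rewrite subr_ge0.
    rewrite /al (bigD1 j)//= lerDl sumr_ge0// => i _.
    by rewrite ltW// (je_gt0 hV).
  have cj := je_gt0 hV j As.
  rewrite /be invf_ple ?posrE ?sumV//.
  rewrite (bigD1 j)//= addrCA lerDl addr_ge0// sumr_ge0// => i _.
  by rewrite invr_ge0 ltW// (je_gt0 hV).
Qed.

(** A sum of eigenrays which reaches the interior. *)
Lemma interior_split_point : exists q,
  [/\ O q, q \in V & forall j, KC (P j *m q)].
Proof.
have [s [sX Os]] := interior_eigensum hO hG disc freeF hC AG AA.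
have cKC := clcore_cone hC; have [KC0 KCD KCZ] := cKC.
exists (\sum_(x <- s) x); split; first exact: Os.
- rewrite big_seq; apply: memv_suml => x /sX[Cx xA].
  by have [j xj] := je_eig hV Cx xA; exact: je_mem xj.
- move=> j; rewrite mulmx_sumr big_seq; apply: (clcore_sum hC) => x /sX[Cx xA].
  have [k xk] := je_eig hV Cx xA; rewrite (je_id hV j xk).
  by case: eqP.
Qed.

(** Approach a relatively interior point [x] of the [i]-th part of the core by
interior points [p k], and let [y k] be the inverses of the recurrence maps of
this sequence.  They converge to an endomorphism [B] which sends an interior
point [w] to [x].  So [B] sends every interior point [u] of [V] into the face of
[x], hence into the [i]-th eigenspace; there [B *m u] is an eigenray, thus a
boundary point, and a limit of the orbit of [u], so it is in the closed core.
Writing [v] as a sum of a multiple of [w] and another interior point, one sees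
that the [i]-th component of [y k *m v] is in the core for a late [k], since it
is close to that of [B *m v] and the core is a neighbourhood of [x] in the
eigenspace.  Apply [z k] to come back to [v]. *)
Lemma interior_components i v : O v -> v \in V -> KC (P i *m v).
Proof.
move=> Ov vV; have [q [Oq qV qKC]] := interior_split_point.
have [x [xW KCx fx [e e0 xe]]] := eigenspace_interior i.
have cKC := clcore_cone hC; have [KC0 KCD KCZ] := cKC.
have KCK := core_clcone hC.
pose p k := x + harmonic k *: q.
have h0 (k : nat) : 0 < harmonic k :> R by rewrite invr_gt0.
have pV k : p k \in V by rewrite memvD ?memvZ// (je_mem xW).
have pO k : O (p k) by apply: (coneDcl hO); [exact: KCK|exact: (coneZ hO)].
have pKC k j : KC (P j *m p k).
  rewrite mulmxDr -scalemxAr; apply: KCD; last first.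
    by apply: KCZ; [exact/ltW/h0|exact: qKC].
  by rewrite (je_id hV j xW); case: eqP.
have [z [w [Zz Ow zw]]] := split_recurrence pV pKC pO.
pose y k := invmx (z k).
have Zy k : Z (y k) by exact: (cgV hZ).
have px : p k @[k --> F] --> x.
  have h : p k @[k --> \oo] --> x.
    rewrite -[X in _ --> X]addr0; apply: cvgD; first exact: cvg_cst.
    by rewrite -(scale0r q); apply: cvgZr_tmp; exact: cvg_harmonic.
  by move=> U /h; exact: freeF.
have yw : y k *m (z k *m p k) @[k --> F] --> x.
  apply: cvg_trans px; apply: near_eq_cvg; apply: nearW => k.
  by rewrite (cg_mulKmx hZ).
have [B yB] : exists B : 'M[R]_d, y k @[k --> F] --> B.
  apply: (cone_maps_cvg hO _ zw Ow (c := ev f x + 1)).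
    by apply: nearW => k u; exact: (cg_clcone hZ).
  exact: (cvg_le_near (cvg_ev f yw)).
have Bw : B *m w = x.
  by apply: (mx_cvg_unique _ yw); exact: cvg_mulmx.
have yuB (u : 'cV[R]_d) : y k *m u @[k --> F] --> B *m u.
  by apply: cvg_mulmx => //; exact: cvg_cst.
have BK u : K u -> K (B *m u).
  move=> Ku; apply: closure_lim (yuB u); apply: nearW => k.
  exact: (cg_clcone hZ).
have BKC u : O u -> u \in V -> KC (B *m u) /\ B *m u \in W i.
  move=> Ou uV.
  have BuV : B *m u \in V.
    by apply: (closed_vspace _ (yuB u)) => k; exact: centralizer_stable.
  have [c c0 Oc] := cone_absorb hO (- w) Ou.
  have [c' c'0 Oc'] := cone_absorb hO (- u) Ow.
  have Kc : K (B *m u - c *: x).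
    by rewrite -Bw scalemxAr -mulmxBr; apply/BK/subset_closure; rewrite -scalerN.
  have Kc' : K (c'^-1 *: x - B *m u).
    rewrite -Bw scalemxAr -mulmxBr; apply/BK/subset_closure.
    have -> : c'^-1 *: w - u = c'^-1 *: (w + c' *: - u).
      by rewrite scalerDr scalerA mulVf ?scale1r// gt_eqF.
    by apply: (coneZ hO) => //; rewrite invr_gt0.
  have BuK : K (B *m u) by apply/BK/subset_closure.
  have BuW : B *m u \in W i.
    by apply: face_in_eigenspace Kc' => //; rewrite memvZ.
  split; last exact: BuW.
  have Bu0 : B *m u != 0.
    apply: contraTneq fx => Bu0; rewrite -leNgt.
    have := clcone_ge0 hO Kc; rewrite Bu0 sub0r evN evZ oppr_ge0.
    by rewrite pmulr_rle0.
  have BuA : eigenray A (B *m u).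
    by split => // a Aa; exists (chi i a); exact: (je_scal hV).
  apply: (limC Ou _ Bu0); last by move=> /noFix.
  apply: cvg_closure (yuB u); apply: nearW => k.
  by exists (y k) => //; case: (Zy k).
have [c c0 Oc] := cone_absorb hO (- w) Ov.
have wV : w \in V.
  by apply: (closed_vspace _ zw) => k; exact: centralizer_stable.
have vwV : v + c *: - w \in V by rewrite memvD// memvZ// memvN.
have [KCc Wc] := BKC _ Oc vwV.
have Pyv : P i *m (y k *m v) @[k --> F] --> P i *m (B *m v).
  exact: (cvg_mulmxr (A := P i) (yuB v)).
have [_ BvW] := BKC v Ov vV.
have [k yk] : exists k, `|P i *m (B *m v) - P i *m (y k *m v)| <= c * e.
  by apply: (filter_ex (F := F)); move/cvgrPdist_le : Pyv; apply; rewrite mulr_gt0.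
have ykV : y k *m v \in V by exact: centralizer_stable.
have KCyk : KC (P i *m (y k *m v)).
  pose u := c^-1 *: (P i *m (y k *m v) - P i *m (B *m v)).
  have -> : P i *m (y k *m v) = c *: (x + u) + B *m (v + c *: - w).
    rewrite scalerDr scalerA mulfV ?gt_eqF// scale1r mulmxDr -scalemxAr mulmxN Bw.
    rewrite (je_id hV i BvW) eqxx scalerN.
    by rewrite [RHS]addrC addrA subrK [RHS]addrC subrK.
  apply: KCD; last exact: KCc.
  apply: KCZ; [exact: ltW|apply: xe].
    by rewrite memvZ// memvB// (je_proj hV)// (je_mem BvW).
  rewrite normrZ gtr0_norm ?invr_gt0// ler_pdivrMl//.
  by rewrite distrC.
have -> : P i *m v = z k *m (P i *m (y k *m v)).
  rewrite !mulmxA (je_comm hV i (Zz k)) -!mulmxA mulKVmx//.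
  exact: (cg_unit hZ).
by apply: (clcore_inv hC) => //; case: (Zz k).
Qed.

Lemma fixed_subspace_core v : O v -> v \in V -> C v.
Proof.
move=> Ov vV; apply: (core_closed hO hG disc freeF hC) => //.
rewrite -(je_sum hV vV); apply: (clcore_sum hC) => j _;
   exact: interior_components.
Qed.

Lemma fixed_subspace_recurrence (v : nat -> 'cV[R]_d) :
  (forall k, v k \in V) -> (forall k, O (v k)) ->
  exists z w, [/\ forall k, Z (z k), O w & z k *m v k @[k --> F] --> w].
Proof.
by move=> vV vO; apply: split_recurrence => // k j; exact: interior_components.
Qed.

Lemma fixed_subspace_meets : exists2 q, O q & q \in V.
Proof. by have [q [Oq qV _]] := interior_split_point; exists q. Qed.

(** With a single eigenspace every interior point of [V] would be an eigenray. *)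
Lemma eigenspaces_ge2 : (2 <= m)%N.
Proof.
have [q Oq qV] := fixed_subspace_meets.
rewrite ltnNge; apply/negP => m1; apply: (noFix Oq); split.
  exact: (cone_neq0 hO).
move=> a Aa; move: (je_sum hV qV).
case: m m1 W P chi hV => [|[|//]] _ W' P' chi' hV'.
  by rewrite big_ord0 => o0; have := cone_neq0 hO Oq; rewrite -o0 eqxx.
rewrite big_ord1 => oE; exists (chi' ord0 a).
by apply: (je_scal hV' Aa); rewrite -oE; exact: (je_proj hV').
Qed.

Lemma eigenspaces_direct : directv (\sum_j W j).
Proof.
apply/directv_sum_independent => u uW u0 i _.
have := congr1 (mulmx (P i)) u0; rewrite mulmx0 mulmx_sumr (bigD1 i)//=.
rewrite (je_id hV i (uW i isT)) eqxx big1 ?addr0// => j ji.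
by rewrite (je_id hV i (uW j isT)) eq_sym (negbTE ji).
Qed.

Lemma eigenspaces_sum : (\sum_j W j)%VS = V.
Proof.
apply/eqP; rewrite eqEsubv; apply/andP; split.
  by apply/subv_sumP => j _; exact: (je_sub hV).
apply/subvP => v vV; rewrite -(je_sum hV vV).
by apply: memv_sumr => j _; exact: (je_proj hV).
Qed.

(** Projections of interior points rather than intersections of the closed cone
with [W j]: being images of an open set, they are relatively open. *)
Definition factor_cone j := [set v | exists w, [/\ O w, w \in V & v = P j *m w]].

End FixedSubspace.

(** * Points of projective space as lines *)

Section ProjectivePoints.
Context (R : realType) (d : nat).
Implicit Types (X : set (proj_space R d)) (v w : 'cV[R]_d).

Definition lines X : set 'cV[R]_d :=
  [set v | exists v0 : v != 0, X (pt_of v0)].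

Lemma pt_ofP v w (v0 : v != 0) (w0 : w != 0) :
  pt_of v0 = pt_of w0 <-> exists2 c, c != 0 & v = c *: w.
Proof. exact: eq_projP. Qed.

Lemma pt_of_pt_vec (x : proj_space R d) : pt_of (pt_vec_neq0 x) = x.
Proof. by rewrite -[RHS]reprK; congr (\pi_ _ _)%qT; exact: val_inj. Qed.

Lemma pt_vec_pt_of v (v0 : v != 0) :
  exists2 c, c != 0 & pt_vec (pt_of v0) = c *: v.
Proof. exact: pt_vec_pi. Qed.

Lemma linesP X v (v0 : v != 0) : lines X v <-> X (pt_of v0).
Proof.
split=> [[v0']|Xv]; last by exists v0.
by rewrite (bool_irrelevance v0 v0').
Qed.

Lemma lines_pt_vec X x : lines X (pt_vec x) <-> X x.
Proof. by rewrite (linesP _ (pt_vec_neq0 x)) pt_of_pt_vec. Qed.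

Lemma linesZ X c v : c != 0 -> lines X (c *: v) <-> lines X v.
Proof.
move=> c0; split=> [[cv0 Xcv]|[v0 Xv]].
  have v0 : v != 0 by apply: contra_neq (cv0) => ->; rewrite scaler0.
  exists v0; have -> // : pt_of v0 = pt_of cv0.
  by apply/pt_ofP; exists c^-1; rewrite ?invr_eq0// scalerA mulVf// scale1r.
have cv0 : c *: v != 0 by rewrite scaler_eq0 negb_or c0.
by exists cv0; have -> : pt_of cv0 = pt_of v0 by apply/pt_ofP; exists c.
Qed.

Lemma linesN X v : lines X (- v) <-> lines X v.
Proof. by rewrite -scaleN1r; apply: linesZ; rewrite oppr_eq0 oner_eq0. Qed.

Lemma lines_neq0 X v : lines X v -> v != 0. Proof. by case. Qed.

Lemma linesS X Y : X `<=` Y -> lines X `<=` lines Y.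
Proof. by move=> XY v [v0 /XY]; exists v0. Qed.

Lemma proj_ofP (V : {vspace 'cV[R]_d}) v : lines (proj_of V) v <-> v != 0 /\ v \in V.
Proof.
split=> [[v0]|[v0 vV]].
  rewrite /proj_of /=; have [c c0 ->] := pt_vec_pt_of v0 => cvV; split => //.
  by rewrite -[v]scale1r -(mulVf c0) -scalerA memvZ.
exists v0; rewrite /proj_of /=; have [c c0 ->] := pt_vec_pt_of v0.
by rewrite memvZ.
Qed.

(** Quotients by scalars are open, which yields enough open sets to describe
neighbourhoods and closures in projective space by vectors. *)
Lemma open_ray_points (U : set 'cV[R]_d) : open U ->
  open [set x : proj_space R d | exists2 c, c != 0 & U (c *: pt_vec x)].
Proof.
move=> oU; rewrite /open /= /quotient_open.
exists (\bigcup_(c in [set c : R | c != 0]) ((fun v : 'cV[R]_d => c *: v) @^-1` U)).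
  apply: bigcup_open => c _.
  have /continuousP : continuous (fun v : 'cV[R]_d => c *: v); last exact.
  exact: scaler_continuous.
rewrite predeqE => u /=; have [c c0 e] := pt_vec_pi u; split.
- move=> [a a0 Ua]; exists (a / c); first by rewrite mulf_neq0// invr_eq0.
  by rewrite e scalerA divfK.
- move=> [a a0]; rewrite e scalerA => Ua; exists (a * c) => //=.
  by rewrite mulf_neq0.
Qed.

Lemma open_lines (U : set (proj_space R d)) v : open U -> lines U v ->
  exists2 e, 0 < e & forall w, `|v - w| < e -> lines U w.
Proof.
move=> oU [v0 Uv].
have [B oB BU] : open ((\pi_(proj_space R d))%qT @^-1` U) by [].
have Bv : B v.
  have : (set_val @^-1` B) (exist _ v (mem_set v0) : nonzero_vec R d) by rewrite BU.
  by [].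
have /nbhs_ballP[e /= e0 eB] := open_nbhs_nbhs (conj oB Bv).
exists (Num.min e `|v|); first by rewrite lt_min e0 normr_gt0.
move=> w; rewrite lt_min => /andP[we wv].
have w0 : w != 0.
  by apply: contraTneq (wv) => ->; rewrite subr0 ltxx.
exists w0.
have Bw : (set_val @^-1` B) (exist _ w (mem_set w0) : nonzero_vec R d).
  by apply: eB; rewrite -ball_normE.
by rewrite BU in Bw.
Qed.

Lemma nbhs_pt_of v (v0 : v != 0) (U : set (proj_space R d)) :
  nbhs (pt_of v0) U <->
  exists2 e, 0 < e & forall w, `|v - w| < e -> lines U w.
Proof.
split.
  rewrite nbhsE => -[U' [oU' U'v] U'U].
  have [e e0 eU] := open_lines oU' (proj2 (linesP _ v0) U'v).
  by exists e => // w /eU; exact: linesS.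
move=> [e e0 eU]; rewrite nbhsE.
exists [set x | exists2 c, c != 0 & ball v e (c *: pt_vec x)].
  split; first by apply: open_ray_points; exact: ball_open.
  have [c c0 ve] := pt_vec_pt_of v0; exists c^-1; first by rewrite invr_eq0.
  by rewrite ve scalerA mulVf// scale1r; exact: ballxx.
move=> x [c c0]; rewrite -ball_normE /= => /eU.
by rewrite linesZ// lines_pt_vec.
Qed.

Lemma closure_linesP X v : v != 0 -> closure (lines X) v <-> lines (closure X) v.
Proof.
move=> v0; rewrite (linesP _ v0); split=> clX U.
  move=> /nbhs_pt_of[e e0 eU].
  have [w [Xw]] := clX _ (nbhsx_ballx v e e0).
  rewrite -ball_normE /= => /eU[w0 Uw]; exists (pt_of w0); split => //.
  exact/linesP.
move=> /nbhs_ballP[e /= e0 eU].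
have oU : open [set x : proj_space R d | exists2 c, c != 0 & ball v e (c *: pt_vec x)].
  by apply: open_ray_points; exact: ball_open.
have Uv : exists2 c, c != 0 & ball v e (c *: pt_vec (pt_of v0)).
  have [c c0 ve] := pt_vec_pt_of v0; exists c^-1; first by rewrite invr_eq0.
  by rewrite ve scalerA mulVf// scale1r; exact: ballxx.
have [x [Xx [c c0 ve]]] := clX _ (open_nbhs_nbhs (conj oU Uv)).
by exists (c *: pt_vec x); split; [apply/linesZ/lines_pt_vec|exact: eU].
Qed.

Lemma pact_pt_of (h : GL R d) v (v0 : v != 0) (hv0 : \val h *m v != 0) :
  pact (\pi_(PGL R d)%qT h) (pt_of v0) = pt_of hv0.
Proof. by rewrite pactE; congr pt_of; exact: bool_irrelevance. Qed.

Lemma lines_preimage (h : GL R d) X v :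
  lines (pact (\pi_(PGL R d)%qT h) @^-1` X) v <-> lines X (\val h *m v).
Proof.
split=> [[v0 Xv]|[hv0 Xhv]].
  by exists (GL_act_neq0 h v0); rewrite -(pact_pt_of v0).
have v0 : v != 0 by apply: contra_neq (hv0) => ->; rewrite mulmx0.
by exists v0; rewrite /= (pact_pt_of v0 hv0).
Qed.

Lemma pact_continuous (g : PGL R d) : continuous (pact g).
Proof.
move: g; apply: PGL_ind => h x; rewrite -(pt_of_pt_vec x) => U.
have v0 := pt_vec_neq0 x; rewrite (bool_irrelevance (pt_vec_neq0 x) v0).
move: (pt_vec x) v0 => v v0.
rewrite (pact_pt_of v0 (GL_act_neq0 h v0)) => /nbhs_pt_of[e e0 eU].
apply/nbhs_pt_of.
have hc : \val h *m w @[w --> v] --> \val h *m v.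
  have idv : (fun w : 'cV[R]_d => w) w @[w --> v] --> v by move=> W.
  exact: (cvg_mulmxr (A := \val h) idv).
have /cvgrPdist_lt/(_ e e0)/nbhs_ballP[e' /= e'0 ee'] := hc.
exists e' => // w vw; apply/lines_preimage/eU; apply: ee'.
by rewrite -ball_normE.
Qed.

Lemma pact1 (x : proj_space R d) : pact (PGL_one R d) x = x.
Proof.
rewrite -{1}(pt_of_pt_vec x) (pact_pt_of _ (GL_act_neq0 _ (pt_vec_neq0 x))).
rewrite -[RHS]pt_of_pt_vec; apply/pt_ofP; exists 1; first exact: oner_neq0.
by rewrite scale1r /= mul1mx.
Qed.

Lemma pactM (g h : PGL R d) (x : proj_space R d) :
  pact (PGL_mul g h) x = pact g (pact h x).
Proof.
move: g; apply: PGL_ind => g; move: h; apply: PGL_ind => h.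
rewrite piPGL_mul -(pt_of_pt_vec x).
have v0 := pt_vec_neq0 x; rewrite (bool_irrelevance (pt_vec_neq0 x) v0).
rewrite (pact_pt_of v0 (GL_act_neq0 h v0)).
rewrite (pact_pt_of _ (GL_act_neq0 g (GL_act_neq0 h v0))).
rewrite (pact_pt_of v0 (GL_act_neq0 _ v0)).
apply/pt_ofP; exists 1; first exact: oner_neq0.
by rewrite scale1r /= mulmxA.
Qed.

End ProjectivePoints.

(** * Cones over sets in an affine chart *)

Lemma convex_setP (R : realType) (E : lmodType R) (A : set E) :
  convex_set A <-> forall u v (s t : R), 0 <= s -> 0 <= t -> s + t = 1 ->
    A u -> A v -> A (s *: u + t *: v).
Proof.
split=> [cA u v s t s0 t0 st Au Av|cA u v l /set_mem Au /set_mem Av].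
  have s1 : s <= 1 by rewrite -st lerDl.
  have := cA u v (Itv01 s0 s1) (mem_set Au) (mem_set Av) => /set_mem.
  rewrite /conv /=; have -> : t = onem s by rewrite /onem -st addrAC subrr add0r.
  exact.
apply: mem_set; apply: (cA u v l%:num (onem l%:num)) => //.
by rewrite onem_ge0.
by rewrite add_onemK.
Qed.

Section ConeOver.
Context (R : realType) (d : nat) (f : 'rV[R]_d).
Implicit Types (X : set (proj_space R d)) (v w : 'cV[R]_d).

(** Of the two cones over a set in an affine chart, the positive one is used
throughout. *)
Definition cone_over X : set 'cV[R]_d := [set v | 0 < ev f v /\ lines X v].

Lemma chart_lines X v : X `<=` affine_chart f -> lines X v -> ev f v != 0.
Proof.
move=> Xf [v0 /Xf]; rewrite /affine_chart /= -/(ev f _).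
by have [c c0 ->] := pt_vec_pt_of v0; rewrite evZ mulf_eq0 negb_or => /andP[].
Qed.

Lemma ev_neq0 v : ev f v != 0 -> v != 0.
Proof. by apply: contra_neq => ->; rewrite ev0. Qed.

Lemma cone_overZ X c v : 0 < c -> cone_over X v -> cone_over X (c *: v).
Proof.
move=> c0 [fv Xv]; split; first by rewrite evZ mulr_gt0.
by apply/linesZ; rewrite ?gt_eqF.
Qed.

Lemma cone_overS X Y : X `<=` Y -> cone_over X `<=` cone_over Y.
Proof. by move=> XY v [fv /(linesS XY)]. Qed.

Lemma lines_cone_over X v : X `<=` affine_chart f -> lines X v ->
  cone_over X v \/ cone_over X (- v).
Proof.
move=> Xf Xv; have := chart_lines Xf Xv.
rewrite neq_lt => /orP[lt0|gt0]; [right|by left].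
by split; [rewrite evN oppr_gt0|apply/linesN].
Qed.

Lemma affine_imageP X w : X `<=` affine_chart f ->
  (affine_coord f @` X) w <-> ev f w = 1 /\ lines X w.
Proof.
move=> Xf; split=> [[x Xx <-]|[fw [w0 Xw]]].
  have fx : ev f (pt_vec x) != 0 by exact: Xf.
  rewrite /affine_coord -/(ev f _) evZ mulVf//; split => //.
  by apply/linesZ; rewrite ?invr_eq0//; apply/lines_pt_vec.
exists (pt_of w0) => //; rewrite /affine_coord -/(ev f _).
have [c c0 ->] := pt_vec_pt_of w0.
by rewrite evZ fw mulr1 scalerA mulVf ?scale1r.
Qed.

Lemma affine_convexP X : X `<=` affine_chart f ->
  convex_set (affine_coord f @` X) <->
  forall u v, cone_over X u -> cone_over X v -> cone_over X (u + v).
Proof.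
move=> Xf; split=> [/convex_setP cX u v [fu Xu] [fv Xv]|cX].
  have fuv : 0 < ev f u + ev f v by rewrite addr_gt0.
  split; first by rewrite evD.
  have fu0 : ev f u != 0 by rewrite gt_eqF.
  have fv0 : ev f v != 0 by rewrite gt_eqF.
  have img w : ev f w != 0 -> lines X w -> (affine_coord f @` X) ((ev f w)^-1 *: w).
    move=> fw Xw; apply/affine_imageP => //; rewrite evZ mulVf//; split => //.
    by apply/linesZ; rewrite ?invr_eq0.
  have /affine_imageP : (affine_coord f @` X)
      ((ev f u / (ev f u + ev f v)) *: ((ev f u)^-1 *: u) +
       (ev f v / (ev f u + ev f v)) *: ((ev f v)^-1 *: v)).
    apply: cX; [by rewrite divr_ge0// ltW|by rewrite divr_ge0// ltW| |exact: img|exact: img].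
    by rewrite -mulrDl mulfV// gt_eqF.
  move=> /(_ Xf)[_]; rewrite !scalerA.
  have fE (x : R) : x != 0 ->
      x / (ev f u + ev f v) * x^-1 = (ev f u + ev f v)^-1.
    by move=> x0; rewrite mulrAC mulfV// mul1r.
  by rewrite !fE// -scalerDr linesZ// invr_eq0 gt_eqF.
apply/convex_setP => u v s t s0 t0 st /affine_imageP[//|fu Xu] /affine_imageP[//|fv Xv].
apply/affine_imageP => //; split; first by rewrite evD !evZ fu fv !mulr1.
have cu : cone_over X u by split => //; rewrite fu.
have cv : cone_over X v by split => //; rewrite fv.
move: s0; rewrite le_eqVlt => /orP[/eqP s0|s0].
  by move: st; rewrite -s0 add0r => ->; rewrite scale0r add0r scale1r.
move: t0; rewrite le_eqVlt => /orP[/eqP t0|t0].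
  by move: st; rewrite -t0 addr0 => ->; rewrite scale0r addr0 scale1r.
by have [] := cX _ _ (cone_overZ s0 cu) (cone_overZ t0 cv).
Qed.

Lemma affine_boundedP X : X `<=` affine_chart f ->
  bounded_set (affine_coord f @` X) <->
  exists2 b, 0 <= b & forall v, cone_over X v -> `|v| <= b * ev f v.
Proof.
move=> Xf; split=> [[M [_ MX]]|[b b0 bX]].
  exists (Num.max 0 (M + 1)); first by rewrite le_max lexx.
  have Mm : M < Num.max 0 (M + 1) by rewrite lt_max ltrDl ltr01 orbT.
  move=> v [fv Xv]; have fv0 : ev f v != 0 by rewrite gt_eqF.
  have iv : (affine_coord f @` X) ((ev f v)^-1 *: v).
    apply/affine_imageP => //; rewrite evZ mulVf//; split => //.
    by apply/linesZ; rewrite ?invr_eq0.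
  have := MX _ Mm _ iv.
  by rewrite /= normrZ gtr0_norm ?invr_gt0// ler_pdivrMl// mulrC.
exists b; split; first exact: num_real.
move=> c bc w /affine_imageP[//|fw Xw]; rewrite /= (le_trans _ (ltW bc))//.
have := bX w; rewrite fw mulr1; apply; split => //.
by rewrite fw.
Qed.

End ConeOver.

(** Fixing one bounded chart [f] turns all statements about the domain into
statements about the sharp cone over it. *)
Record domain_chart (R : realType) (d : nat) (Omega : set (proj_space R d))
    (f : 'rV[R]_d) (b : R) : Prop := DomainChart {
  dc_open : open Omega;
  dc_nonempty : Omega !=set0;
  dc_chart : Omega `<=` affine_chart f;
  dc_convex : convex_set (affine_coord f @` Omega);
  dc_bound0 : 0 <= b;
  dc_bound : forall v, cone_over f Omega v -> `|v| <= b * ev f v }.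

Section Domain.
Context (R : realType) (d : nat) (Omega : set (proj_space R d)).
Context (f : 'rV[R]_d) (b : R) (hD : domain_chart Omega f b).
Local Notation O := (cone_over f Omega).
Local Notation K := (closure O).

Let oOmega := dc_open hD.
Let Omega0 := dc_nonempty hD.
Let Omegaf := dc_chart hD.
Let cOmega := dc_convex hD.
Let b0 := dc_bound0 hD.
Let bOmega := dc_bound hD.

Lemma domain_sharp_cone : sharp_cone f b O.
Proof.
split => //.
- have [x Ox] := Omega0.
  have [] := lines_cone_over Omegaf (proj2 (lines_pt_vec Omega x) Ox).
    by exists (pt_vec x).
  by exists (- pt_vec x).
- rewrite openE => v [fv Ov]; apply/nbhs_ballP.
  have [e e0 eO] := open_lines oOmega Ov.
  have fc : ev f w @[w --> v] --> ev f v.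
    have idv : (fun w : 'cV[R]_d => w) w @[w --> v] --> v by move=> U.
    exact: (cvg_ev f idv).
  have fpos : \forall w \near v, 0 < ev f w by exact: (cvgr_gt _ fc).
  have /nbhs_ballP[e' /= e'0 e'f] := fpos.
  exists (Num.min e e') => /=; first by rewrite lt_min e0.
  move=> w; rewrite -ball_normE /= lt_min => /andP[we we']; split.
    by apply: e'f; rewrite -ball_normE.
  exact: eO.
- exact/affine_convexP.
- by move=> c v; exact: cone_overZ.
- by move=> v [].
Qed.

Let hO := domain_sharp_cone.

Lemma lines_domain_bound v : closure (lines Omega) v -> `|v| <= b * `|ev f v|.
Proof.
move=> /closure_seq[u [Ou uv]].
have fu : ev f (u k) @[k --> \oo] --> ev f v by exact: (cvg_ev f uv).
have h1 : `|u k| @[k --> \oo] --> `|v| by exact: cvg_norm.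
have h2 : b * `|ev f (u k)| @[k --> \oo] --> b * `|ev f v|.
  by apply: cvgMl_tmp; exact: cvg_norm.
apply: (cvg_ler h1 h2); apply: nearW => k.
have [[fk Xk]|[fk Xk]] := lines_cone_over Omegaf (Ou k).
  by rewrite gtr0_norm//; exact: bOmega.
rewrite -normrN (le_trans (bOmega (conj fk Xk)))// ler_wpM2l//.
by rewrite evN -normrN ler_norm.
Qed.

Lemma closure_domain_chart : closure Omega `<=` affine_chart f.
Proof.
move=> x clx; rewrite /affine_chart /= -/(ev f _).
have /closure_linesP := proj2 (lines_pt_vec (closure Omega) x) clx.
move=> /(_ (pt_vec_neq0 x))/lines_domain_bound; apply: contraTneq => ->.
by rewrite normr0 mulr0 -ltNge normr_gt0 pt_vec_neq0.
Qed.

(** A nonzero limit of vectors of the cone stays on the positive side because the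
closed domain avoids the hyperplane at infinity of [f]. *)
Lemma closure_cone_over X v : X `<=` Omega -> v != 0 ->
  closure (cone_over f X) v <-> cone_over f (closure X) v.
Proof.
move=> XO v0; split=> [clv|[fv /(closure_linesP _ v0) clv]].
  split.
    apply: (clcone_gt0 hO) => //; apply: closure_subset clv.
    exact: cone_overS.
  apply/closure_linesP => //; apply: closure_subset clv.
  by move=> w [].
have [u [Xu uv]] := closure_seq clv.
have fu : ev f (u k) @[k --> \oo] --> ev f v by exact: (cvg_ev f uv).
apply: (cvg_closure _ uv); near=> k; split; last exact: Xu.
near: k; exact: (cvgr_gt _ fu).
Unshelve. all: by end_near. Qed.

Lemma clcone_lines v : v != 0 -> K v <-> cone_over f (closure Omega) v.
Proof. exact: closure_cone_over. Qed.

(** Convexity of a subset of the closed domain may be tested in the fixed chart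
[f]: another chart [g] in which the subset is convex has constant sign on the
cone, since a chord joining points of different signs would cross the
hyperplane at infinity of [f]. *)
Lemma proj_convexP X : X `<=` closure Omega -> proj_convex X <->
  forall u v, cone_over f X u -> cone_over f X v -> cone_over f X (u + v).
Proof.
move=> XO; have Xf : X `<=` affine_chart f by exact: subset_trans closure_domain_chart.
split=> [[g _ [Xg /convex_setP cX]]|cX]; last first.
  exists f; last by split => //; exact/affine_convexP.
  have [x0 /Omegaf] := Omega0; apply: contraTneq => ->.
  by rewrite /affine_chart /= mul0mx mxE eqxx.
move=> u v cu cv; have [fu Xu] := cu; have [fv Xv] := cv.
have gu := chart_lines Xg Xu; have gv := chart_lines Xg Xv.
have seg s t : 0 <= s -> 0 <= t -> s + t = 1 ->
    lines X (s *: ((ev g u)^-1 *: u) + t *: ((ev g v)^-1 *: v)).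
  have img w : ev g w != 0 -> lines X w -> (affine_coord g @` X) ((ev g w)^-1 *: w).
    move=> gw Xw; apply/affine_imageP => //; rewrite evZ mulVf//; split => //.
    by apply/linesZ; rewrite ?invr_eq0.
  move=> s0 t0 st; have := cX _ _ s t s0 t0 st (img _ gu Xu) (img _ gv Xv).
  by move=> /affine_imageP[].
have sgn : 0 < ev g u / ev g v.
  rewrite lt_neqAle eq_sym mulf_neq0 ?invr_eq0//= leNgt; apply/negP => neg.
  pose t := ev f v / ev g v; pose s := ev f u / ev g u.
  have st0 : s * t < 0.
    rewrite /s /t mulrACA -invfM pmulr_rlt0 ?mulr_gt0// invr_lt0.
    by rewrite -(pmulr_llt0 _ (_ : 0 < (ev g v)^-1 ^+ 2)) ?exprn_even_gt0 ?invr_eq0//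
      expr2 mulrA mulfK.
  have stn : s != t by apply: contraTneq st0 => ->; rewrite -leNgt -expr2 sqr_ge0.
  have st1 : t / (t - s) + - s / (t - s) = 1.
    by rewrite -mulrDl mulfV// subr_eq0 eq_sym.
  have pos : 0 <= t / (t - s) /\ 0 <= - s / (t - s).
    have [s0|s0|s0] := ltgtP s 0; last by move: st0; rewrite s0 mul0r ltxx.
      have t0 : 0 < t by move: st0; rewrite nmulr_rlt0.
      have ts : 0 < t - s by rewrite subr_gt0 (lt_trans s0).
      by split; apply: divr_ge0; rewrite ?oppr_ge0 ltW.
    have t0 : t < 0 by move: st0; rewrite pmulr_rlt0.
    have ts : (t - s)^-1 < 0 by rewrite invr_lt0 subr_lt0 (lt_trans t0).
    by split; apply: mulr_le0; rewrite ?oppr_le0 ltW.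
  have := seg _ _ pos.1 pos.2 st1 => /(chart_lines Xf).
  rewrite evD !evZ -![(ev g _)^-1 * _]mulrC -/s -/t => /eqP; apply.
  by field; rewrite subr_eq0 eq_sym.
split; first by rewrite evD addr_gt0.
have gg : 0 < 1 + ev g u / ev g v by rewrite addr_gt0.
have gvu : ev g v + ev g u != 0.
  have -> : ev g v + ev g u = ev g v * (1 + ev g u / ev g v) by field.
  by rewrite mulf_neq0// gt_eqF.
have := seg (ev g u / ev g v / (1 + ev g u / ev g v)) (1 + ev g u / ev g v)^-1.
rewrite divr_ge0 ?(ltW sgn) ?(ltW gg)// invr_ge0 (ltW gg) => /(_ isT isT).
rewrite -[X in _ + X = _]mul1r -mulrDl [X in X / _]addrC mulfV ?gt_eqF// => /(_ erefl).
have -> : (ev g u / ev g v / (1 + ev g u / ev g v)) *: ((ev g u)^-1 *: u) +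
   (1 + ev g u / ev g v)^-1 *: ((ev g v)^-1 *: v) =
   ((1 + ev g u / ev g v)^-1 * (ev g v)^-1) *: (u + v).
  rewrite scalerDr !scalerA; congr (_ *: _ + _).
  by field; rewrite gu gv /= andbT.
by rewrite linesZ// mulf_neq0// ?invr_eq0// gt_eqF.
Qed.

End Domain.

(** * Lifts of projective automorphisms *)

Local Open Scope quotient_scope.

Section Lifts.
Context (R : realType) (d : nat) (Omega : set (proj_space R d)).
Context (f : 'rV[R]_d) (b : R) (hD : domain_chart Omega f b).
Local Notation O := (cone_over f Omega).
Let Omegaf := dc_chart hD.
Let hO : sharp_cone f b O := domain_sharp_cone hD.

(** Lifts preserving the cone, and not its opposite, are determined up to positive
scalars; this is what makes lifts of commuting elements commute. *)
Definition lifts (B : set (PGL R d)) : set 'M[R]_d :=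
  [set h | (exists hu : h \in unitmx, B (\pi_(PGL R d) (mkGL hu))) /\
           forall v, O v -> O (h *m v)].

Lemma mkGL_val (h : GL R d) (hu : \val h \in unitmx) : mkGL hu = h.
Proof. exact: val_inj. Qed.

Lemma pi_mkGLZ c (h : 'M[R]_d) (hu : h \in unitmx) (chu : c *: h \in unitmx) :
  c != 0 -> \pi_(PGL R d) (mkGL chu) = \pi_(PGL R d) (mkGL hu).
Proof. by move=> c0; apply/eq_PGLP; exists c. Qed.

Lemma pact_inj (g : PGL R d) : injective (pact g).
Proof.
by apply: (can_inj (g := pact (PGL_inv g))) => x; rewrite -pactM PGL_mulV pact1.
Qed.

Lemma Aut_lines (h : GL R d) v : Aut Omega (\pi_(PGL R d) h) ->
  lines Omega (\val h *m v) <-> lines Omega v.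
Proof.
move=> hAut; rewrite -lines_preimage; split; apply: linesS => x /=.
  by rewrite -{1}hAut => -[y Oy /pact_inj <-].
by move=> Ox; rewrite -hAut; exists x.
Qed.

(** A lift sends the cone off the hyperplane at infinity, so [ev f] cannot change
sign on the convex image. *)
Lemma Aut_sign (h : GL R d) : Aut Omega (\pi_(PGL R d) h) ->
  (forall v, O v -> O (\val h *m v)) \/ (forall v, O v -> O (- (\val h *m v))).
Proof.
move=> hAut; have lin v : O v -> lines Omega (\val h *m v).
  by move=> [_ Ov]; apply/Aut_lines.
have [w Ow] := cone_nonempty hO.
have same u v : O u -> O v -> 0 < ev f (\val h *m u) -> 0 < ev f (\val h *m v).
  move=> Ou Ov fu; rewrite lt_neqAle eq_sym (chart_lines Omegaf (lin _ Ov))/=.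
  rewrite leNgt; apply/negP => fv.
  have Oc : O (- ev f (\val h *m v) *: u + ev f (\val h *m u) *: v).
    by apply: (coneD hO); apply: (coneZ hO); rewrite ?oppr_gt0.
  have /eqP := chart_lines Omegaf (lin _ Oc); apply.
  by rewrite mulmxDr -!scalemxAr evD !evZ; ring.
have [fw|] := ltP 0 (ev f (\val h *m w)).
  by left=> v Ov; split; [exact: same fw|exact: lin].
rewrite le_eqVlt (negbTE (chart_lines Omegaf (lin _ Ow)))/= => fw.
right=> v Ov; split; last by apply/linesN; exact: lin.
rewrite evN oppr_gt0 lt_neqAle (chart_lines Omegaf (lin _ Ov))/= leNgt.
by apply/negP => fv; have := same _ _ Ov Ow fv; rewrite ltNge ltW.
Qed.

Lemma Aut_lift (h : GL R d) : Aut Omega (\pi_(PGL R d) h) ->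
  exists2 c, c != 0 & forall v, O v -> O ((c *: \val h) *m v).
Proof.
move=> /Aut_sign[H|H]; [exists 1; rewrite ?oner_neq0//|exists (-1)].
- by move=> v /H; rewrite scale1r.
- by rewrite oppr_eq0 oner_neq0.
- by move=> v /H; rewrite scaleN1r mulNmx.
Qed.

Lemma unit_scale c (h : GL R d) : c != 0 -> c *: \val h \in unitmx.
Proof. by move=> c0; rewrite unitmxZ ?unitfE// GL_unit. Qed.

Lemma lift_exists (B : set (PGL R d)) g : B `<=` Aut Omega -> B g ->
  exists (h : 'M[R]_d) (hu : h \in unitmx),
    lifts B h /\ \pi_(PGL R d) (mkGL hu) = g.
Proof.
move=> BAut Bg; have [c c0 cO] : exists2 c, c != 0 &
    forall v, O v -> O ((c *: \val (repr g : GL R d)) *m v).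
  by apply: Aut_lift; rewrite reprK; exact: BAut.
have E : \pi_(PGL R d) (mkGL (unit_scale (repr g) c0)) = g.
  rewrite (pi_mkGLZ (GL_unit (repr g)))// mkGL_val; exact: reprK.
exists (c *: \val (repr g : GL R d)), (unit_scale _ c0); split => //; split => //.
by exists (unit_scale (repr g) c0); rewrite E.
Qed.

Lemma lift_of_rep (B : set (PGL R d)) (h : GL R d) : B `<=` Aut Omega ->
  B (\pi_(PGL R d) h) -> exists2 c, c != 0 & lifts B (c *: \val h).
Proof.
move=> BAut Bh; have [c c0 cO] := Aut_lift (BAut _ Bh).
exists c => //; split => //; exists (unit_scale h c0).
by rewrite (pi_mkGLZ (GL_unit h))// mkGL_val.
Qed.

Lemma liftsS B B' : B `<=` B' -> lifts B `<=` lifts B'.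
Proof. by move=> BB' h [[hu /BB' Bh] hO']; split => //; exists hu. Qed.

Lemma lifts_group (B : set (PGL R d)) : is_subgroup B -> B `<=` Aut Omega ->
  cone_group O (lifts B).
Proof.
move=> sB BAut; have [B1 _] := sB.
have BV x : B x -> B (PGL_inv x).
  by move=> Bx; apply: set_mem; apply: (group_closedV sB); exact: mem_set.
have BM x y : B x -> B y -> B (PGL_mul x y).
  move=> Bx By; apply: set_mem.
  by apply: (group_closedM sB); exact: mem_set.
split.
- split; last by move=> v; rewrite mul1mx.
  by exists (unitmx1 R d); exact: set_mem B1.
- move=> g h [[gu Bg] gO] [[hu Bh] hO']; split.
    have ghu : g *m h \in unitmx by rewrite unitmx_mul gu.
    exists ghu; have := BM _ _ Bg Bh; rewrite piPGL_mul.
    by congr (B (\pi _)); exact: val_inj.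
  by move=> v /hO'/gO; rewrite mulmxA.
- move=> g [[gu Bg] gO]; have giu : invmx g \in unitmx by rewrite unitmx_inv.
  have Bgi : B (\pi_(PGL R d) (mkGL giu)).
    have := BV _ Bg; rewrite piPGL_inv.
    by congr (B (\pi _)); exact: val_inj.
  split; first by exists giu.
  have [//|neg] := Aut_sign (BAut _ Bgi) => v Ov; exfalso.
  have := gO _ (neg v Ov); rewrite mulmxN mulKVmx// => ON.
  have := cone_gt0 hO (coneD hO Ov ON).
  by rewrite subrr ev0 ltxx.
- move=> c g c0 [[gu Bg] gO]; have cu : c *: g \in unitmx.
    by rewrite unitmxZ ?unitfE// gt_eqF.
  split; first by exists cu; rewrite (pi_mkGLZ gu)// gt_eqF.
  by move=> v /gO gv; rewrite -scalemxAl; exact: (coneZ hO).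
- by move=> g [[gu _] _].
- by move=> g v [_ gO]; exact: gO.
Qed.

(** Pull back a neighbourhood isolating the neutral element. *)
Lemma lifts_discrete (B : set (PGL R d)) : is_subgroup B -> discrete_set B ->
  proj_discrete (lifts B).
Proof.
move=> [B1 _] dB; have [_ [U nU UB]] := dB _ (set_mem B1).
have [U' [oU' U'1] U'U] : exists2 U', open_nbhs (PGL_one R d) U' & U' `<=` U.
  by move: nU; rewrite nbhsE => -[U' ? ?]; exists U'.
have [W oW WU] : open (\pi_(PGL R d) @^-1` U') by [].
have W1 : W 1%:M.
  have : (set_val @^-1` W) (GL_one R d) by rewrite WU.
  by [].
have /nbhs_ballP[e /= e0 eW] := open_nbhs_nbhs (conj oW W1).
exists e => // h [[hu Bh] _] h1.
have Wh : (set_val @^-1` W) (mkGL hu).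
  by apply: eW; rewrite -ball_normE /= distrC.
rewrite WU in Wh.
have : (U `&` B) (\pi_(PGL R d) (mkGL hu)) by split => //; exact: U'U.
rewrite UB /= => /eq_PGLP[c c0 /= hE]; exists c.
by rewrite hE scalemx1.
Qed.

(** Lifts of commuting projective maps commute up to a scalar [c]; it is positive
since both maps preserve the cone, and [c ^+ d = 1] by taking determinants. *)
Lemma lifts_commute g h (gu : g \in unitmx) (hu : h \in unitmx) :
  (forall v, O v -> O (g *m v)) -> (forall v, O v -> O (h *m v)) ->
  PGL_mul (\pi_(PGL R d) (mkGL gu)) (\pi_(PGL R d) (mkGL hu)) =
    PGL_mul (\pi_(PGL R d) (mkGL hu)) (\pi_(PGL R d) (mkGL gu)) ->
  g *m h = h *m g.
Proof.
move=> gO hO'; rewrite !piPGL_mul => /eq_PGLP[c c0 /= ghE].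
have [w Ow] := cone_nonempty hO.
have cgt0 : 0 < c.
  have := cone_gt0 hO (gO _ (hO' _ Ow)).
  rewrite mulmxA ghE -scalemxAl evZ pmulr_lgt0// -mulmxA.
  exact/(cone_gt0 hO)/hO'/gO.
have : c ^+ d = 1.
  have := congr1 determinant ghE; rewrite detZ !det_mulmx.
  rewrite [X in _ = _ * X]mulrC -[X in X = _]mul1r => /mulIf <-//.
  by rewrite mulf_neq0// -unitfE -unitmxE.
move=> /eqP; rewrite -{1}(expr1n _ d) eqrXn2 ?ltW ?(cone_dim_gt0 hO)// => /eqP c1.
by rewrite ghE c1 scale1r.
Qed.

Lemma lifts_centralizer (B A : set (PGL R d)) : B `<=` Aut Omega -> A `<=` B ->
  centralizing (lifts B) (lifts A) = lifts (centralizer B A).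
Proof.
move=> BAut AB; apply/seteqP; split=> [z [[[zu Bz] zO] zA]|z [[zu [Bz zA]] zO]].
  split => //; exists zu; split => // a Aa.
  have [h [hu [Ah haE]]] := lift_exists (subset_trans AB BAut) Aa.
  rewrite -haE; have E : PGL_mul (\pi_(PGL R d) (mkGL zu)) (\pi_(PGL R d) (mkGL hu)) =
      PGL_mul (\pi_(PGL R d) (mkGL hu)) (\pi_(PGL R d) (mkGL zu)).
    by rewrite !piPGL_mul; congr (\pi _); apply: val_inj; exact: zA.
  exact: E.
split; first by split => //; exists zu.
move=> a [[au Aa] aO]; apply: (lifts_commute zO aO); exact: (zA _ Aa).
Qed.

End Lifts.

(** * The convex core of the limit set *)

Section LimitCore.
Context (R : realType) (d : nat) (Omega : set (proj_space R d)).
Context (f : 'rV[R]_d) (b : R) (hD : domain_chart Omega f b).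
Local Notation O := (cone_over f Omega).
Local Notation K := (closure O).
Let oOmega := dc_open hD.
Let Omegaf := dc_chart hD.
Let hO : sharp_cone f b O := domain_sharp_cone hD.

Lemma clcone_over v : cone_over f (closure Omega) v -> K v.
Proof. by move=> cv; apply/(clcone_lines hD) => //; case: cv => _ /lines_neq0. Qed.

Lemma closure_domain_convex : proj_convex (closure Omega).
Proof.
apply/(proj_convexP hD) => // u v cu cv; apply/(clcone_lines hD).
  by apply: (@ev_neq0 _ _ f); rewrite evD gt_eqF// addr_gt0//; [case: cu|case: cv].
by apply: (clconeD hO); exact: clcone_over.
Qed.

Lemma conv_hullD X u v : X `<=` closure Omega ->
  cone_over f (conv_hull Omega X) u -> cone_over f (conv_hull Omega X) v ->
  cone_over f (conv_hull Omega X) (u + v).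
Proof.
move=> XO [fu Hu] [fv Hv]; have fuv : 0 < ev f (u + v) by rewrite evD addr_gt0.
split => //; have uv0 : u + v != 0 by apply: (@ev_neq0 _ _ f); rewrite gt_eqF.
apply/(linesP _ uv0) => C [[pC CO] XC].
have HC : conv_hull Omega X `<=` C by apply: smallest_sub.
have [_ [uv0' Cuv]] := (proj1 (proj_convexP hD CO) pC) u v
  (conj fu (linesS HC Hu)) (conj fv (linesS HC Hv)).
by rewrite (bool_irrelevance uv0 uv0').
Qed.

Context (Gamma : set (PGL R d)) (sGamma : is_subgroup Gamma).
Context (GammaAut : Gamma `<=` Aut Omega).
Local Notation G := (lifts Omega f Gamma).

Let hG : cone_group O G := lifts_group hD sGamma GammaAut.

Lemma Gamma1 : Gamma (PGL_one R d).
Proof. by have [G1 _] := sGamma; exact: set_mem G1. Qed.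

Lemma GammaM g h : Gamma g -> Gamma h -> Gamma (PGL_mul g h).
Proof.
move=> Gg Gh; apply: set_mem.
by apply: (group_closedM sGamma); exact: mem_set.
Qed.

Lemma GammaV g : Gamma g -> Gamma (PGL_inv g).
Proof. by move=> Gg; apply: set_mem; apply: (group_closedV sGamma); exact: mem_set. Qed.

Lemma closure_lines_inv h v : G h -> lines (closure Omega) v ->
  lines (closure Omega) (h *m v).
Proof.
move=> Gh Ov.
have pos u : cone_over f (closure Omega) u -> lines (closure Omega) (h *m u).
  move=> cu; have Ku : K (h *m u) by apply: (cg_clcone hG) => //; exact: clcone_over.
  have u0 : u != 0 by case: cu => _ /lines_neq0.
  have hu0 : h *m u != 0.
    by apply: contra_neq u0 => hu; rewrite -(cg_mulKmx hG u Gh) hu mulmx0.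
  by have /(clcone_lines hD hu0)[] := Ku.
have [/pos//|/pos] := lines_cone_over (closure_domain_chart hD) Ov.
by rewrite mulmxN => /linesN.
Qed.

Lemma closure_inv g x : Gamma g -> closure Omega x -> closure Omega (pact g x).
Proof.
move=> Gg clx; have [h [hu [Gh gE]]] := lift_exists hD GammaAut Gg.
have := closure_lines_inv Gh (proj2 (lines_pt_vec _ x) clx).
rewrite -[X in lines _ (X *m _)]/(\val (mkGL hu)) -lines_preimage gE.
by rewrite lines_pt_vec.
Qed.

(** The preimage of a convex set of the closed domain by an automorphism is again
one, so it may be used in the definition of the hull. *)
Lemma conv_hull_inv X g x : X `<=` closure Omega -> Gamma g ->
  (forall y, X y -> X (pact g y)) ->
  conv_hull Omega X x -> conv_hull Omega X (pact g x).
Proof.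
move=> XO Gg Xg Hx C [[pC CO] XC].
have [h [hu [Gh gE]]] := lift_exists hD GammaAut Gg.
have linE v : lines (pact g @^-1` C) v <-> lines C (h *m v).
  by rewrite -gE lines_preimage.
have C'O : pact g @^-1` C `<=` closure Omega.
  move=> y /CO cly; rewrite -(pact1 y) -(PGL_mulV g) pactM.
  exact/closure_inv/cly/GammaV.
apply: (Hx (pact g @^-1` C)); split; last by move=> y /Xg/XC.
split => //; apply/(proj_convexP hD) => // u v [fu /linE Cu] [fv /linE Cv].
split; first by rewrite evD addr_gt0.
have fh w : 0 < ev f w -> lines C (h *m w) -> 0 < ev f (h *m w).
  move=> fw /[dup] Cw /lines_neq0 hw0; apply: (clcone_gt0 hO) => //.
  apply: (cg_clcone hG Gh); apply: clcone_over; split => //.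
  by apply: (linesS C'O); apply/linE.
apply/linE; rewrite mulmxDr.
by have [] := proj1 (proj_convexP hD CO) pC _ _ (conj (fh _ fu Cu) Cu) (conj (fh _ fv Cv) Cv).
Qed.

Local Notation L := (limit_set Omega Gamma).

Lemma limit_set_sub : L `<=` closure Omega.
Proof. by move=> x [[]]. Qed.

Lemma Aut_inv g x : Gamma g -> Omega (pact g x) -> Omega x.
Proof.
by move=> /GammaAut gO; rewrite -[X in X (pact g x)]gO => -[y Oy /pact_inj <-].
Qed.

Lemma Aut_act g x : Gamma g -> Omega x -> Omega (pact g x).
Proof. by move=> /GammaAut gO Ox; rewrite -gO; exists x. Qed.

Lemma limit_set_inv g x : Gamma g -> L x -> L (pact g x).
Proof.
move=> Gg [[clx nOx] [p [gn [Op Ggn gx]]]]; split.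
  split; first exact: closure_inv.
  by rewrite (proj1 (interior_id _) oOmega) in nOx *; move=> /(Aut_inv Gg).
exists p, (fun n => PGL_mul g (gn n)); split => //.
  by move=> n; exact: GammaM.
under eq_cvg do rewrite pactM.
exact: (cvg_comp _ _ gx (@pact_continuous _ _ g x)).
Qed.

Local Notation core := (limit_core Omega Gamma).
Local Notation C := (cone_over f core).

Lemma limit_core_inv g x : Gamma g -> core x -> core (pact g x).
Proof.
move=> Gg [Hx Ox]; split; last exact: Aut_act.
apply: conv_hull_inv => //; first exact: limit_set_sub.
by move=> y; exact: limit_set_inv.
Qed.

Lemma core_coneD u v : C u -> C v -> C (u + v).
Proof.
move=> [fu Cu] [fv Cv].
have [_ Huv] : cone_over f (conv_hull Omega L) (u + v).
  apply: conv_hullD; first exact: limit_set_sub.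
    by split => //; apply: linesS Cu => x [].
  by split => //; apply: linesS Cv => x [].
have [fuv Ouv] : O (u + v).
  by apply: (coneD hO); split => //; [apply: linesS Cu|apply: linesS Cv] => x [].
by split => //; have [uv0 Huv'] := Huv; exists uv0; split => //; apply/linesP.
Qed.

Lemma lines_inv h v (X : set (proj_space R d)) :
  (forall g x, Gamma g -> X x -> X (pact g x)) -> G h -> lines X v ->
  lines X (h *m v).
Proof.
move=> Xinv [[hu Gh] _] Xv; rewrite -[h]/(\val (mkGL hu)) -lines_preimage.
by apply: linesS Xv => x /(Xinv _ _ Gh).
Qed.

Lemma core_cone_inv h v : G h -> C v -> C (h *m v).
Proof.
move=> Gh [fv Cv]; split.
  by have [] : O (h *m v); [apply: (cg_cone hG Gh); split => //; apply: linesS Cv => x []|].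
by apply: lines_inv Cv => // g x; exact: limit_core_inv.
Qed.

(** A segment of the convex hull joins a boundary limit point of an orbit to a
point of the core, so that the limit point is a limit of points of the core. *)
Lemma orbit_limit_core p y : core !=set0 -> O p ->
  closure [set h *m p | h in G] y -> y != 0 -> ~ O y -> closure C y.
Proof.
move=> [x0 Cx0] Op /closure_seq[u [uG uy]] y0 nOy.
have Ky : K y.
  by apply: (cvg_closure _ uy); apply: nearW => k; have [h Gh <-] := uG k;
    exact: (cg_cone hG).
have [fy cly] := proj1 (clcone_lines hD y0) Ky.
have Ly : L (pt_of y0).
  split.
    split; first exact/linesP.
    rewrite (proj1 (interior_id _) oOmega) => Oy; apply: nOy; split => //.
    exact/linesP.
  have H k : exists g : PGL R d, Gamma g /\
      forall p0 : p != 0, forall U : set (proj_space R d), lines U (u k) ->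
        U (pact g (pt_of p0)).
    have [h [[hu Bh] _] <-] := uG k; exists (\pi_(PGL R d) (mkGL hu)); split => // p0 U.
    move=> [hp0 Uhp].
    by rewrite (pact_pt_of (h := mkGL hu) p0 hp0).
  have [g gP] := choice H.
  have p0 : p != 0 := cone_neq0 hO Op.
  exists (pt_of p0), g; split => //.
  - by have [_ /(linesP _ p0)] := Op.
  - by move=> k; case: (gP k).
  - move=> U /nbhs_pt_of[e e0 eU].
    have /cvgrPdist_lt/(_ e e0) := uy; apply: filterS => k uk.
    by have [_] := gP k; apply; exact: eU.
have [c Cc] : exists c, C c.
  have Coref : core `<=` affine_chart f by move=> x [_ /Omegaf].
  have [h|h] := lines_cone_over Coref (proj2 (lines_pt_vec _ x0) Cx0).
    by exists (pt_vec x0).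
  by exists (- pt_vec x0).
have ycy : y + harmonic k *: c @[k --> \oo] --> y.
  rewrite -[X in _ --> X]addr0; apply: cvgD; first exact: cvg_cst.
  by rewrite -(scale0r c); apply: cvgZr_tmp; exact: cvg_harmonic.
apply: (cvg_closure _ ycy); apply: nearW => k.
have h0 : 0 < harmonic k :> R by rewrite invr_gt0.
have Ckc : C (harmonic k *: c) by exact: cone_overZ.
have [fkc Ckc'] := Ckc.
have Okc : O (harmonic k *: c) by split => //; apply: linesS Ckc' => x [].
have [fO Oyc] : O (y + harmonic k *: c) by exact: (coneDcl hO).
split => //.
have [_ [yc0 Hyc]] : cone_over f (conv_hull Omega L) (y + harmonic k *: c).
  apply: conv_hullD; first exact: limit_set_sub.
    split => //; exists y0; exact: (sub_gen_smallest Ly).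
  by split => //; apply: linesS Ckc' => x [].
by exists yc0; split => //; apply/linesP.
Qed.

End LimitCore.

(** * Cocompactness and proper discontinuity *)

Section Cocompactness.
Context (R : realType) (d : nat) (Omega : set (proj_space R d)).
Context (f : 'rV[R]_d) (b : R) (hD : domain_chart Omega f b).
Local Notation O := (cone_over f Omega).
Let hO : sharp_cone f b O := domain_sharp_cone hD.
Context (Gamma : set (PGL R d)) (sGamma : is_subgroup Gamma).
Context (GammaAut : Gamma `<=` Aut Omega).
Local Notation G := (lifts Omega f Gamma).
Let hG : cone_group O G := lifts_group hD sGamma GammaAut.

Lemma lines_cone_sign X v : X `<=` affine_chart f -> lines X v ->
  exists2 c, c != 0 & cone_over f X (c *: v).
Proof.
move=> Xf /(lines_cone_over Xf)[h|h].
  by exists 1; rewrite ?oner_neq0 ?scale1r.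
by exists (-1); rewrite ?oppr_eq0 ?oner_neq0 ?scaleN1r.
Qed.

Lemma orbit_same (x y : proj_space R d) : orbit Gamma x = orbit Gamma y ->
  exists2 g, Gamma g & x = pact g y.
Proof.
move=> e; have : orbit Gamma x x by exists (PGL_one R d); [exact: Gamma1|exact: pact1].
by rewrite e => -[h Gh <-]; exists h.
Qed.

(** The classes of the [v k] have a cluster point in the compact orbit space.  The
preimage of a small ball around a representative [w], saturated by the group,
is a neighbourhood of that class, and a cluster point along an ultrafilter is a
limit. *)
Lemma cocompact_orbits (X : set (proj_space R d)) (F : set_system nat)
    {FU : UltraFilter F} (v : nat -> 'cV[R]_d) :
  compact_quotient Gamma X -> X `<=` Omega ->
  (forall k, cone_over f X (v k)) ->
  exists2 w, cone_over f X w & forall e, 0 < e ->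
    \forall k \near F, exists2 h, G h & `|w - h *m v k| < e.
Proof.
move=> cX XO Xv; have Xf : X `<=` affine_chart f by move=> x /XO/(dc_chart hD).
have v0 k : v k != 0 by have [_ /lines_neq0] := Xv k.
have Xpt k : X (pt_of (v0 k)) by have [_ /(linesP _ (v0 k))] := Xv k.
pose x k : X := exist _ (pt_of (v0 k)) (mem_set (Xpt k)).
pose y k : orbit_space Gamma X := \pi_(orbit_space Gamma X) (x k).
have [|y0 [_ cly]] := cX (fmap y F) _ ; first exact: filterT.
pose x0 : X := repr y0.
have [c c0 cw] := lines_cone_sign Xf (proj2 (lines_pt_vec X _) (set_mem (valP x0))).
exists (c *: pt_vec (val x0)) => //; set w := c *: _ in cw *.
move=> e e0.
pose U : set 'cV[R]_d := [set u | `|w - u| < e /\ 0 < ev f u].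
have oU : open U.
  rewrite openE => u [uw fu].
  have idu : (fun u : 'cV[R]_d => u) u' @[u' --> u] --> u by move=> B.
  have n1 : \forall u' \near u, `|w - u'| < e.
    have : nbhs u (ball w e).
      apply: open_nbhs_nbhs; split; first exact: ball_open.
      by rewrite -ball_normE.
    by apply: filterS => u'; rewrite -ball_normE.
  have n2 : \forall u' \near u, 0 < ev f u'.
    exact: (cvgr_gt _ (cvg_ev f idu)).
  by apply: filterS2 n1 n2.
pose U' : set (proj_space R d) := [set p | exists2 a, a != 0 & U (a *: pt_vec p)].
have oU' : open U' by exact: open_ray_points.
pose S : set (proj_space R d) := \bigcup_(g in Gamma) (pact g @^-1` U').
have oS : open S.
  apply: bigcup_open => g _.
  by have /continuousP := @pact_continuous R d g; exact.
pose T : set (orbit_space Gamma X) := [set z | S (val (repr z : X))].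
have SE (p q : X) : orbit Gamma (val p) = orbit Gamma (val q) ->
    S (val p) -> S (val q).
  move=> pq [g Gg Ug]; have [h Gh pE] := orbit_same pq.
  by exists (PGL_mul g h); [exact: GammaM|rewrite /= pactM -pE].
have reprE (p : X) : orbit Gamma (val (repr (\pi_(orbit_space Gamma X) p) : X))
    = orbit Gamma (val p).
  by have /eqmodP/asboolP := reprK (\pi_(orbit_space Gamma X) p).
have oT : open T.
  exists S => //; rewrite predeqE => p; split => /= Sp.
    by apply: SE Sp; rewrite reprE.
  by apply: SE Sp; rewrite reprE.
have Ty0 : T y0.
  exists (PGL_one R d); first exact: Gamma1.
  rewrite /= pact1; exists c => //.
  by split; [rewrite subrr normr0|case: cw].
have [FT|FnT] := in_ultra_setVsetC (y @^-1` T) FU; last first.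
  by have [z [nT]] := cly (~` T) T FnT (open_nbhs_nbhs (conj oT Ty0)).
apply: filterS FT => k Tk.
have [g Gg [a a0 [wa fa]]] : S (val (x k)) by apply: SE Tk; rewrite reprE.
have [h [hu [Gh gE]]] := lift_exists hD GammaAut Gg.
have hv0 : h *m v k != 0 by exact: (GL_act_neq0 (mkGL hu) (v0 k)).
have [a' a'0 E] := pt_vec_pt_of hv0.
rewrite /= -gE (pact_pt_of (h := mkGL hu) (v0 k) hv0) E scalerA in wa fa.
have fhv : 0 < ev f (h *m v k).
  by apply/(cone_gt0 hO)/(cg_cone hG Gh); have := Xv k; exact: cone_overS.
rewrite evZ pmulr_lgt0// in fa.
by exists ((a * a') *: h); [exact: (cgZ hG)|rewrite -scalemxAl].
Qed.

(** Choosing almost closest orbit representatives turns cluster points of the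
orbit space into limits of representatives. *)
Lemma limit_core_cocompact (F : set_system nat) {FU : UltraFilter F} :
  eventually `<=` F -> limit_core Omega Gamma !=set0 ->
  compact_quotient Gamma (limit_core Omega Gamma) ->
  cocompact_core O G F (cone_over f (limit_core Omega Gamma)).
Proof.
move=> freeF [x0 Cx0] cC; have CO : limit_core Omega Gamma `<=` Omega by move=> x [].
split.
- exact: cone_overS.
- have [||c c0 Cc] := @lines_cone_sign (limit_core Omega Gamma) (pt_vec x0).
  + by move=> x /CO/(dc_chart hD).
  + exact/lines_pt_vec.
  + by exists (c *: pt_vec x0).
- by move=> u v; exact: (core_coneD hD).
- by move=> c v; exact: cone_overZ.
- by move=> g v; exact: (core_cone_inv hD sGamma GammaAut).
- move=> v Cv; have [w Cw near_w] := cocompact_orbits cC CO Cv.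
  have H k : exists h, G h /\ forall h', G h' ->
      `|w - h *m v k| <= `|w - h' *m v k| + k.+1%:R^-1.
    have [||s [u [us Gu us']]] := @real_sup_seq R _ G (fun h => - `|w - h *m v k|) 0.
    - by exists 1%:M; exact: (cg1 hG).
    - by move=> h _; rewrite oppr_le0.
    have : \forall n \near \oo, s - k.+1%:R^-1 <= - `|w - u n *m v k|.
      by apply: (cvgr_ge _ us'); rewrite ltrBlDr ltrDl invr_gt0.
    move=> /filter_ex[n un]; exists (u n); split => // h' /us /= h's.
    rewrite -lerBlDr; move: un h's; move: (k.+1%:R^-1) => t un h's; lra.
  have [g gP] := choice H; exists g, w; split => //.
    by move=> k; case: (gP k).
  apply/cvgrPdist_le => e e0; have e20 : 0 < e / 2 by rewrite divr_gt0.
  have n1 : \forall k \near F, harmonic k <= e / 2 :> R.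
    apply: freeF; apply: (cvgr_le _ (@cvg_harmonic R)) => //.
  apply: filterS2 (near_w _ e20) n1 => k [h Gh wh] ke.
  have [_ /(_ h Gh) le1] := gP k.
  rewrite (le_trans le1)// [leRHS](splitr e) lerD//.
  exact: ltW.
Qed.

(** An infinite group cannot fix a point of the domain, by proper
discontinuity. *)
Lemma no_fixed_point (A : set (PGL R d)) v : A `<=` Gamma -> discrete_set Gamma ->
  infinite_set A -> O v -> ~ eigenray (lifts Omega f A) v.
Proof.
move=> AG dG infA Ov [v0 vA].
have [F [FU freeF]] := free_ultrafilter.
have [a [ainj Aa]] : exists a : nat -> PGL R d, injective a /\ forall k, A (a k).
  have /infiniteP/card_leP[q] := infA.
  have kT (k : nat) : k \in [set: nat] by exact: mem_set.
  exists (fun k => val (q (exist _ k (kT k)))); split.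
    move=> k l /val_inj e.
    by have [] := 'inj_q (mem_set I) (mem_set I) e.
  by move=> k; exact: (set_mem (valP (q _))).
have H k : exists h, lifts Omega f A h /\ exists hu : h \in unitmx,
    \pi_(PGL R d) (mkGL hu) = a k /\ h *m v = v.
  have [h [hu [[Bh hO'] hE]]] := lift_exists hD (subset_trans AG GammaAut) (Aa k).
  have [c hv] := vA h (conj Bh hO').
  have c0 : 0 < c.
    have := cone_gt0 hO (hO' _ Ov); rewrite hv evZ pmulr_lgt0//.
    exact: (cone_gt0 hO).
  have cu : c^-1 *: h \in unitmx by rewrite unitmxZ ?unitfE ?invr_eq0// gt_eqF.
  have cE : \pi_(PGL R d) (mkGL cu) = a k.
    by rewrite (pi_mkGLZ hu)// invr_eq0 gt_eqF.
  exists (c^-1 *: h); split; last first.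
    by exists cu; rewrite -scalemxAl hv scalerA mulVf ?scale1r// gt_eqF.
  split; first by exists cu; rewrite cE; exact: Aa.
  move=> u Ou; rewrite -scalemxAl; apply: (coneZ hO); last exact: hO'.
  by rewrite invr_gt0.
have [h hP] := choice H.
have vF : (fun _ : nat => v) k @[k --> F] --> v by exact: cvg_cst.
have hvF : h k *m (fun _ : nat => v) k @[k --> F] --> v.
  by apply: cvg_near_cst; apply: nearW => k; have [_ [hu []]] := hP k.
have Gh : \forall k \near F, G (h k).
  by apply: nearW => k; have [Ah _] := hP k; exact: liftsS AG _ Ah.
have [h0 [_ _ _ hh0]] := cone_group_proper hO hG (lifts_discrete Omega f sGamma dG) Gh vF Ov hvF Ov.
have [k [c c0 hk]] := filter_ex hh0.
have gtk : \forall l \near F, (k < l)%N by apply: freeF; exact: nbhs_infty_gt.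
have [l [[c' c'0 hl] kl]] := filter_ex (filterI hh0 gtk).
have [_ [hku [hkE _]]] := hP k; have [_ [hlu [hlE _]]] := hP l.
suff /ainj kl' : a k = a l by move: kl; rewrite kl' ltnn.
rewrite -hkE -hlE; apply/eq_PGLP; exists (c / c').
  by rewrite mulf_neq0 ?invr_eq0 ?gt_eqF.
by rewrite /= hk hl scalerA divfK// gt_eqF.
Qed.

End Cocompactness.

(** * The domain spanned by the fixed points *)

Section ProjectiveSubspace.
Context (R : realType) (d : nat) (V : {vspace 'cV[R]_d}).
Implicit Types (X : set (proj_space R d)) (v w : 'cV[R]_d).

Lemma nbhs_proj_subspace X v (v0 : v != 0) : v \in V ->
  nbhs (pt_of v0 : subspace (proj_of V)) X <->
  exists2 e, 0 < e & forall w, w \in V -> `|v - w| < e -> lines X w.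
Proof.
move=> vV; have Vv : proj_of V (pt_of v0) by apply/linesP/proj_ofP.
case: (@nbhs_subspaceP _ (proj_of V) (pt_of v0)) => // _.
apply: (iff_trans (nbhs_pt_of v0 [set x | proj_of V x -> X x])); split.
  move=> [e e0 eX]; exists e => // w wV /eX[w0 Xw]; exists w0; apply: Xw.
  by apply/linesP/proj_ofP.
move=> [e e0 eX]; exists (Num.min e `|v|); first by rewrite lt_min e0 normr_gt0.
move=> w; rewrite lt_min => /andP[we wv].
have w0 : w != 0 by apply: contraTneq wv => ->; rewrite subr0 ltxx.
exists w0 => /(linesP _ w0)/proj_ofP[_ wV]; apply/linesP.
exact: eX.
Qed.

Lemma open_proj_subspace X : X `<=` proj_of V ->
  (forall v, lines X v -> exists2 e, 0 < e &
    forall w, w \in V -> `|v - w| < e -> lines X w) ->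
  open (X : set (subspace (proj_of V))).
Proof.
move=> XV XP; rewrite openE => x Xx; rewrite /interior.
have v0 := pt_vec_neq0 x.
have /proj_ofP[_ xV] : lines (proj_of V) (pt_vec x) by apply/lines_pt_vec/XV.
rewrite -(pt_of_pt_vec x); apply/nbhs_proj_subspace => //.
by apply: XP; apply/lines_pt_vec.
Qed.

End ProjectiveSubspace.

Lemma Span_unique (R : realType) (d : nat) (X : set (proj_space R d)) V :
  is_span X V -> Span X = V.
Proof.
move=> [XV Vmin]; have [XS Smin] := SpanP X.
by apply/eqP; rewrite eqEsubv Vmin// Smin.
Qed.

Section FixedDomain.
Context (R : realType) (d : nat) (Omega : set (proj_space R d)).
Context (f : 'rV[R]_d) (b : R) (hD : domain_chart Omega f b).
Local Notation O := (cone_over f Omega).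
Local Notation K := (closure O).
Let hO : sharp_cone f b O := domain_sharp_cone hD.
Context (Gamma A : set (PGL R d)) (sGamma : is_subgroup Gamma).
Context (GammaAut : Gamma `<=` Aut Omega) (dGamma : discrete_set Gamma).
Local Notation core := (limit_core Omega Gamma).
Local Notation C := (cone_over f core).
Context (core0 : core !=set0) (ccore : compact_quotient Gamma core).
Context (sA : is_subgroup A) (AGamma : A `<=` Gamma).
Context (infA : infinite_set A) (abA : abelian_set A).
Context (F : set_system nat) {FU : UltraFilter F} (freeF : eventually `<=` F).
Local Notation G := (lifts Omega f Gamma).
Local Notation LA := (lifts Omega f A).
Local Notation ZGA := (centralizer Gamma A).
Local Notation Z := (centralizing G LA).

Let AAut : A `<=` Aut Omega := subset_trans AGamma GammaAut.
Let hG : cone_group O G := lifts_group hD sGamma GammaAut.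
Let hLA : cone_group O LA := lifts_group hD sA AAut.
Let disc : proj_discrete G := lifts_discrete Omega f sGamma dGamma.
Let hC : cocompact_core O G F C :=
  limit_core_cocompact hD sGamma GammaAut freeF core0 ccore.
Let LAG : LA `<=` G := liftsS AGamma.
Let ZE : Z = lifts Omega f ZGA := lifts_centralizer hD GammaAut AGamma.

Lemma lifts_abelian a a' : LA a -> LA a' -> a *m a' = a' *m a.
Proof.
move=> [[au Aa] aO] [[au' Aa'] aO']; apply: (lifts_commute hD aO aO').
exact: (abA Aa Aa').
Qed.

Let noFix v : O v -> ~ eigenray LA v :=
  @no_fixed_point _ _ _ _ _ hD _ sGamma GammaAut _ v AGamma dGamma infA.

Let limC p y : O p -> closure [set g *m p | g in G] y -> y != 0 -> ~ O y ->
    closure C y :=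
  @orbit_limit_core _ _ _ _ _ hD _ sGamma GammaAut p y core0.

Local Notation fixed := (fixed_points A (closure core)).
Local Notation V := (Span fixed).

Lemma core_domain : core `<=` Omega. Proof. by move=> x []. Qed.

Lemma fixed_chart : fixed `<=` affine_chart f.
Proof.
move=> x [clx _]; apply: (closure_domain_chart hD).
by apply: closure_subset clx; exact: core_domain.
Qed.

Lemma fixed_pointsP v : cone_over f fixed v <-> closure C v /\ eigenray LA v.
Proof.
split=> [[fv [v0 [clv vA]]]|[clv [v0 vA]]].
  split.
    apply/(closure_cone_over hD core_domain v0); split => //.
    by exists v0.
  split => // a [[au Aa] _]; have := vA _ Aa.
  rewrite (pact_pt_of (h := mkGL au) v0 (GL_act_neq0 _ v0)) => /pt_ofP[c c0 e].
  by exists c.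
have [fv [v0' clv']] := proj1 (closure_cone_over hD core_domain v0) clv.
split => //; exists v0'; split => // g Ag.
have [a [au [La aE]]] := lift_exists hD AAut Ag.
have [c ac] := vA a La.
rewrite -aE (pact_pt_of (h := mkGL au) v0' (GL_act_neq0 _ v0')).
apply/pt_ofP; exists c => //; apply: contra_neq v0 => c0.
by rewrite -(cg_mulKmx hLA v La) ac c0 scale0r mulmx0.
Qed.

Lemma eigenray_Span v : closure C v -> eigenray LA v -> v \in V.
Proof.
move=> clv vA; have [_ vfix] := proj2 (fixed_pointsP v) (conj clv vA).
by have /proj_ofP[] := linesS (proj1 (SpanP fixed)) vfix.
Qed.

Lemma Span_eigenrays (W : {vspace 'cV[R]_d}) :
  (forall v, closure C v -> eigenray LA v -> v \in W) -> (V <= W)%VS.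
Proof.
move=> vW; apply: (proj2 (SpanP fixed)) => x fixx.
have [c c0 cx] := lines_cone_sign fixed_chart (proj2 (lines_pt_vec _ x) fixx).
have [clx xA] := proj1 (fixed_pointsP _) cx.
have cW := vW _ clx xA.
by rewrite /proj_of /= -[pt_vec x]scale1r -(mulVf c0) -scalerA memvZ.
Qed.

Local Notation OmegaV := (Omega `&` proj_of V).

Lemma domain_subspaceP v : cone_over f OmegaV v <-> O v /\ v \in V.
Proof.
split=> [[fv [v0 [Ov Vv]]]|[[fv [v0 Ov]] vV]].
  split; first by split => //; exists v0.
  by have /proj_ofP[] : lines (proj_of V) v by exists v0.
split => //; exists v0; split => //.
by apply/linesP/proj_ofP.
Qed.

Lemma domain_subspace_chart : OmegaV `<=` affine_chart f.
Proof. by move=> x [/(dc_chart hD)]. Qed.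

Lemma domain_subspace_vec x : OmegaV x ->
  exists2 c, c != 0 & O (c *: pt_vec x) /\ c *: pt_vec x \in V.
Proof.
move=> Ox; have [c c0 cx] := lines_cone_sign domain_subspace_chart
  (proj2 (lines_pt_vec _ x) Ox).
by exists c => //; apply/domain_subspaceP.
Qed.

Lemma domain_subspace_properly_convex : properly_convex_domain_in V OmegaV.
Proof.
split; first by move=> x [].
- apply: open_proj_subspace; first by move=> x [].
  move=> v [v0 [Ov Vv]].
  have [e e0 eO] := open_lines (dc_open hD) (proj2 (linesP _ v0) Ov).
  exists e => // w wV /eO[w0 Ow]; exists w0; split => //.
  by apply/linesP/proj_ofP.
- exists f; last split.
  + have [x /(dc_chart hD)] := dc_nonempty hD; apply: contraTneq => ->.
    by rewrite /affine_chart /= mul0mx mxE eqxx.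
  + exact: domain_subspace_chart.
  + apply/affine_convexP; first exact: domain_subspace_chart.
    move=> u v /domain_subspaceP[Ou uV] /domain_subspaceP[Ov vV].
    by apply/domain_subspaceP; split; [exact: (coneD hO)|exact: memvD].
  + apply/affine_boundedP; first exact: domain_subspace_chart.
    exists b; first exact: (dc_bound0 hD).
    by move=> v /domain_subspaceP[/(dc_bound hD)].
Qed.

Context (m : nat) (W : 'I_m -> {vspace 'cV[R]_d}) (P : 'I_m -> 'M[R]_d).
Context (chi : 'I_m -> 'M[R]_d -> R).
Context (hV : joint_eigenspaces LA Z (closure C) V W P chi).

Lemma domain_subspace_nonempty : OmegaV !=set0.
Proof.
have [w Ow wV] := fixed_subspace_meets hO hG disc freeF hC LAG lifts_abelian hV.
have [_ [w0 Ow0]] := proj2 (domain_subspaceP w) (conj Ow wV).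
by exists (pt_of w0).
Qed.

Lemma centralizer_act g x : ZGA g -> OmegaV x -> OmegaV (pact g x).
Proof.
move=> Zg /domain_subspace_vec[c c0 [Ox xV]].
have ZAut : ZGA `<=` Aut Omega by move=> h [/GammaAut].
have [z [zu [Lz zE]]] := lift_exists hD ZAut Zg.
have Zz : Z z by rewrite ZE.
have [_ Ozx] : cone_over f OmegaV (z *m (c *: pt_vec x)).
  apply/domain_subspaceP; split; first by apply: (cg_cone hG) => //; case: Zz.
  exact: (centralizer_stable hG hC hV).
move: Ozx; rewrite -scalemxAr linesZ// -[z]/(\val (mkGL zu)) -lines_preimage zE.
by rewrite lines_pt_vec.
Qed.

Lemma centralizer_inv g : ZGA g -> ZGA (PGL_inv g).
Proof.
move=> Zg; have ZAut : ZGA `<=` Aut Omega by move=> h [/GammaAut].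
have [z [zu [Lz zE]]] := lift_exists hD ZAut Zg.
have Zz : Z z by rewrite ZE.
have : Z (invmx z) by exact: (cgV (centralizing_group hG LA)).
rewrite ZE => -[[ziu Zzi] _]; rewrite -zE piPGL_inv.
by move: Zzi; congr (ZGA (\pi_(PGL R d) _)); exact: val_inj.
Qed.

Lemma domain_subspace_invariant : invariant_under ZGA OmegaV.
Proof.
move=> g Zg; apply/seteqP; split=> [_ [x Ox <-]|x Ox]; first exact: centralizer_act.
exists (pact (PGL_inv g) x).
  by apply: centralizer_act => //; exact: centralizer_inv.
by rewrite -pactM PGL_mulrV pact1.
Qed.

Lemma domain_subspace_core : OmegaV `<=` core.
Proof.
move=> x /domain_subspace_vec[c c0 [Ox xV]].
have [_] := fixed_subspace_core hO hG disc freeF hC hLA LAG lifts_abelian noFix limC hV Ox xV.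
by rewrite linesZ// lines_pt_vec.
Qed.

Lemma centralizerM g h : ZGA g -> ZGA h -> ZGA (PGL_mul g h).
Proof.
move=> [Gg gA] [Gh hA]; split; first exact: GammaM.
move=> a Aa; have ga : PGL_mul g a = PGL_mul a g := gA a Aa.
have ha : PGL_mul h a = PGL_mul a h := hA a Aa.
suff : PGL_mul (PGL_mul g h) a = PGL_mul a (PGL_mul g h) by [].
by rewrite -PGL_mulA ha !PGL_mulA ga.
Qed.

Lemma centralizer_orbit g x : ZGA g -> orbit ZGA (pact g x) = orbit ZGA x.
Proof.
move=> Zg; apply/seteqP; split=> _ [h Zh <-].
  by exists (PGL_mul h g); [exact: centralizerM|exact: pactM].
exists (PGL_mul h (PGL_inv g)).
  by apply: centralizerM => //; exact: centralizer_inv.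
by rewrite -pactM -PGL_mulA PGL_mulV PGL_mulr1.
Qed.

(** Recurrence on the interior points of [V] gives a compact set [N] meeting all
their orbits.  A filter on the orbit space lifts to a filter on [N], and a
cluster point of the lift has a cluster point of the filter as its class. *)
Lemma domain_subspace_cocompact : compact_quotient ZGA OmegaV.
Proof.
have [|N [cN NO NZ]] := @recurrence_compact R d f b O Z
    [set v | O v /\ v \in V] F _ hO freeF.
  move=> v vQ; apply: (fixed_subspace_recurrence hO hG disc freeF hC hLA LAG
    lifts_abelian noFix limC hV) => k; by case: (vQ k).
move=> FF PFF _.
pose rep (B : set (orbit_space ZGA OmegaV)) := [set v : 'cV[R]_d |
  [/\ N v, v \in V & exists (v0 : v != 0) (x : OmegaV),
    val x = pt_of v0 /\ B (\pi_(orbit_space ZGA OmegaV) x)]].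
have PG : ProperFilter (filter_from FF rep).
  apply: filter_from_proper.
    apply: filter_from_filter; first by exists setT; exact: filterT.
    move=> B B' FB FB'; exists (B `&` B'); first exact: filterI.
    move=> v [Nv vV [v0 [x [xv [Bx B'x]]]]].
    by split; split => //; exists v0, x.
  move=> B FB; have [z Bz] := filter_ex FB.
  pose x : OmegaV := repr z.
  have [c c0 [Ox xV]] := domain_subspace_vec (set_mem (valP x)).
  have [y Zy Ny] := NZ _ (conj Ox xV).
  have yV : y *m (c *: pt_vec (val x)) \in V by exact: (centralizer_stable hG hC hV).
  have y0 := cone_neq0 hO (NO _ Ny).
  have Zy' := Zy; rewrite ZE in Zy'; have [[yu Zyu] _] := Zy'.
  have Oy : OmegaV (pt_of y0).
    by have [_ /(linesP _ y0)] := proj2 (domain_subspaceP _) (conj (NO _ Ny) yV).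
  exists (y *m (c *: pt_vec (val x))); split => //; exists y0.
  exists (exist _ (pt_of y0) (mem_set Oy)); split => //.
  suff -> : \pi_(orbit_space ZGA OmegaV)
      (exist _ (pt_of y0) (mem_set Oy) : OmegaV) = z by [].
  rewrite -[RHS]reprK; apply/eqmodP/asboolP => /=.
  rewrite -[RHS](centralizer_orbit _ Zyu); congr orbit.
  pose x0 := pt_vec_neq0 (val x).
  have yx0 : y *m pt_vec (val x) != 0 := GL_act_neq0 (mkGL yu) x0.
  have yxE : pact (\pi_(PGL R d) (mkGL yu)) (val x) = pt_of yx0.
    by rewrite -(pact_pt_of (h := mkGL yu) x0 yx0) pt_of_pt_vec.
  rewrite [RHS]yxE.
  by apply/pt_ofP; exists c => //; rewrite scalemxAr.
have [|v [Nv clv]] := cN _ PG _.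
  by exists setT; [exact: filterT|move=> v []].
have vV : v \in V.
  have clV : closure [set w : 'cV[R]_d | w \in V] v.
    move=> B nB; have [|w [[_ wV _] Bw]] := clv (rep setT) B _ nB.
      by exists setT => //; exact: filterT.
    by exists w.
  have [u [uV uv]] := closure_seq clV.
  exact: (closed_vspace uV uv).
have Ov := NO _ Nv; have v0 := cone_neq0 hO Ov.
have OVv : OmegaV (pt_of v0).
  by have [_ /(linesP _ v0)] := proj2 (domain_subspaceP _) (conj Ov vV).
pose x : OmegaV := exist _ (pt_of v0) (mem_set OVv).
exists (\pi_(orbit_space ZGA OmegaV) x); split => // B U FB.
rewrite nbhsE => -[U' [oU' U'x] U'U].
have [S oS SU] : open (\pi_(orbit_space ZGA OmegaV) @^-1` U') by [].
have Sx : S (pt_of v0).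
  have : (set_val @^-1` S) x by rewrite SU.
  by [].
have [e e0 eS] := open_lines oS (proj2 (linesP _ v0) Sx).
have [|w [[_ _ [w0 [y [yw By]]]]]] := clv (rep B) (ball v e) _ (nbhsx_ballx v e e0).
  by exists B.
rewrite -ball_normE /= => /eS/(linesP _ w0) Sw.
exists (\pi_(orbit_space ZGA OmegaV) y); split => //; apply: U'U.
have : (set_val @^-1` S) y by rewrite /= /set_val /= yw.
by rewrite SU.
Qed.

Lemma eigenspace_neq0 j : W j != 0%VS.
Proof.
have [x [xW _ fx _]] := eigenspace_interior hO hC hV j.
apply: contraTneq fx => W0; move: xW; rewrite W0 memv0 => /eqP ->.
by rewrite ev0 ltxx.
Qed.

Lemma eigenspace_lift_invariant j : lift_invariant ZGA (W j).
Proof.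
move=> h Zh v vW; have ZAut : ZGA `<=` Aut Omega by move=> g [/GammaAut].
have [c c0 Lc] := lift_of_rep hD ZAut Zh; rewrite -ZE in Lc.
have := centralizer_stable_eigenspace hG hC hV Lc vW.
by rewrite -scalemxAl -{2}[\val h *m v]scale1r -(mulVf c0) -scalerA => /memvZ; exact.
Qed.

Lemma eigenspace_scaling j : acts_by_scaling A (W j).
Proof.
move=> h Ah; have [c c0 Lc] := lift_of_rep hD AAut Ah.
exists (c^-1 * chi j (c *: \val h)) => v vW.
rewrite -scalerA -(je_scal hV Lc vW) -scalemxAl scalerA mulVf// scale1r//.
Qed.

Definition factor_domain j : set (proj_space R d) :=
  [set x | exists2 c, c != 0 & factor_cone O V P j (c *: pt_vec x)].

Lemma factor_core j v : factor_cone O V P j v -> closure C v.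
Proof.
move=> [w [Ow wV ->]].
exact: (interior_components hO hG disc freeF hC hLA LAG lifts_abelian noFix limC hV).
Qed.

Lemma factor_clcone j v : factor_cone O V P j v -> K v.
Proof. by move=> /factor_core; exact: core_clcone hC _. Qed.

Lemma factor_W j v : factor_cone O V P j v -> v \in W j.
Proof. by move=> [w [_ wV ->]]; exact: (je_proj hV). Qed.

Lemma factorZ j c v : 0 < c -> factor_cone O V P j v ->
  factor_cone O V P j (c *: v).
Proof.
move=> c0 [w [Ow wV ->]]; exists (c *: w); split; first exact: (coneZ hO).
  exact: memvZ.
by rewrite scalemxAr.
Qed.

Lemma factor_near j v : factor_cone O V P j v -> exists2 e, 0 < e &
  forall u, u \in W j -> `|u| <= e -> factor_cone O V P j (v + u).
Proof.
move=> [w [Ow wV ->]]; have [e e0 eO] := cone_ball hO Ow.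
exists e => // u uW ue; exists (w + u); split; first exact: eO.
  by rewrite memvD// (je_mem hV uW).
by rewrite mulmxDr (je_id hV j uW) eqxx.
Qed.

(** If a relatively open factor contained [0], it would contain the opposite of a
small nonzero vector of the closed cone, which is sharp. *)
Lemma factor_neq0 j v : factor_cone O V P j v -> v != 0.
Proof.
move=> /[dup] Fv /factor_near[e e0 eF]; apply/eqP => v0.
have [x [xW Cx fx _]] := eigenspace_interior hO hC hV j.
have x0 : x != 0 by apply: contraTneq fx => ->; rewrite ev0 ltxx.
have [t t0 tx] : exists2 t, 0 < t & `|- (t *: x)| <= e.
  exists (e / `|x|); first by rewrite divr_gt0// normr_gt0.
  rewrite normrN normrZ gtr0_norm ?divr_gt0 ?normr_gt0// divfK//.
  by rewrite normr_eq0.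
have txW : - (t *: x) \in W j by rewrite memvN memvZ.
have := factor_clcone (eF _ txW tx); rewrite v0 add0r => KN.
have /eqP : t *: x = 0.
  apply: (clcone_antisym hO) KN.
  by apply: (clconeZ hO (ltW t0)); exact: (core_clcone hC).
by rewrite scaler_eq0 gt_eqF//= (negbTE x0).
Qed.

Lemma lines_factor j v : v != 0 ->
  lines (factor_domain j) v <-> exists2 c, c != 0 & factor_cone O V P j (c *: v).
Proof.
move=> v0; rewrite (linesP _ v0) /factor_domain /=.
have [a a0 ->] := pt_vec_pt_of v0; split=> -[c c0 Fc].
  by exists (c * a); rewrite ?mulf_neq0// -scalerA.
by exists (c / a); rewrite ?mulf_neq0 ?invr_eq0// scalerA divfK.
Qed.

Lemma cone_over_factor j v :
  cone_over f (factor_domain j) v <-> factor_cone O V P j v.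
Proof.
split=> [[fv /[dup] /lines_neq0 v0 /(lines_factor _ v0)[c c0 Fc]]|Fv].
  have := clcone_ge0 hO (factor_clcone Fc); rewrite evZ pmulr_lge0// => cge.
  have cgt : 0 < c by rewrite lt_neqAle eq_sym c0.
  rewrite -[v]scale1r -(mulVf c0) -scalerA; apply: factorZ => //.
  by rewrite invr_gt0.
have v0 := factor_neq0 Fv; split.
  by apply: (clcone_gt0 hO) => //; exact: factor_clcone Fv.
by apply/lines_factor => //; exists 1; rewrite ?oner_neq0 ?scale1r.
Qed.

Lemma factor_domain_closure j : factor_domain j `<=` closure Omega.
Proof.
move=> x [c c0 Fc]; have /(clcone_lines hD (factor_neq0 Fc))[_] := factor_clcone Fc.
by rewrite linesZ// lines_pt_vec.
Qed.

Lemma factor_domain_properly_convex j :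
  properly_convex_domain_in (W j) (factor_domain j).
Proof.
have FW : factor_domain j `<=` proj_of (W j).
  move=> x [c c0 /factor_W cW].
  by rewrite /proj_of /= -[pt_vec x]scale1r -(mulVf c0) -scalerA memvZ.
have Ff : factor_domain j `<=` affine_chart f.
  exact: subset_trans (@factor_domain_closure j) (closure_domain_chart hD).
split => //.
- apply: open_proj_subspace => // v /[dup] /(linesS FW)/proj_ofP[v0 vW].
  move=> /(lines_factor _ v0)[c c0 /[dup] Fc /factor_near[e e0 eF]].
  exists (Num.min (e / `|c|) `|v|).
    by rewrite lt_min divr_gt0 ?normr_gt0.
  move=> w wW; rewrite lt_min => /andP[we wv].
  have w0 : w != 0 by apply: contraTneq wv => ->; rewrite subr0 ltxx.
  apply/lines_factor => //; exists c => //.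
  have -> : c *: w = c *: v + c *: (w - v) by rewrite scalerBr addrCA subrr addr0.
  apply: eF; first by rewrite memvZ// memvB.
  by rewrite normrZ distrC mulrC -ler_pdivlMr ?normr_gt0// ltW.
- exists f; last split => //.
  + have [x /(dc_chart hD)] := dc_nonempty hD; apply: contraTneq => ->.
    by rewrite /affine_chart /= mul0mx mxE eqxx.
  + apply/affine_convexP => // u v /cone_over_factor[u' [Ou uV ->]].
    move=> /cone_over_factor[v' [Ov v'V ->]]; apply/cone_over_factor.
    exists (u' + v'); split; [exact: (coneD hO)|exact: memvD|].
    by rewrite mulmxDr.
  + apply/affine_boundedP => //; exists b; first exact: (dc_bound0 hD).
    by move=> v /cone_over_factor/factor_clcone; exact: (clcone_bound hO).
Qed.

Local Notation Union := (\bigcup_j factor_domain j).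
Local Notation H := (conv_hull Omega Union).

Lemma factors_closure : Union `<=` closure Omega.
Proof. by move=> x [j _ /factor_domain_closure]. Qed.

Lemma hull_subspace : H `<=` closure Omega `&` proj_of V.
Proof.
have CO : closure Omega `&` proj_of V `<=` closure Omega by move=> x [].
apply: smallest_sub; last first.
  move=> x [j _ Fx]; split; first exact: factor_domain_closure Fx.
  have [c c0 /factor_W/(je_mem hV) cV] := Fx.
  by rewrite /proj_of /= -[pt_vec x]scale1r -(mulVf c0) -scalerA memvZ.
split => //; apply/(proj_convexP hD CO) => u v [fu [u0 [Ou Vu]]] [fv [v0 [Ov Vv]]].
have fuv : 0 < ev f (u + v) by rewrite evD addr_gt0.
have uv0 : u + v != 0 by apply: (@ev_neq0 _ _ f); rewrite gt_eqF.
split => //; exists uv0; split.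
  apply/linesP; have [||_ //] := proj1 (proj_convexP hD (@subset_refl _ _))
    (closure_domain_convex hD) u v.
    by split => //; exists u0.
  by split => //; exists v0.
apply/linesP/proj_ofP; split => //; apply: memvD.
  by have /proj_ofP[] : lines (proj_of V) u by exists u0.
by have /proj_ofP[] : lines (proj_of V) v by exists v0.
Qed.

(** An interior point is the sum of its components, which lie over the factors. *)
Lemma interior_hull v : O v -> v \in V -> cone_over f H v.
Proof.
move=> Ov vV.
have : v = 0 \/ cone_over f H v.
  rewrite -(je_sum hV vV); elim/big_ind : _ => [|x y [->|Hx] [->|Hy]|j _].
  - by left.
  - by left; rewrite addr0.
  - by right; rewrite add0r.
  - by right; rewrite addr0.
  - by right; apply: (conv_hullD hD) => //; exact: factors_closure.
  - right; apply: (@cone_overS _ _ f (factor_domain j)).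
      by apply: subset_trans (@sub_gen_smallest _ _ _) => x Fx; exists j.
    by apply/cone_over_factor; exists v.
by case=> // v0; have := cone_neq0 hO Ov; rewrite v0 eqxx.
Qed.

Lemma hull_span : Span H = V.
Proof.
apply: Span_unique; split; first by move=> x /hull_subspace[].
move=> W' HW; apply/subvP => u uV.
have [w Ow wV] := fixed_subspace_meets hO hG disc freeF hC LAG lifts_abelian hV.
have inW v : O v -> v \in V -> v \in W'.
  by move=> Ov vV; have [_ /(linesS HW)/proj_ofP[]] := interior_hull Ov vV.
have [e e0 Oe] := cone_absorb hO u Ow.
have weW : w + e *: u \in W' by apply: inW => //; rewrite memvD// memvZ.
have := memvB weW (inW _ Ow wV).
rewrite addrAC subrr add0r => eW.
by rewrite -[u]scale1r -(mulVf (lt0r_neq0 e0)) -scalerA memvZ.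
Qed.

(** The hull contains the slice of the domain by [interior_hull], and the slice is
relatively open.  Conversely a relatively interior point of the hull remains in
the closed cone after subtracting a small multiple of an interior point, hence
is itself interior. *)
Lemma domain_subspace_join : OmegaV = relint H.
Proof.
rewrite /relint hull_span; apply/seteqP; split=> x.
  move=> Ox; have [c c0 [Ocx cxV]] := domain_subspace_vec Ox.
  have v0 := cone_neq0 hO Ocx.
  have -> : x = pt_of v0.
    rewrite -[LHS]pt_of_pt_vec; apply/pt_ofP; exists c^-1; first by rewrite invr_eq0.
    by rewrite scalerA mulVf// scale1r.
  apply/nbhs_proj_subspace => //.
  have [e e0 eO] := cone_ball hO Ocx.
  exists e => // w wV /ltW we.
  have Ow : O w by rewrite -(subKr (c *: pt_vec x) w); apply: eO; rewrite normrN.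
  by have [_] := interior_hull Ow wV.
move=> intx; have Hx : H x := interior_subset intx.
have Hf : H `<=` affine_chart f.
  by move=> y /hull_subspace[/(closure_domain_chart hD)].
have [c c0 [fcx Hcx]] := lines_cone_sign Hf (proj2 (lines_pt_vec _ x) Hx).
have v0 := lines_neq0 Hcx.
have xE : x = pt_of v0.
  rewrite -[LHS]pt_of_pt_vec; apply/pt_ofP; exists c^-1; first by rewrite invr_eq0.
  by rewrite scalerA mulVf// scale1r.
have cxV : c *: pt_vec x \in V.
  have HV : H `<=` proj_of V by move=> y /hull_subspace[].
  by have /proj_ofP[] := linesS HV Hcx.
move: intx; rewrite xE => /(nbhs_proj_subspace _ v0 cxV)[e e0 eH].
have [w Ow wV] := fixed_subspace_meets hO hG disc freeF hC LAG lifts_abelian hV.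
have fw := cone_gt0 hO Ow.
have [t t0 [tf te]] : exists2 t, 0 < t & 0 < ev f (c *: pt_vec x - t *: w) /\
    `|t *: w| < e.
  have nw : 0 < `|w| by rewrite normr_gt0 (cone_neq0 hO).
  exists (Num.min (ev f (c *: pt_vec x) / ev f w) (e / `|w|) / 2).
    by rewrite divr_gt0// lt_min !divr_gt0.
  set t := _ / 2.
  have tlt : t < Num.min (ev f (c *: pt_vec x) / ev f w) (e / `|w|).
    by rewrite /t ltr_pdivrMr// ltr_pMr ?ltr1n// lt_min !divr_gt0.
  have tgt : 0 < t by rewrite divr_gt0// lt_min !divr_gt0.
  move: tlt; rewrite lt_min !ltr_pdivlMr// => /andP[t1 t2].
  by rewrite evB [ev f (t *: w)]evZ subr_gt0 normrZ gtr0_norm.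
have Hw : lines H (c *: pt_vec x - t *: w).
  apply: eH; first by rewrite memvB// memvZ.
  by rewrite opprB addrCA subrr addr0.
have Kw : K (c *: pt_vec x - t *: w).
  apply/(clcone_lines hD (lines_neq0 Hw)); split => //.
  by apply: linesS Hw => y /hull_subspace[].
have Ocx : O (c *: pt_vec x).
  rewrite -(subrK (t *: w) (c *: pt_vec x)); apply: (coneDcl hO) => //.
  exact: (coneZ hO).
by have [_ /(linesP _ v0)] := proj2 (domain_subspaceP _) (conj Ocx cxV).
Qed.

Lemma fixed_domain_structure :
  [/\ [/\ OmegaV !=set0, invariant_under ZGA OmegaV
        & properly_convex_domain_in V OmegaV],
      OmegaV `<=` core,
      compact_quotient ZGA OmegaV
    & exists (m : nat) (W : 'I_m -> {vspace 'cV[R]_d})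
        (F : 'I_m -> set (proj_space R d)),
      [/\ [/\ (2 <= m)%N, forall j, W j != 0%VS, directv (\sum_j W j)
            & (\sum_j W j)%VS = V],
          forall j, lift_invariant ZGA (W j),
          forall j, acts_by_scaling A (W j),
          forall j, properly_convex_domain_in (W j) (F j)
            /\ F j `<=` closure Omega
        & OmegaV = relint (conv_hull Omega (\bigcup_j F j))]].
Proof.
split.
- split; [exact: domain_subspace_nonempty|exact: domain_subspace_invariant|].
  exact: domain_subspace_properly_convex.
- exact: domain_subspace_core.
- exact: domain_subspace_cocompact.
exists m, W, factor_domain; split.
- split.
  + exact: (eigenspaces_ge2 hO hG disc freeF hC LAG lifts_abelian noFix hV).
  + exact: eigenspace_neq0.
  + exact: (eigenspaces_direct hV).
  + exact: (eigenspaces_sum hV).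
- exact: eigenspace_lift_invariant.
- exact: eigenspace_scaling.
- move=> j; split; first exact: factor_domain_properly_convex.
  exact: factor_domain_closure.
- exact: domain_subspace_join.
Qed.

End FixedDomain.

Theorem theorem4p1 (R : realType) (d : nat)
  (Omega : set (proj_space R d)) (Gamma A : set (PGL R d))
  (hOmega : properly_convex_domain Omega)
  (hGamma : convex_cocompact Omega Gamma)
  (hA : is_subgroup A) (hAGamma : A `<=` Gamma)
  (hAinf : infinite_set A) (hAab : abelian_set A) :
  let Z := centralizer Gamma A in
  let V := Span (fixed_points A (closure (limit_core Omega Gamma))) in
  let OmegaV := Omega `&` proj_of V in
  [/\ [/\ OmegaV !=set0, invariant_under Z OmegaV
        & properly_convex_domain_in V OmegaV],
      OmegaV `<=` limit_core Omega Gamma,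
      compact_quotient Z OmegaV
    & exists (m : nat) (W : 'I_m -> {vspace 'cV[R]_d})
        (F : 'I_m -> set (proj_space R d)),
      [/\ [/\ (2 <= m)%N, forall j, W j != 0%VS, directv (\sum_j W j)
            & (\sum_j W j)%VS = V],
          forall j, lift_invariant Z (W j),
          forall j, acts_by_scaling A (W j),
          forall j, properly_convex_domain_in (W j) (F j)
            /\ F j `<=` closure Omega
        & OmegaV = relint (conv_hull Omega (\bigcup_j F j))]].
Proof.
move=> Z V OmegaV.
have [oOmega [f _ [Omegaf cOmega bOmega]]] := hOmega.
have [[sGamma GammaAut _ dGamma] [core0 ccore]] := hGamma.
have [b b0 bO] := proj1 (affine_boundedP Omegaf) bOmega.
have hD : domain_chart Omega f b.
  by split => //; have [x [_ Ox]] := core0; exists x.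
have [F [FU freeF]] := free_ultrafilter.
have AAut : A `<=` Aut Omega := subset_trans hAGamma GammaAut.
have hO := domain_sharp_cone hD.
have hLA := lifts_group hD hA AAut.
have hC : cocompact_core (cone_over f Omega) (lifts Omega f Gamma) F
    (cone_over f (limit_core Omega Gamma)).
  exact: (limit_core_cocompact hD sGamma GammaAut freeF core0 ccore).
have ZA z a : centralizing (lifts Omega f Gamma) (lifts Omega f A) z ->
    lifts Omega f A a -> z *m a = a *m z by move=> [_]; exact.
have [m [W [P [chi hV]]]] := joint_eigenspaces_exist hO hLA ZA
  (@core_clcone _ _ _ _ _ _ hC)
  (@eigenray_Span _ _ _ _ _ hD _ _ GammaAut hA hAGamma)
  (@Span_eigenrays _ _ _ _ _ hD _ _ GammaAut hA hAGamma).
exact: (fixed_domain_structure hD sGamma GammaAut dGamma core0 ccore hA hAGamma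
  hAinf hAab freeF hV).
Qed.
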